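(* Let $n,m\ge1$ be integers. Suppose that the degree $m$ part $G_{m,n}$ of the grove algebra $G_n$ has a basis $\{b_\pi\}$ indexed by the staircase plane partitions $\pi\in\mathcal{PP}^m(\delta_{n-1})$ of size $n-1$ and height $m$, such that the induced action of the cyclic generator $c$ of $\langle c\rangle\simeq\mathbb{Z}/2n\mathbb{Z}$ on $G_{m,n}$ corresponds to promotion on basis elements: $c\cdot b_\pi=b_{\mathrm{Pr}(\pi)}$ for all $\pi\in\mathcal{PP}^m(\delta_{n-1})$. Let $\kappa=2$ if $n\ge3$ and $\kappa=1$ if $n\le2$, and let $$\Omega_{\delta_{n-1}}(m;q)=\prod_{\alpha}\frac{1-q^{\kappa(m-\alpha)}}{1-q^{-\kappa\alpha}}=\prod_{1\le i\le j\le n-1}\frac{1-q^{\kappa\left(m+\frac{i+j}{2}\right)}}{1-q^{\kappa\frac{i+j}{2}}},$$ where $\alpha$ runs over the roots, with multiplicity, of the order polynomial of $\delta_{n-1}$. Then $\Omega_{\delta_{n-1}}(m;q)$ is a polynomial in $q$ with nonnegative integer coefficients, $\langle\mathrm{Row}\rangle\simeq\mathbb{Z}/\kappa n\mathbb{Z}$, and the triple $(\mathcal{PP}^m(\delta_{n-1}),\ \langle\mathrm{Row}\rangle\simeq\mathbb{Z}/\kappa n\mathbb{Z},\ \Omega_{\delta_{n-1}}(m;q))$ exhibits cyclic sieving; that is, for every integer $k\ge0$, $$\#\{\pi\in\mathcal{PP}^m(\delta_{n-1}):\mathrm{Row}^k(\pi)=\pi\}=\Omega_{\delta_{n-1}}(m;\zeta^k),\qquad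 \zeta=e^{2\pi i/(\kappa n)}.$$
   Context: Staircase plane partitions. For $N,m\ge1$, $\mathcal{PP}^m(\delta_N)$ is the set of arrays $\pi=(\pi_{i,j})$ of nonnegative integers indexed by $i,j\ge1$, $i+j\le N+1$, weakly decreasing along rows and down columns ($\pi_{i,j}\ge\pi_{i+1,j}$, $\pi_{i,j}\ge\pi_{i,j+1}$), with $\pi_{1,1}\le m$. For $N=0$ there is a single (empty) such array. The order polynomial of $\delta_N$ is the polynomial in $m$ with value $\#\mathcal{PP}^m(\delta_N)$ at each $m\ge1$; it is known to equal $\prod_{1\le i\le j\le N}\frac{i+j+2m}{i+j}$, so its roots with multiplicity are $-\frac{i+j}2$, $1\le i\le j\le N$. The toggle $\tau_{i,j}$ on $\mathcal{PP}^m(\delta_N)$ changes only the $(i,j)$ entry, replacing $\pi_{i,j}$ by $\min(\pi_{i,j-1},\pi_{i-1,j})+\max(\pi_{i+1,j},\pi_{i,j+1})-\pi_{i,j}$, with conventions $\pi_{0,j}:=m$, $\pi_{i,0}:=m$, $\pi_{i,j}:=0$ if $i+j>N+1$. Let $R_k$ ($1\le k\le N$) be the composition of the commuting toggles $\tau_{i,j}$ with $i+j-1=k$, and $F_k$ ($-N+1\le k\le N-1$) the composition of the commuting toggles with $j-i=k$. Rowmotion is $\mathrm{Row}:=R_N\cdots R_2\cdot R_1$ and promotion is $\mathrm{Pr}:=F_{N-1}\cdot F_{N-2}\cdots F_{-N+1}$ (compositions of maps, rightmost applied first). Both are the identity when $N=0$. Here $N=n-1$. Grove algebra. For $1\le i\le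 2n-2$ let $w_i\in\mathbb{C}^{2n}$ be the vector with $1$ in positions $i$ and $i+2$ and $0$ elsewhere, and let $V=\mathrm{span}(w_1,\dots,w_{2n-2})\subset\mathbb{C}^{2n}$, a $(2n-2)$-dimensional space with symplectic form $\Lambda$ given in this basis by $\Lambda(w_i,w_{i+1})=(-1)^{i+1}=-\Lambda(w_{i+1},w_i)$ and $\Lambda(w_i,w_j)=0$ if $|i-j|\ne1$. Let $\mathrm{LG}(n-1,V)$ be the Lagrangian Grassmannian of $(n-1)$-dimensional $\Lambda$-isotropic subspaces $W\subset V$. Viewed inside $\mathrm{Gr}(n-1,2n)$, it is identified (by a theorem of Bychkov, Gorbounov, Kazakov and Talalaev) with the electroid variety $\mathcal{X}_n$, the Zariski closure of the image of Lam's embedding of the space of circular planar electrical networks with $n$ boundary vertices. The grove algebra $G_n=\bigoplus_{m\ge0}G_{m,n}$ is the homogeneous coordinate ring of $\mathcal{X}_n$ in the Plücker embedding of $\mathrm{Gr}(n-1,2n)$, i.e. the polynomial ring over $\mathbb{C}$ in the Plücker coordinates $\Delta_I$, $I\in\binom{[2n]}{n-1}$, modulo the ideal of $\mathcal{X}_n$, graded by $\deg\Delta_I=1$. Cyclic action. The linear map $c\colon\mathbb{C}^{2n}\to\mathbb{C}^{2n}$, $c\cdot(x_1,\dots,x_{2n})=(x_2,\dots,x_{2n},(-1)^nx_1)$, preserves $V$ and sends isotropic subspaces of $V$ to isotropic subspaces, so it acts on $\mathcal{X}_n$. The induced action on $G_n$ is by graded algebra automorphisms, given by pulling back functions along $c$;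 on Plücker coordinates it is $c\cdot\Delta_I=\Delta_{I+1}$, where $I+1$ is the cyclic shift of $I$ modulo $2n$. This is an action of $\mathbb{Z}/2n\mathbb{Z}$. *)

(* Defs.v *)
(* The real numbers are any [R : realType], the complex numbers [R[i]]. *)
From HB Require Import structures.
From mathcomp Require Import all_boot all_order all_algebra all_fingroup.
From mathcomp Require Import all_solvable ring zify.
From mathcomp Require Import ring_quotient generic_quotient boolp reals.
(* Not imported: the notations of mathcomp-analysis clash with those of mpoly. *)
From mathcomp Require trigo.
From mathcomp Require Import mpoly complex.

Set Implicit Arguments.
Unset Strict Implicit.
Unset Printing Implicit Defensive.

Import Order.TTheory GRing.Theory Num.Theory.

Section PlanePartitions.
Variables N m : nat.

(* The cells (i, j) with i, j >= 1 and i + j <= N + 1, numbered from 1. *)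
Definition cell : predArgType :=
  {p : 'I_N.+1 * 'I_N.+1 | [&& 0 < p.1, 0 < p.2 & p.1 + p.2 <= N.+1]}.

Definition crow (c : cell) : nat := (val c).1.
Definition ccol (c : cell) : nat := (val c).2.

(* In a plane partition every entry is at most the (1, 1) entry, which is at
   most m; hence the codomain [0, m]. *)
Definition filling : predArgType := {ffun cell -> 'I_m.+1}.

(* Entries at arbitrary positions, with the boundary conventions used by the
   toggles: m in row 0 and in column 0, and 0 beyond the staircase. *)
Definition entry (f : filling) (i j : nat) : nat :=
  if (i == 0) || (j == 0) then m
  else if [pick c | (crow c == i) && (ccol c == j)] is Some c then f c else 0.

Definition is_pp (f : filling) : bool :=
  [forall c, (entry f (crow c).+1 (ccol c) <= f c)
             && (entry f (crow c) (ccol c).+1 <= f c)].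

Definition PP : predArgType := {f : filling | is_pp f}.

Definition upper (f : filling) (c : cell) : nat :=
  minn (entry f (crow c) (ccol c).-1) (entry f (crow c).-1 (ccol c)).

Definition lower (f : filling) (c : cell) : nat :=
  maxn (entry f (crow c).+1 (ccol c)) (entry f (crow c) (ccol c).+1).

(* The subtraction is exact on plane partitions, see [pp_bounds]. *)
Definition toggle_value (f : filling) (c : cell) : nat :=
  upper f c + lower f c - f c.

Definition toggle_filling (c : cell) (f : filling) : filling :=
  [ffun d => if d == c then inord (toggle_value f c) else f d].

Lemma entry_cell f c : entry f (crow c) (ccol c) = f c.
Proof.
rewrite /entry; case: c => -[a b] /= h; rewrite /crow /ccol /=.
case/and3P: (h) => /= a0 b0 _.
rewrite !eqn0Ngt a0 b0 /=.
case: pickP => [[[a' b'] h'] /= /andP[/eqP e1 /eqP e2]|/(_ (Sub (a, b) h))].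
  by congr (nat_of_ord (f _)); apply/val_inj; congr pair; apply/val_inj.
by rewrite /= !eqxx.
Qed.

Lemma entry_le f i j : entry f i j <= m.
Proof.
by rewrite /entry; case: ifP => // _; case: pickP => //= c _; rewrite -ltnS.
Qed.

Lemma entry0l f j : entry f 0 j = m. Proof. by []. Qed.
Lemma entry0r f i : entry f i 0 = m. Proof. by rewrite /entry orbT. Qed.

Lemma entryP f i j : 0 < i -> 0 < j ->
  (exists2 c, crow c = i /\ ccol c = j & entry f i j = f c)
  \/ (forall c, (crow c, ccol c) != (i, j)) /\ entry f i j = 0.
Proof.
move=> i0 j0; rewrite /entry !eqn0Ngt i0 j0 /=.
case: pickP => [c /andP[/eqP h1 /eqP h2]|h]; first by left; exists c.
by right; split=> // c; rewrite xpair_eqE h.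
Qed.

Lemma cell_inj c d : crow c = crow d -> ccol c = ccol d -> c = d.
Proof.
case: c d => -[a b] h [[a' b'] h']; rewrite /crow /ccol /= => e1 e2.
by apply/val_inj; congr pair; apply/val_inj.
Qed.

Lemma crow_gt0 c : 0 < crow c. Proof. by case: c => -[a b] /= h; case/and3P: (h). Qed.
Lemma ccol_gt0 c : 0 < ccol c. Proof. by case: c => -[a b] /= h; case/and3P: (h). Qed.

Lemma is_ppP f : is_pp f ->
  forall i j, (0 < i) || (0 < j) ->
  (entry f i.+1 j <= entry f i j) * (entry f i j.+1 <= entry f i j).
Proof.
move=> /forallP h [|i] [|j] // _; rewrite ?entry0l ?entry0r ?entry_le //.
have [[c [<- <-]] ->|[hn e0]] := entryP f (ltn0Sn i) (ltn0Sn j).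
  by have /andP[-> ->] := h c.
rewrite e0.
have no c : crow c >= i.+1 -> ccol c >= j.+1 -> False.
  case: c => -[a b] hc; rewrite /crow /ccol /= => ha hb.
  have [_ _ le] := and3P hc; rewrite /= in le.
  have iN : i.+1 < N.+1 by apply: leq_ltn_trans ha _.
  have jN : j.+1 < N.+1 by apply: leq_ltn_trans hb _.
  have hc' : [&& 0 < (Ordinal iN, Ordinal jN).1, 0 < (Ordinal iN, Ordinal jN).2
     & (Ordinal iN, Ordinal jN).1 + (Ordinal iN, Ordinal jN).2 <= N.+1].
    by rewrite /= (leq_trans _ le) // leq_add.
  by have := hn (Sub (Ordinal iN, Ordinal jN) hc'); rewrite /crow /ccol /= eqxx.
split.
  have [[c [e1 e2] _]|[_ ->]//] := entryP f (ltn0Sn i.+1) (ltn0Sn j).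
  by case: (no c); rewrite ?e1 ?e2.
have [[c [e1 e2] _]|[_ ->]//] := entryP f (ltn0Sn i) (ltn0Sn j.+1).
by case: (no c); rewrite ?e1 ?e2.
Qed.

Lemma pp_bounds f c : is_pp f -> lower f c <= f c <= upper f c.
Proof.
move=> hf; have p := is_ppP hf.
rewrite /lower /upper -entry_cell geq_max leq_min.
have hi0 := crow_gt0 c; have hj0 := ccol_gt0 c.
rewrite !(p (crow c) (ccol c)) ?hi0 //=.
have := p (crow c) (ccol c).-1; have := p (crow c).-1 (ccol c).
rewrite !prednK // hj0 hi0 orbT => /(_ isT)[-> _] /(_ isT)[_ ->].
by [].
Qed.

Lemma toggle_fillingE f c : is_pp f ->
  toggle_filling c f c = upper f c + lower f c - f c :> nat.
Proof.
move=> hf; rewrite ffunE eqxx /toggle_value inordK // ltnS.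
have /andP[h1 h2] := pp_bounds c hf.
rewrite leq_subLR addnC leq_add //.
by rewrite /upper geq_min entry_le.
Qed.

Lemma entry_toggle f c i j : (crow c, ccol c) != (i, j) ->
  entry (toggle_filling c f) i j = entry f i j.
Proof.
move=> h; rewrite /entry; case: ifP => // _.
case: pickP => // d /andP[/eqP e1 /eqP e2]; rewrite ffunE.
by case: eqP => // e; move: h; rewrite -e e1 e2 eqxx.
Qed.

Lemma lower_toggle f c : lower (toggle_filling c f) c = lower f c.
Proof. by rewrite /lower !entry_toggle // xpair_eqE; lia. Qed.

Lemma upper_toggle f c : upper (toggle_filling c f) c = upper f c.
Proof.
have := crow_gt0 c; have := ccol_gt0 c => ? ?.
by rewrite /upper !entry_toggle // xpair_eqE; lia.
Qed.

Lemma toggle_pp c f : is_pp f -> is_pp (toggle_filling c f).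
Proof.
move=> hf; apply/forallP => d.
have /andP[l1 l2] := pp_bounds c hf.
have tc := toggle_fillingE c hf.
have tlo : lower f c <= toggle_filling c f c by rewrite tc; lia.
have thi : toggle_filling c f c <= upper f c by rewrite tc; lia.
have [->|ndc] := eqVneq d c.
  by have := tlo; rewrite -lower_toggle geq_max.
have fd : toggle_filling c f d = f d by rewrite ffunE (negPf ndc).
rewrite fd; have /andP[h1 h2] := forallP hf d.
apply/andP; split.
  have [/eqP[e1 e2]|/entry_toggle->//] := boolP ((crow c, ccol c) == ((crow d).+1, ccol d)).
  rewrite -e1 -e2 entry_cell (leq_trans thi) // /upper geq_min e1 e2 /= entry_cell.
  by rewrite leqnn orbT.
have [/eqP[e1 e2]|/entry_toggle->//] := boolP ((crow c, ccol c) == (crow d, (ccol d).+1)).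
rewrite -e1 -e2 entry_cell (leq_trans thi) // /upper geq_min e1 e2 /= entry_cell.
by rewrite leqnn.
Qed.

Definition toggle (c : cell) (p : PP) : PP :=
  Sub (toggle_filling c (val p)) (toggle_pp c (valP p)).

Lemma toggleK c : involutive (toggle c).
Proof.
move=> [f hf]; apply/val_inj/ffunP => d /=.
have [->|ndc] := eqVneq d c; last by rewrite !ffunE (negPf ndc).
apply/val_inj => /=.
rewrite toggle_fillingE ?toggle_pp // lower_toggle upper_toggle toggle_fillingE //.
have /andP[l1 l2] := pp_bounds c hf.
by rewrite subKn // (leq_trans l2) ?leq_addr.
Qed.

Definition toggle_perm (c : cell) : {perm PP} := perm (inv_inj (toggleK c)).

(* In {perm _}, [s * t] applies s first. Toggles in one product below commute,
   so the order of enumeration of the cells does not matter. *)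
Definition Rk (k : nat) : {perm PP} :=
  (\prod_(c : cell | crow c + ccol c - 1 == k) toggle_perm c)%g.

Definition Fk (k : int) : {perm PP} :=
  (\prod_(c : cell | ((ccol c)%:Z - (crow c)%:Z == k)%R) toggle_perm c)%g.

(* R_1 is applied first. *)
Definition Row : {perm PP} := (\prod_(1 <= k < N.+1) Rk k)%g.

(* k = t - N + 1 runs from - N + 1 to N - 1, and F_(- N + 1) is applied first. *)
Definition Pr : {perm PP} :=
  (\prod_(0 <= t < N.*2.-1) Fk (t%:Z - N%:Z + 1)%R)%g.
End PlanePartitions.

Local Open Scope ring_scope.
Local Open Scope complex_scope.
Local Open Scope quotient_scope.

Section Plucker.
Variable n : nat.

(* Plucker indices: (n - 1)-subsets of a 2n-element set; all positions are
   numbered from 0 from here on. *)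
Definition pindex : predArgType := {I : {set 'I_n.*2} | #|I| == n.-1}.

(* [enum] lists ordinals increasingly: pcol I k is the k-th smallest element. *)
Definition pcol (I : pindex) (k : 'I_n.-1) : 'I_n.*2 :=
  enum_val (cast_ord (esym (eqP (valP I))) k).

Lemma ishift_subproof (I : pindex) : #|[set ordS i | i in val I]| == n.-1.
Proof. by rewrite card_imset ?(eqP (valP I)) //; apply: ordS_inj. Qed.

(* I + 1, modulo 2n. *)
Definition ishift (I : pindex) : pindex := exist (fun J : {set 'I_n.*2} => #|J| == n.-1) _ (ishift_subproof I).

Lemma pcol_in I k : pcol I k \in val I. Proof. exact: enum_valP. Qed.

Lemma enum_ord_sorted q (A : {set 'I_q}) :
  sorted (fun x y : 'I_q => x < y)%N (enum A).
Proof.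
have h : sorted (fun x y : 'I_q => x < y)%N (enum 'I_q).
  have := iota_ltn_sorted 0 q; rewrite -val_enum_ord.
  by rewrite sorted_map.
apply: subseq_sorted h; first by move=> y x z; apply: ltn_trans.
by rewrite enumT; apply: filter_subseq.
Qed.

Lemma pcol_mono I (i j : 'I_n.-1) : (i < j)%N -> (pcol I i < pcol I j)%N.
Proof.
move=> ij; rewrite /pcol.
have x0 := pcol I i; rewrite !(enum_val_nth x0) /=.
have sz : size (enum (val I)) = n.-1 by rewrite -cardE (eqP (valP I)).
apply: (sorted_ltn_nth _ x0 (enum_ord_sorted _)); rewrite ?inE ?sz //.
by move=> y x z; apply: ltn_trans.
Qed.

Lemma pcol_uniq (I : pindex) (g : 'I_n.-1 -> 'I_n.*2) :
  {homo g : i j / (i < j)%N} -> (forall k, g k \in val I) -> g =1 pcol I.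
Proof.
move=> hg gI.
have mono_inj (f : 'I_n.-1 -> 'I_n.*2) : {homo f : i j / (i < j)%N} -> injective f.
  move=> hf i j e; apply/val_inj; case: (ltngtP i j) => // /hf; rewrite e ltnn //.
have tr : transitive (fun x y : 'I_n.*2 => x < y)%N by move=> y x z; apply: ltn_trans.
have irr : irreflexive (fun x y : 'I_n.*2 => x < y)%N by move=> x; rewrite ltnn.
have so (f : 'I_n.-1 -> 'I_n.*2) : {homo f : i j / (i < j)%N} ->
   sorted (fun x y : 'I_n.*2 => x < y)%N (map f (enum 'I_n.-1)).
  move=> hf; rewrite sorted_map.
  have := enum_ord_sorted [set: 'I_n.-1]; rewrite -(eq_enum (in_set predT)).
  by apply: sub_sorted => x y /=; apply: hf.
have key (f : 'I_n.-1 -> 'I_n.*2) : {homo f : i j / (i < j)%N} ->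
   (forall k, f k \in val I) -> map f (enum 'I_n.-1) =i val I.
  move=> hf fI.
  have us : uniq (map f (enum 'I_n.-1)) by rewrite map_inj_uniq ?enum_uniq //; apply: mono_inj.
  have [||_ e] := @uniq_min_size _ _ (enum (val I)) us.
  - by move=> x /mapP[k _ ->]; rewrite mem_enum.
  - by rewrite -cardE (eqP (valP I)) size_map size_enum_ord.
  by move=> x; rewrite e mem_enum.
have E : map g (enum 'I_n.-1) = map (pcol I) (enum 'I_n.-1).
  apply: (irr_sorted_eq tr irr); first exact: so.
    by apply: so; apply: pcol_mono.
  by move=> x; rewrite (key g) // (key (pcol I)) //; [apply: pcol_mono|apply: pcol_in].
by move=> k; move/eq_in_map: E; apply; rewrite mem_enum.
Qed.

End Plucker.

Section Variety.
Variables (R : realType) (n : nat).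
Local Notation C := R[i].
Local Notation N := (n.-1.*2).

(* The rows of wmx are the basis vectors w of V. *)
Definition wmx : 'M[C]_(N, n.*2) :=
  \matrix_(i, j) ((j == i :> nat) || (j == i.+2 :> nat))%:R.

(* With positions numbered from 0 the sign (-1)^(i+1) becomes (-1)^i. *)
Definition Lambda : 'M[C]_N :=
  \matrix_(i, j) (if j == i.+1 :> nat then (-1) ^+ i
                  else if i == j.+1 :> nat then - (-1) ^+ j else 0).

(* A point W of LG(n-1, V) is given by the coordinates in the basis w of a basis
   of W (the rows of A); in C^2n, W is then the row space of A *m wmx. *)
Definition lagrangian (A : 'M[C]_(n.-1, N)) : bool :=
  row_free A && (A *m Lambda *m A^T == 0).

Definition plucker (I : pindex n) (M : 'M[C]_(n.-1, n.*2)) : C :=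
  \det (colsub (pcol I) M).

(* The map c, acting on row vectors: see [mul_cmx]. *)
Definition cmx : 'M[C]_(n.*2) :=
  \matrix_(i, j) (if i == j.+1 :> nat then 1
                  else if (i == 0 :> nat) && (j.+1 == n.*2) then (-1) ^+ n else 0).

Lemma mul_cmx k (M : 'M[C]_(k, n.*2)) i j :
  (M *m cmx) i j = (if j.+1 == n.*2 then (-1) ^+ n else 1) * M i (ordS j).
Proof.
rewrite mxE (bigD1 (ordS j)) //= big1 ?addr0.
  rewrite !mxE mulrC; congr (_ * _) => /=.
  have := ltn_ord j; rewrite leq_eqVlt => /orP[/eqP e|l].
    by rewrite [X in (X %% _)%N]e modnn /= e eqxx.
  by rewrite modn_small // eqxx ltn_eqF.
move=> k' nk; rewrite mxE; case: eqP => [e|_].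
  case/eqP: nk; apply/val_inj => /=.
  by rewrite e modn_small // -e.
case: andP => [[/eqP e0 /eqP ej]|]; last by rewrite mulr0.
by case/eqP: nk; apply/val_inj; rewrite /= e0 ej modnn.
Qed.

(* Matrix of the restriction of c to V, in the basis w. *)
Definition cVmx : 'M[C]_N := \matrix_(i, j)
  (if i == j.+1 :> nat then 1
   else if (i == 0 :> nat) && odd j then (-1) ^+ j./2 else 0).

Definition bb (i j : nat) : C := (if i == j.+1 :> nat then 1
   else if (i == 0 :> nat) && odd j then (-1) ^+ j./2 else 0).

Lemma wmx_sum (F : nat -> C) (j : 'I_n.*2) :
  \sum_(k < N) F k * wmx k j =
    (if (j < N)%N then F j else 0) + (if (1 < j)%N then F j.-2 else 0).
Proof.
under eq_bigr => k _.
  rewrite mxE; have -> : (((j == k :> nat) || (j == k.+2 :> nat))%:R : C)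
     = (k == j :> nat)%:R + (k == j.-2 :> nat)%:R * (1 < j)%N%:R.
    case: (@eqP _ (j : nat) (k : nat)) => [e|ne].
      rewrite e eqxx /=; case: ltnP => h; rewrite ?mulr0 ?addr0 //.
      by rewrite (_ : _ == _ = false) ?mul0r ?addr0 //; apply/negP => /eqP; lia.
    rewrite /= (_ : (k == j :> nat) = false) ?add0r -?natrM ?mulnb.
      by congr (_%:R); congr nat_of_bool; apply/idP/idP; lia.
    by apply/eqP => e; case: ne.
  rewrite mulrDr mulrA. over.
rewrite big_split /= -mulr_suml; congr (_ + _).
  case: ltnP => h.
    rewrite (bigD1 (Ordinal h)) //= eqxx mulr1 big1 ?addr0 // => k nk.
    by rewrite (_ : _ == _ = false) ?mulr0 //; apply: contraNF nk => /eqP e; apply/eqP/val_inj.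
  rewrite big1 // => k _; rewrite (_ : _ == _ = false) ?mulr0 //.
  by have := ltn_ord k; apply: contraTF => /eqP; lia.
case: ltnP => h; last by rewrite mulr0.
have h' : (j.-2 < N)%N by have := ltn_ord j; lia.
rewrite mulr1 (bigD1 (Ordinal h')) //= eqxx mulr1 big1 ?addr0 // => k nk.
by rewrite (_ : _ == _ = false) ?mulr0 //; apply: contraNF nk => /eqP e; apply/eqP/val_inj.
Qed.

Lemma wmx_cmx : wmx *m cmx = cVmx *m wmx.
Proof.
apply/matrixP => i j; rewrite mul_cmx [RHS]mxE.
have hi := ltn_ord i; have hj := ltn_ord j.
rewrite (eq_bigr (fun k : 'I_N => bb i k * wmx k j)); last by move=> k _; rewrite [cVmx _ _]mxE.
rewrite (wmx_sum (bb i)) mxE /bb /=.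
have [ej|nj] := eqVneq j.+1 n.*2.
  rewrite ej modnn /=.
  have -> : (n.*2 <= N)%N = false by lia.
  have -> : (1 < j)%N by lia.
  have -> : (i == j.-2.+1 :> nat) = false by apply/eqP; lia.
  have -> : odd j.-2 by lia.
  have -> : (0 == i.+2 :> nat) = false by [].
  rewrite orbF andbT add0r eq_sym; case: eqP => _; last by rewrite mulr0.
  rewrite mulr1 (_ : (-1) ^+ n = (-1) ^+ j.-2./2.+2); first by rewrite !exprS; ring.
  by congr (_ ^+ _); lia.
have lj : (j.+1 < n.*2)%N by lia.
rewrite modn_small // mul1r.
have [i0|ni] := eqVneq (i : nat) 0%N.
  rewrite i0 /= eqSS.
  have [oj|ej] := boolP (odd j); last first.
    have -> : odd j.-2 = false by lia.
    have -> : (j == 1 :> nat) = false by apply/negP => /eqP e; rewrite e in ej.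
    by rewrite !if_same addr0.
  have -> : (j < N)%N by lia.
  have [->|j1] := eqVneq (j : nat) 1%N; first by rewrite addr0.
  have -> : (1 < j)%N by lia.
  have -> : odd j.-2 by lia.
  have -> : j./2 = j.-2./2.+1 by lia.
  by rewrite exprS mulN1r addNr.
rewrite !eqSS /=.
have [e|ni1] := eqVneq (i : nat) j.+1.
  rewrite e in hi *.
  have -> : (j < N)%N by lia.
  case: ltnP => h; last by rewrite addr0 ?eqxx.
  rewrite (_ : (j.+1 == j.-2.+1) = false) ?addr0 ?eqxx //.
  by apply/negP => /eqP; lia.
rewrite if_same add0r /=.
case: ltnP => h; last by rewrite (_ : _ == _ = false) //; apply/negP => /eqP; lia.
have -> : (i == j.-2.+1 :> nat) = (j == i.+1 :> nat) by apply/eqP/eqP; lia.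
by case: eqP.
Qed.

Definition lam (i j : nat) : C := if j == i.+1 then (-1) ^+ i
                  else if i == j.+1 :> nat then - (-1) ^+ j else 0.

Lemma lamC i j : lam j i = - lam i j.
Proof.
rewrite /lam; case: (eqVneq i j.+1) => [->|h].
  by rewrite (_ : j == _ = false) ?opprK //; apply/negP => /eqP; lia.
by case: eqP; rewrite ?oppr0.
Qed.

Lemma lamS i j : lam i.+1 j.+1 = - lam i j.
Proof. by rewrite /lam !eqSS; case: (j == i.+1); case: (i == j.+1); rewrite ?exprS ?mulN1r ?oppr0. Qed.

Lemma sum1 (F : 'I_N -> C) (i0 : 'I_N) : (forall k, k != i0 -> F k = 0) ->
  \sum_k F k = F i0.
Proof. by move=> h; rewrite (bigD1 i0) //= big1 ?addr0. Qed.

Lemma bb_lam i (j : 'I_N) : (i < N)%N -> \sum_(k < N) bb i k * lam k j =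
   if i is i'.+1 then lam i' j else - (j == 0 :> nat)%:R.
Proof.
have hj := ltn_ord j.
case: i => [|i] iN; last first.
  have iN' := ltnW iN.
  rewrite (sum1 (i0 := Ordinal iN')) /bb /= ?eqxx ?mul1r // => k nk.
  by rewrite eqSS eq_sym (_ : _ == _ = false) ?mul0r //; apply: contraNF nk => /eqP e; apply/eqP/val_inj.
rewrite /bb /=.
have [oj|ej] := boolP (odd j).
  rewrite big1 => [|k _].
    by rewrite (_ : _ == _ = false) ?oppr0 //; case: (j : nat) oj.
  case: ifP => ok; rewrite ?mul0r // /lam.
  rewrite (_ : (j == k.+1 :> nat) = false); last by apply/negP => /eqP; lia.
  by rewrite (_ : (_ == _) = false) ?mulr0 //; apply/negP => /eqP; lia.
have hj1 : (j.+1 < N)%N by lia.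
have [j0|j0] := eqVneq (j : nat) 0%N.
  rewrite (sum1 (i0 := Ordinal hj1)) /= ?ej.
    by rewrite /lam j0 /= !expr0 !mul1r.
  move=> k nk; case: ifP => ok; rewrite ?mul0r // /lam j0 /=.
  by rewrite (_ : _ == _ = false) ?mulr0 //; apply: contraNF nk => /eqP e; apply/eqP/val_inj; rewrite /= j0.
have hj2 : (j.-1 < N)%N by lia.
rewrite (bigD1 (Ordinal hj1)) //= (bigD1 (Ordinal hj2)) /=; last first.
  by apply/negP => /eqP[]; lia.
rewrite big1 => [|k /andP[k1 k2]]; last first.
  have e1 : (k == j.+1 :> nat) = false.
    by apply: contraNF k1 => /eqP e; apply/eqP/val_inj.
  have e2 : (j == k.+1 :> nat) = false.
    by apply: contraNF k2 => /eqP e; apply/eqP/val_inj; rewrite /= e.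
  by rewrite /lam e1 e2 mulr0.
have L1 : lam j.+1 j = - (-1) ^+ j.
  by rewrite lamC /lam eqxx.
have L2 : lam j.-1 j = (-1) ^+ j.-1 by rewrite /lam prednK ?lt0n // eqxx.
have o1 : odd j.-1 by lia.
rewrite /= L1 L2 o1 ej /= addr0 oppr0.
rewrite -[(-1) ^+ j]signr_odd -[(-1) ^+ j.-1]signr_odd (negPf ej) o1.
have hu : uphalf j = (j.-1)./2.+1.
  by have h : j.+1./2 = (j.-1)./2.+1 by lia; exact: h.
by rewrite hu exprS expr0 expr1; ring.
Qed.

Lemma cVmx_Lambda : cVmx *m Lambda *m cVmx^T = - Lambda.
Proof.
have eB i k : cVmx i k = bb i k by rewrite mxE.
have eL i k : Lambda i k = lam i k by rewrite mxE.
apply/matrixP => i j; have hi := ltn_ord i; have hj := ltn_ord j.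
rewrite [RHS]mxE eL mxE.
under eq_bigr => l _.
  rewrite mxE (eq_bigr (fun k : 'I_N => bb i k * lam k l)); last by move=> k _; rewrite eB eL.
  rewrite bb_lam // [_^T _ _]mxE eB. over.
case: (i : nat) hi => [|i'] hi.
  have h0 : (0 < N)%N by [].
  rewrite (sum1 (i0 := Ordinal h0)) /=.
    rewrite /bb /lam /= mulN1r; case: eqP => // _.
    by rewrite andbF.
  by move=> k nk; rewrite (_ : _ == _ = false) ?oppr0 ?mul0r //; apply: contraNF nk => /eqP e; apply/eqP/val_inj.
have hi' := ltnW hi.
have := bb_lam (Ordinal hi') hj => /= e.
under eq_bigr => l _ do rewrite mulrC lamC mulrN.
rewrite sumrN e; case: (j : nat) => [|j']; last by rewrite lamS lamC opprK.
by rewrite /lam /= eqSS; case: (i' == 0)%N; rewrite ?expr0 ?oppr0.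
Qed.

Lemma cVmx_free : row_free cVmx.
Proof.
rewrite -kermx_eq0; apply/rowV0P => v /sub_kermxP vB.
have vl (l : 'I_N) : \sum_k v 0 k * bb k l = 0.
  have := congr1 (fun M : 'rV_N => M 0 l) vB; rewrite [RHS]mxE mxE => e.
  by rewrite -[RHS]e; apply: eq_bigr => k _; rewrite [cVmx _ _]mxE.
have v0 (k : 'I_N) : k = 0 :> nat -> v 0 k = 0.
  move=> k0; have hk := ltn_ord k.
  have hN : (N.-1 < N)%N by lia.
  have := vl (Ordinal hN); rewrite (sum1 (i0 := k)).
    rewrite /bb /= k0 /= (_ : odd _); last by lia.
    by move/eqP; rewrite mulf_eq0 signr_eq0 orbF => /eqP.
  move=> i nk; rewrite /bb /= (_ : _ == _ = false); last by apply/negP => /eqP; have := ltn_ord i; lia.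
  rewrite (_ : _ == _ = false) ?mulr0 //.
  by apply: contraNF nk => /eqP e; apply/eqP/val_inj; rewrite /= e k0.
apply/rowP => k; rewrite [RHS]mxE; have [/v0//|k0] := eqVneq (k : nat) 0%N.
have hk : (k.-1 < N)%N by have := ltn_ord k; lia.
have := vl (Ordinal hk); rewrite (sum1 (i0 := k)).
  by rewrite /bb /= prednK ?lt0n // eqxx mulr1.
move=> i nk; have [/v0->|i0] := eqVneq (i : nat) 0%N; first by rewrite mul0r.
rewrite /bb /= (negPf i0) prednK ?lt0n // (_ : _ == _ = false) ?mulr0 //.
by apply: contraNF nk => /eqP e; apply/eqP/val_inj.
Qed.

Lemma lagrangian_cVmx A : lagrangian A -> lagrangian (A *m cVmx).
Proof.
case/andP => fA /eqP iA; apply/andP; split.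
  by rewrite /row_free mxrankMfree ?cVmx_free.
rewrite trmx_mul !mulmxA -[A *m cVmx *m Lambda]mulmxA -[A *m _ *m cVmx^T]mulmxA cVmx_Lambda.
by rewrite mulmxN mulNmx iA oppr0.
Qed.

End Variety.

Lemma plucker_cmx (R : realType) n (I : pindex n) (M : 'M[R[i]]_(n.-1, n.*2)) :
  plucker I (M *m cmx R n) = plucker (ishift I) M.
Proof.
rewrite /plucker; case: n => [|[|p]] in I M *; rewrite ?det_mx00 //.
have [mI|mI] := boolP (ord_max \in val I); last first.
  have lt k : ((pcol I k).+1 < p.+2.*2)%N.
    rewrite ltn_neqAle ltn_ord andbT; apply: contraNneq mI => e.
    by suff <- : pcol I k = ord_max; [exact: pcol_in | apply: val_inj; case: e].
  have e : (fun k => ordS (pcol I k)) =1 pcol (ishift I).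
    apply: pcol_uniq => [i j ij|k]; last by rewrite imset_f ?pcol_in.
    by rewrite /= !modn_small ?lt // ltnS pcol_mono.
  congr (\det _); apply/matrixP => i j; rewrite [LHS]mxE mul_cmx [RHS]mxE.
  by rewrite ltn_eqF ?lt // mul1r e.
have pM : pcol I ord_max = ord_max.
  have /= := enum_rankK_in mI mI.
  set r := enum_rank_in mI ord_max => er.
  pose k : 'I_p.+1 := cast_ord (eqP (valP I)) r.
  have ek : pcol I k = ord_max by rewrite /pcol (_ : cast_ord _ k = r) //; apply: val_inj.
  have [->//|nk] := eqVneq (ord_max : 'I_p.+1) k.
  have lk : (k < (ord_max : 'I_p.+1))%N by have := ltn_ord k; move: nk; rewrite -val_eqE /=; lia.
  by have := pcol_mono I lk; rewrite ek ltnNge -ltnS ltn_ord.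
have lt k : ((pcol I (lift ord_max k)).+1 < p.+2.*2)%N.
  have lk : (lift ord_max k < (ord_max : 'I_p.+1))%N by rewrite lift_max ltn_ord.
  by have := pcol_mono I lk; rewrite pM.
have opl (k : 'I_p) : ord_pred (lift ord0 k) = lift ord_max k.
  apply/val_inj; rewrite [RHS](lift_max k).
  have -> : val (ord_pred (lift ord0 k)) = ((k.+1 + p.+1).-1 %% p.+1)%N by [].
  by rewrite addSn /= modnDr modn_small // ltnW ?ltnS.
have op0 : ord_pred ord0 = ord_max :> 'I_p.+1 by apply: val_inj; apply: modn_small.
have e : (fun k => ordS (pcol I (ord_pred k))) =1 pcol (ishift I).
  apply: pcol_uniq => [i j|k]; last by rewrite imset_f ?pcol_in.
  case: (unliftP ord0 i) => [i'|] ->; case: (unliftP ord0 j) => [j'|] -> //.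
    rewrite !opl /= !modn_small ?lt // => ij; rewrite ltnS pcol_mono //.
    by rewrite !lift_max.
  by move=> _; rewrite opl op0 pM /= modnn modn_small ?lt.
rewrite (expand_det_col _ ord_max) [RHS](expand_det_col _ ord0).
apply: eq_bigr => i _.
set A := colsub (pcol I) _; set A' := colsub _ M.
have eA : A i ord_max = (-1) ^+ p.+2 * A' i ord0.
  by rewrite [LHS]mxE mul_cmx [A' _ _]mxE -e op0 pM /= eqxx.
have eC : row' i (col' ord_max A) = row' i (col' ord0 A').
  apply/matrixP => x y; rewrite [LHS]mxE [LHS]mxE [LHS]mxE mul_cmx.
  by rewrite [RHS]mxE [RHS]mxE [RHS]mxE -e opl ltn_eqF ?lt // mul1r.
rewrite eA /cofactor eC /= addn0 exprD !exprS !mulN1r opprK.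
have s2 : (-1) ^+ p * (-1) ^+ p = 1 :> R[i] by rewrite -expr2 sqrr_sign.
by rewrite mulrCA [RHS]mulrCA; ring: s2.
Qed.

Section GroveAlgebra.
Variables (R : realType) (n : nat).
Local Notation C := R[i].
Local Notation ppoly := {mpoly C[#|{: pindex n}|]}.

Definition Delta (I : pindex n) : ppoly := 'X_(enum_rank I).

Definition peval (t : C) (M : 'M[C]_(n.-1, n.*2)) (f : ppoly) : C :=
  f.@[fun v => t * plucker (enum_val v) M].

(* The ideal of the projective variety LG(n-1, V) = X_n: the polynomials that
   vanish at all homogeneous coordinate vectors of all its points. The scalar t
   only matters for n = 1, where W has a single basis. *)
Definition grove_ideal : pred ppoly := fun f =>
  `[< forall (t : C) (A : 'M[C]_(n.-1, n.-1.*2)),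
        t != 0 -> lagrangian A -> peval t (A *m wmx R n) f = 0 >].

Lemma exists_lagrangian : exists A : 'M[C]_(n.-1, n.-1.*2), lagrangian A.
Proof.
exists (\matrix_(i, j) (j == i.*2 :> nat)%:R); apply/andP; split.
  rewrite -kermx_eq0; apply/rowV0P => v /sub_kermxP vA.
  apply/rowP => k; rewrite [RHS]mxE.
  have hk : (k.*2 < n.-1.*2)%N by have := ltn_ord k; lia.
  have := congr1 (fun M : 'rV_(n.-1.*2) => M 0 (Ordinal hk)) vA.
  rewrite [RHS]mxE mxE (bigD1 k) //= big1 ?addr0 => [|i ni]; rewrite mxE /=.
    by rewrite eqxx mulr1.
  rewrite (_ : _ == _ = false) ?mulr0 //.
  by apply: contraNF ni => /eqP e; apply/eqP/val_inj => /=; lia.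
apply/eqP/matrixP => i j; rewrite [RHS]mxE mxE big1 // => k _; rewrite mxE.
rewrite [_^T _ _]mxE [X in _ * X]mxE.
have [ek|nk] := eqVneq (k : nat) j.*2; last by rewrite mulr0.
rewrite big1 ?mul0r // => l _; rewrite !mxE.
have [el|nl] := eqVneq (l : nat) i.*2; last by rewrite mul0r.
have h1 : (k == l.+1 :> nat) = false by apply/negP => /eqP; lia.
have h2 : (l == k.+1 :> nat) = false by apply/negP => /eqP; lia.
by rewrite h1 h2 mulr0.
Qed.

Lemma grove_ideal_closed : idealr_closed grove_ideal.
Proof.
split=> [||a u v /asboolP hu /asboolP hv].
- by apply/asboolP => t A _ _; rewrite /peval meval0.
- apply/negP => /asboolP h; have [A /(h 1)] := exists_lagrangian.
  by rewrite /peval meval1 oner_eq0 => /(_ isT)/eqP; rewrite oner_eq0.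
apply/asboolP => t A t0 hA; rewrite /peval mevalD mevalM.
by move: (hu t A t0 hA) (hv t A t0 hA); rewrite /peval => -> ->; rewrite mulr0 addr0.
Qed.

HB.instance Definition _ := isIdealr.Build ppoly grove_ideal grove_ideal_closed.

Definition grove : predArgType := {ideal_quot (grove_ideal : idealr _)}.
HB.instance Definition _ := GRing.ComNzRing.on grove.

Definition grove_pi : ppoly -> grove :=
  \pi_({ideal_quot (grove_ideal : idealr _)}).
HB.instance Definition _ := GRing.RMorphism.on grove_pi.

Lemma grove_piP (f g : ppoly) :
  reflect (grove_pi f = grove_pi g) (f - g \in grove_ideal).
Proof. by rewrite (Quotient.idealrBE (grove_ideal : idealr _)); apply: eqP. Qed.

Definition grove_scale (a : C) (x : grove) : grove := grove_pi a%:MP * x.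

Fact grove_scaleA a b x : grove_scale a (grove_scale b x) = grove_scale (a * b) x.
Proof. by rewrite /grove_scale mulrA -rmorphM -mpolyCM. Qed.
Fact grove_scale1 : left_id 1 grove_scale.
Proof. by move=> x; rewrite /grove_scale mpolyC1 rmorph1 mul1r. Qed.
Fact grove_scaleDr : right_distributive grove_scale +%R.
Proof. by move=> a x y; rewrite /grove_scale mulrDr. Qed.
Fact grove_scaleDl x : {morph grove_scale^~ x : a b / a + b}.
Proof. by move=> a b; rewrite /grove_scale mpolyCD rmorphD mulrDl. Qed.
HB.instance Definition _ := GRing.Zmodule_isLmodule.Build C grove
  grove_scaleA grove_scale1 grove_scaleDr grove_scaleDl.

Definition in_grove_deg (m : nat) (x : grove) : Prop :=
  exists2 f : ppoly, f \is m.-homog & x = grove_pi f.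

(* Pullback of functions along c, see [peval_cyc]; it sends Delta_I to
   Delta_(I+1). *)
Definition cyc_poly (f : ppoly) : ppoly :=
  f \mPo [tuple Delta (ishift (enum_val v)) | v < #|{: pindex n}|].

(* Independent of the representative, see [cyc_pi]. *)
Definition cyc (x : grove) : grove := grove_pi (cyc_poly (repr x)).

Lemma peval_cyc t M f : peval t M (cyc_poly f) = peval t (M *m cmx R n) f.
Proof.
rewrite /peval /cyc_poly comp_mpoly_meval; apply: meval_eq => v.
by rewrite tnth_mktuple mevalXU enum_rankK plucker_cmx.
Qed.

Lemma grove_ideal_cyc f : f \in grove_ideal -> cyc_poly f \in grove_ideal.
Proof.
move=> /asboolP h; apply/asboolP => t A t0 hA.
by rewrite peval_cyc -mulmxA wmx_cmx mulmxA h // lagrangian_cVmx.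
Qed.

Lemma cyc_pi f : cyc (grove_pi f) = grove_pi (cyc_poly f).
Proof.
apply/grove_piP; rewrite /cyc_poly -raddfB; apply: grove_ideal_cyc.
by apply/grove_piP; rewrite /grove_pi reprK.
Qed.

End GroveAlgebra.

Definition is_basis_of_deg (R : realType) (n m : nat) (T : finType)
    (b : T -> grove R n) : Prop :=
  [/\ forall p, in_grove_deg m (b p),
      forall a : T -> R[i], \sum_p a p *: b p = 0 -> forall p, a p = 0
    & forall x, in_grove_deg m x -> exists a : T -> R[i], x = \sum_p a p *: b p].

Definition kappa (n : nat) : nat := if (3 <= n)%N then 2 else 1.

(* The exponents are kappa * (m + (i + j) / 2) and kappa * (i + j) / 2. Halving is
   exact, since kappa = 1 leaves at most the factor i = j = 1. *)
Definition Omega (n m : nat) : {fraction {poly int}} :=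
  \prod_(1 <= i < n) \prod_(i <= j < n)
    (tofrac (1 - 'X^((kappa n * (2 * m + i + j))./2)%N)
     / tofrac (1 - 'X^((kappa n * (i + j))./2)%N)).

(* exp (2 pi i / (kappa n)) *)
Definition zeta (R : realType) (n : nat) : R[i] :=
  let t := 2 * trigo.pi / (kappa n * n)%:R in trigo.cos t +i* trigo.sin t.

(* Main.v *)
Require Import Defs.
From mathcomp Require Import all_boot all_order all_algebra all_fingroup.
From mathcomp Require Import all_solvable ring lra zify.
From mathcomp Require Import ring_quotient generic_quotient boolp reals.
From mathcomp Require trigo.
From mathcomp Require Import mpoly complex.

(** Write N for n - 1 and xi for a primitive 2n-th root of unity.

Rowmotion and promotion are conjugate. Each is a product of classes of commuting
toggles in which only consecutive classes fail to commute, so each is conjugate to the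
product of all toggles at cells with i + j odd and all toggles at cells with i + j even
([Row_conj_Pr]). Hence the fixed points of Row^k are as many as those of Pr^k, and their
number is the trace of c^k on the degree m part of the grove algebra, because c permutes
the basis b as promotion does.

The trace is read off another basis. On V, the map c has the 2N distinct eigenvalues
u xi^j and u xi^-j for 1 <= j <= N, where u^2 = -1, and the symplectic form pairs the
eigenvectors of u xi^j and u xi^-j. Products of m maximal minors in these coordinates are
eigenvectors of c. On the subspaces that are graphs of a symmetric matrix X the maximal
minors become minors of X. A plane partition pi has m levels; at level t, the cells at
which pi first falls to t or below form an antichain, that is a set of rows
i_1 < i_2 < ... and columns j_1 < j_2 < ... of X, hence a minor whose diagonal term is the
product of the X_(i_s, j_s). Multiplied over the levels, the diagonal terms give the
monomial with exponents e_(i, j) = (smaller neighbour of pi towards the corner) - pi;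
this is the transfer map from the order polytope to the chain polytope, so pi is
recovered from e. Distinct leading monomials make the products linearly independent.
There are exactly as many of them as elements of b, so they form a basis: comparison of
cardinalities replaces a straightening law. As the product attached to pi has eigenvalue
xi^w(pi) with w(pi) the sum of the (i + j) e_(i, j), the number of fixed points of Pr^k is
the sum of the xi^(k w(pi)) ([exists_eigenbasis], [card_fixed_Pr]).

It remains to see that the sum of the q^w(pi) is the product Omega ([king_product],
[sum_pp_weight]). The Robinson-Schensted-Knuth correspondence, written as a composition
of toggles, is a permutation of the plane partitions that turns w into a linear function
of the entries along the diagonals. With that weight the plane partitions are the
symplectic Gelfand-Tsetlin (King) patterns whose top row is the rectangle (m^N), at
x_i = q^-i. Summing such patterns row by row is a sequence of telescoping sums inside a
determinant, which yields a constant times the numerator det(x_i^l_j - x_i^-l_j) of the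
Weyl character formula ([pattern_sum_sp_det]). At x_i = q^-i this numerator is a
Vandermonde determinant in the q^l_j + q^-l_j; dividing by the case m = 0, in which there
is one plane partition, leaves Omega.

Finally Row^k = 1 exactly when xi^(k w(pi)) = 1 for all pi. If n >= 3 the weights 2 and 3
occur, so the order of Row is 2n. If n <= 2 all weights are even; q^2 is then the natural
variable, which accounts for kappa. *)

Set Implicit Arguments.
Unset Strict Implicit.
Unset Printing Implicit Defensive.

Import Order.TTheory GRing.Theory Num.Theory.

(** * Determinants and sums over interlacing sequences *)

Lemma ord_predE k (s : 'I_k.+1) : (0 < s)%N -> ord_pred s = s.-1 :> nat.
Proof.
move=> s0; have -> : ord_pred s = ((s + k.+1).-1 %% k.+1)%N :> nat by [].
rewrite -{1}(prednK s0) addSn /= modnDr modn_small //; have := ltn_ord s; lia.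
Qed.

Section KingPatterns.
Local Open Scope ring_scope.
Variable K : fieldType.

(** Multiplication by this matrix on the right replaces each column by its difference
with the column before it. *)
Definition diff_mx k : 'M[K]_k :=
  \matrix_(s, t) ((s == t)%:R - (s.+1 == t :> nat)%:R).

Lemma det_diff_mx k : \det (diff_mx k) = 1.
Proof.
rewrite -det_tr det_trig; last first.
  apply/is_trig_mxP => i j ij; rewrite mxE mxE.
  have /negPf-> : j != i by apply: contraTneq ij => ->; rewrite ltnn.
  have /negPf-> : j.+1 != i :> nat by apply: contraTneq ij => <-; rewrite -leqNgt leqnSn.
  by rewrite subrr.
apply: big1 => i _; rewrite mxE mxE eqxx.
have /negPf-> : i.+1 != i :> nat by rewrite neq_ltn ltnSn orbT.
by rewrite subr0.
Qed.

Lemma mul_diff_mx k (B : 'M[K]_k.+1) i s :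
  (B *m diff_mx k.+1) i s
  = B i s - (if s == ord0 then 0 else B i (ord_pred s)).
Proof.
rewrite mxE (eq_bigr (fun t => B i t * (t == s)%:R - B i t * (t.+1 == s :> nat)%:R)); last first.
  by move=> t _; rewrite mxE mulrBr.
rewrite sumrB (bigD1 s) //= eqxx mulr1 big1 ?addr0; last by move=> t /negPf->; rewrite mulr0.
congr (_ - _); case: eqP => [->|/eqP s0].
  by rewrite big1 // => t _; rewrite mulr0.
have s0' : (0 < s)%N by rewrite lt0n; apply: contraNneq s0 => e; apply/eqP/val_inj.
have e : (ord_pred s).+1 = s :> nat by rewrite ord_predE ?prednK.
rewrite (bigD1 (ord_pred s)) //= e eqxx mulr1 big1 ?addr0 // => t nt.
rewrite (_ : (_ == _ :> nat) = false) ?mulr0 //.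
by apply: contraNF nt => /eqP e'; apply/eqP/val_inj; apply: succn_inj; rewrite e e'.
Qed.

Lemma ord_pred_lift0 k (s : 'I_k) : ord_pred (lift ord0 s) = widen_ord (leqnSn k) s.
Proof. by apply: ord_inj; rewrite ord_predE. Qed.

(** Subtracting from each column the preceding one turns the first row into (1, 0, ...,
0). *)
Lemma det_border k (B : 'M[K]_k.+1) : (forall s, B ord0 s = 1) ->
  \det (\matrix_(i < k, s < k) (B (lift ord0 i) (lift ord0 s)
          - B (lift ord0 i) (widen_ord (leqnSn k) s))) = \det B.
Proof.
move=> B0; rewrite -[RHS]mulr1 -(det_diff_mx k.+1) -det_mulmx.
rewrite (expand_det_row _ ord0) (bigD1 ord0) //= mul_diff_mx eqxx subr0 B0 mul1r.
rewrite big1 ?addr0; last first.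
  by move=> s /negPf s0; rewrite mul_diff_mx s0 !B0 subrr mul0r.
rewrite /cofactor /= expr0 mul1r; congr (\det _); apply/matrixP => i s.
rewrite [LHS]mxE [RHS]mxE [RHS]mxE mul_diff_mx.
by rewrite eq_sym (negPf (neq_lift _ _)) ord_pred_lift0.
Qed.

Lemma det_diffs k (B : 'M[K]_k.+1) :
  \det (\matrix_(i, s) (B i s - (if s == ord0 then 0 else B i (ord_pred s)))) = \det B.
Proof.
rewrite -[RHS]mulr1 -(det_diff_mx k.+1) -det_mulmx; congr (\det _).
by apply/matrixP => i s; rewrite mul_diff_mx mxE.
Qed.

(** A determinant is linear in each column, so independent summations over one variable
per column may be carried out inside it. *)
Lemma sum_det_columns (T : finType) k (P : 'I_k -> pred T) (F : 'I_k -> 'I_k -> T -> K) :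
  \sum_(f : {ffun 'I_k -> T} | [forall s, P s (f s)]) \det (\matrix_(i, s) F i s (f s))
  = \det (\matrix_(i, s) \sum_(t | P s t) F i s t).
Proof.
under eq_bigr => f _ do rewrite -det_tr.
rewrite -[RHS]det_tr /determinant exchange_big /=; apply: eq_bigr => u _; rewrite -mulr_sumr; congr (_ * _).
rewrite (eq_bigr (fun s => \sum_(t | P s t) F (u s) s t)); last by move=> s _; rewrite !mxE.
rewrite bigA_distr_big_dep; apply: eq_big => [f|f _].
  by apply/forallP/familyP => h s; apply: h.
by apply: eq_bigr => s _; rewrite !mxE.
Qed.

Lemma sum_ord_telescope M (a b : nat) (F G : nat -> K) :
  (a <= b <= M)%N -> (forall t, G t.+1 - G t = F t) ->
  \sum_(t < M | (a <= t < b)%N) F t = G b - G a.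
Proof.
case/andP=> ab bM FG.
transitivity (\sum_(a <= t < b) F t); last first.
  by rewrite -(telescope_sumr G ab); apply: eq_bigr => t _; rewrite FG.
rewrite -(big_mkord (fun t => a <= t < b)%N F).
rewrite (big_cat_nat (n := b)) //= [X in _ + X]big_nat_cond [X in _ + X]big1 ?addr0; last by move=> t; lia.
rewrite (big_cat_nat (n := a)) //= [X in X + _]big_nat_cond [X in X + _]big1 ?add0r; last by move=> t; lia.
by rewrite big_nat_cond [RHS]big_nat_cond; apply: eq_bigl => t; lia.
Qed.

Lemma det_scale_cols k (B : 'M[K]_k) (c : 'I_k -> K) :
  \det (\matrix_(i, s) (B i s * c s)) = (\prod_s c s) * \det B.
Proof.
rewrite mulrC; have -> : \prod_s c s = \det (diag_mx (\row_s c s)).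
  by rewrite det_diag; apply: eq_bigr => s _; rewrite mxE.
rewrite -det_mulmx; congr (\det _); apply/matrixP => i s.
by rewrite mul_mx_diag !mxE.
Qed.

Lemma det_scale_rows k (B : 'M[K]_k) (c : 'I_k -> K) :
  \det (\matrix_(i, s) (c i * B i s)) = (\prod_s c s) * \det B.
Proof.
have -> : \prod_s c s = \det (diag_mx (\row_s c s)).
  by rewrite det_diag; apply: eq_bigr => s _; rewrite mxE.
rewrite -det_mulmx; congr (\det _); apply/matrixP => i s.
by rewrite mul_diag_mx !mxE.
Qed.

Variable x : nat -> K.

(** Rows of a pattern are listed from the smallest part; 0 stands before the smallest
one. *)
Definition prev_part M k (l : {ffun 'I_k -> 'I_M}) (s : 'I_k) : nat :=
  if s == 0 :> nat then 0%N else l (ord_pred s).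

(** Row 2k - 1 against row 2k. All rows are stored shifted (part number s has s added to
it in odd rows and s + 1 in even rows), which makes them strictly increasing; the
half-open intervals are the usual interlacing conditions in shifted form. *)
Definition odd_interlaced M k (l o : {ffun 'I_k -> 'I_M}) :=
  [forall s, prev_part l s <= o s < l s]%N.

Definition even_interlaced M k (o : {ffun 'I_k.+1 -> 'I_M}) (l : {ffun 'I_k -> 'I_M}) :=
  [forall s, o (widen_ord (leqnSn k) s) < l s <= o (lift ord0 s)]%N.

(** The generating function of symplectic patterns with top row l. The summand is the
usual weight x_k^(2 |row 2k-1| - |row 2k| - |row 2k-2|), to which the shifts contribute
the factor x_k^k. *)
Fixpoint pattern_sum M k : {ffun 'I_k -> 'I_M} -> K :=
  match k with
  | 0%N => fun=> 1
  | k'.+1 => fun l =>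
     \sum_(o | odd_interlaced l o) \sum_(l' | even_interlaced o l')
       (x k'.+1 ^+ k'.+1 * (\prod_s x k'.+1 ^- l s) * (\prod_s x k'.+1 ^+ (2 * o s))
         * (\prod_s x k'.+1 ^- l' s)) * pattern_sum l'
  end.

(** The numerator of the Weyl character formula of Sp(2k); the variables x_k, ..., x_1
are listed downwards, so that passing from k - 1 to k adds a row at the top. *)
Definition sp_det k (l : 'I_k -> nat) : K :=
  \det (\matrix_(i, j) (x (k - i)%N ^+ l j - x (k - i)%N ^- l j)).

Lemma prev_part0 M k (l : {ffun 'I_k.+1 -> 'I_M}) : prev_part l ord0 = 0%N.
Proof. by []. Qed.

Lemma prev_part_lift M k (l : {ffun 'I_k.+1 -> 'I_M}) s :
  prev_part l (lift ord0 s) = l (widen_ord (leqnSn k) s).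
Proof. by rewrite /prev_part /= ord_pred_lift0. Qed.

(** An antiderivative of (y^t - y^-t) X^-t, the column entries summed over an even
row. *)
Definition even_primitive (y X : K) (t : nat) : K :=
  y / (y - X) * (y ^+ t * X ^- t) - (1 - y * X)^-1 * (y ^- t * X ^- t).

(** An antiderivative of [even_primitive y X t * X^(2 t)], the column entries summed
over an odd row. The constants of the two geometric sums cancel, so that it vanishes at
0 and, times X^-t, is a multiple of y^t - y^-t again. *)
Definition odd_primitive (y X : K) (t : nat) : K :=
  y / ((y - X) * (y * X - 1)) * (y ^+ t * X ^+ t - y ^- t * X ^+ t).

Lemma even_primitiveS y X t : y != 0 -> X != 0 -> y != X -> y * X != 1 ->
  even_primitive y X t.+1 - even_primitive y X t = (y ^+ t.+1 - y ^- t.+1) * X ^- t.+1.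
Proof.
move=> y0 X0 yX yX1; rewrite /even_primitive !exprS.
have h1 : y - X != 0 by rewrite subr_eq0.
have h2 : 1 - y * X != 0 by rewrite subr_eq0 eq_sym.
have h3 : y ^+ t != 0 by rewrite expf_neq0.
have h4 : X ^+ t != 0 by rewrite expf_neq0.
by field; rewrite ?h4 ?h3 ?h1 ?h2 ?X0 ?y0.
Qed.

Lemma odd_primitiveS y X t : y != 0 -> X != 0 -> y != X -> y * X != 1 ->
  odd_primitive y X t.+1 - odd_primitive y X t = even_primitive y X t * X ^+ (2 * t).
Proof.
move=> y0 X0 yX yX1; rewrite /even_primitive /odd_primitive !exprS mulnC exprM.
have h1 : y - X != 0 by rewrite subr_eq0.
have h2 : 1 - y * X != 0 by rewrite subr_eq0 eq_sym.
have h2' : y * X - 1 != 0 by rewrite subr_eq0.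
have h3 : y ^+ t != 0 by rewrite expf_neq0.
have h4 : X ^+ t != 0 by rewrite expf_neq0.
by field; rewrite ?h2' ?h4 ?h3 ?h1 ?h2 ?X0 ?y0.
Qed.

Lemma odd_primitive0 y X : odd_primitive y X 0 = 0.
Proof. by rewrite /odd_primitive !expr0 invr1 subrr mulr0. Qed.

(** Induction on k. The sum over row 2k - 2 telescopes in each column; it produces a k -
1 by k - 1 determinant of differences, which is a k by k determinant bordered by a row
of ones. The sum over row 2k - 1 telescopes again, and the border becomes the row of the
new variable. The factors picked up do not depend on the top row; their product is left
unspecified. *)
Lemma pattern_sum_sp_det N :
  (forall i, (0 < i <= N)%N -> x i != 0) ->
  (forall i, (0 < i <= N)%N -> x i ^+ 2 != 1) ->
  (forall i j, (0 < i < j)%N -> (j <= N)%N -> x i != x j) ->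
  (forall i j, (0 < i < j)%N -> (j <= N)%N -> x i * x j != 1) ->
  forall k, (k <= N)%N -> exists C : K, forall M (l : {ffun 'I_k -> 'I_M}),
    (forall s, prev_part l s <= l s)%N -> pattern_sum l = C * sp_det (fun s => l s).
Proof.
move=> x0 x2 xne xinv; elim=> [_|k IH kN].
  by exists 1 => M l _; rewrite mul1r /sp_det det_mx00.
have [C hC] := IH (ltnW kN).
set X := x k.+1.
have X0 : X != 0 by apply: x0; rewrite ltn0Sn.
have X2 : X ^+ 2 - 1 != 0 by rewrite subr_eq0; apply: x2; rewrite ltn0Sn.
pose y (i : 'I_k) := x (k - i)%N.
have yk (i : 'I_k) : (0 < k - i < k.+1)%N by have := ltn_ord i; lia.
have y0 i : y i != 0 by apply: x0; have := yk i; lia.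
have yX i : y i != X by apply: xne.
have yX1 i : y i * X != 1 by apply: xinv.
pose B1 (i : 'I_k.+1) t := if unlift ord0 i is Some i' then even_primitive (y i') X t else 1.
pose B2 (i : 'I_k.+1) t := if unlift ord0 i is Some i' then odd_primitive (y i') X t
                           else (X ^+ (2 * t) - 1) / (X ^+ 2 - 1).
pose c (i : 'I_k.+1) := if unlift ord0 i is Some i' then y i' / ((y i' - X) * (y i' * X - 1))
                           else (X ^+ 2 - 1)^-1.
exists (X ^+ k.+1 * C * \prod_i c i) => M l hl.
(* the sum over row 2k - 2, for a fixed row 2k - 1 *)
have inner (o : {ffun 'I_k.+1 -> 'I_M}) : odd_interlaced l o ->
    \sum_(l' | even_interlaced o l') (\prod_s X ^- l' s) * pattern_sum l'
    = C * \det (\matrix_(i, s) B1 i (o s)).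
  move=> /forallP ho.
  have oS s : (o (widen_ord (leqnSn k) s) <= o (lift ord0 s))%N.
    have /andP[_ h1] := ho (widen_ord (leqnSn k) s).
    have /andP[h2 _] := ho (lift ord0 s).
    by rewrite prev_part_lift in h2; apply: leq_trans (ltnW h1) h2.
  pose F (i s : 'I_k) (t : 'I_M) := (y i ^+ t - y i ^- t) * X ^- t.
  transitivity (\sum_(l' : {ffun 'I_k -> 'I_M} | even_interlaced o l') C * \det (\matrix_(i, s) F i s (l' s))).
    apply: eq_bigr => l' /forallP hl'; rewrite hC => [|s].
      rewrite mulrCA; congr (_ * _); rewrite -det_scale_cols.
      by congr (\det _); apply/matrixP => i s; rewrite !mxE.
    case: k l l' {IH kN hC X X0 X2 y yk y0 yX yX1 B1 B2 c hl F} o ho oS hl' s => [|k] l l' o ho oS hl' s; first by case: s.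
    have [s'|] := unliftP ord0 s => ->; last by rewrite prev_part0.
    rewrite prev_part_lift; have /andP[_ h1] := hl' (widen_ord (leqnSn k) s').
    have /andP[h2 _] := hl' (lift ord0 s').
    apply: leq_trans h1 (leq_trans _ (ltnW h2)).
    by rewrite (_ : lift _ _ = widen_ord (leqnSn k.+1) (lift ord0 s')) //; apply/val_inj.
  rewrite -mulr_sumr; congr (_ * _).
  rewrite (sum_det_columns (fun (s : 'I_k) (t : 'I_M) => o (widen_ord (leqnSn k) s) < t <= o (lift ord0 s))%N F).
  rewrite -(det_border (B := \matrix_(i, s) B1 i (o s))); last first.
    by move=> s; rewrite mxE /B1 unlift_none.
  congr (\det _); apply/matrixP => i s; rewrite !mxE /B1 liftK.
  (* the summation runs over a < t <= b, hence the primitive moved by one *)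
  pose G t := if t is t'.+1 then even_primitive (y i) X t' else even_primitive (y i) X 0 - (y i ^+ 0 - y i ^- 0) * X ^- 0.
  rewrite (sum_ord_telescope (a := (o (widen_ord (leqnSn k) s)).+1) (b := (o (lift ord0 s)).+1)
            (F := fun t => (y i ^+ t - y i ^- t) * X ^- t) (G := G)) //.
    by rewrite ltnS oS ltn_ord.
  by case=> [|t]; rewrite /G ?even_primitiveS // opprB addrC subrK.
transitivity (X ^+ k.+1 * C * ((\prod_s X ^- l s) *
  \sum_(o | odd_interlaced l o) (\prod_s X ^+ (2 * o s)) * \det (\matrix_(i, s) B1 i (o s)))).
  rewrite /= !mulr_sumr; apply: eq_bigr => o ho.
  transitivity (X ^+ k.+1 * (\prod_s X ^- l s) * (\prod_s X ^+ (2 * o s))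
    * \sum_(l' | even_interlaced o l') (\prod_s X ^- l' s) * pattern_sum l').
    by rewrite mulr_sumr; apply: eq_bigr => l' _; rewrite !mulrA.
  by rewrite inner //; ring.
rewrite -!mulrA; congr (_ * (_ * _)).
pose F (i s : 'I_k.+1) (t : 'I_M) := B1 i t * X ^+ (2 * t).
transitivity ((\prod_s X ^- l s) * \sum_(o | odd_interlaced l o) \det (\matrix_(i, s) F i s (o s))).
  congr (_ * _); apply: eq_bigr => o _; rewrite -det_scale_cols.
  by congr (\det _); apply/matrixP => i s; rewrite !mxE.
(* the sum over row 2k - 1 *)
rewrite (sum_det_columns (fun s (t : 'I_M) => prev_part l s <= t < l s)%N F) /F {F}.
transitivity ((\prod_s X ^- l s) * \det (\matrix_(i, s) B2 i (l s))).
  congr (_ * _); rewrite -[RHS]det_diffs; congr (\det _); apply/matrixP => i s.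
  rewrite !mxE (sum_ord_telescope (F := fun t => B1 i t * X ^+ (2 * t)) (G := B2 i)).
  - congr (_ - _); rewrite /prev_part; case: eqP => [e|/eqP ne]; last first.
      by rewrite (_ : (s == ord0) = false) //; apply: contraNF ne => /eqP->.
    rewrite (_ : s == ord0); last by apply/eqP/val_inj.
    by rewrite /B2; case: unlift => [i'|]; rewrite ?odd_primitive0 // expr0 subrr mul0r.
  - by rewrite hl ltnW ?ltn_ord.
  move=> t; rewrite /B1 /B2; case: unlift => [i'|]; first by rewrite odd_primitiveS.
  by rewrite mulnS exprD; field; rewrite X2.
rewrite -det_scale_cols -det_scale_rows; congr (\det _); apply/matrixP => i s; rewrite !mxE /B2 /c.
have Xl : X ^+ l s != 0 by rewrite expf_neq0.
have [i'|] := unliftP ord0 i => ->.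
  rewrite subSS -/(y i') /odd_primitive -mulrA; congr (_ * _).
  by rewrite mulrBl -!mulrA mulfV ?mulr1.
rewrite subn0 -/X mulrAC mulrC; congr (_ * _).
by rewrite mulnC exprM expr2 mulrBl mul1r -mulrA mulfV ?mulr1.
Qed.

End KingPatterns.

(** * The symplectic Vandermonde determinant *)

Section SymplecticVandermonde.
Local Open Scope ring_scope.
Variable K : fieldType.

(** Chebyshev polynomials of the second kind at half the variable: z^(n+1) - z^-(n+1) is
(z - 1/z) times their value at z + 1/z. *)
Fixpoint chebyshev n : {poly K} :=
  match n with
  | 0 => 1
  | n'.+1 => match n' with 0 => 'X | n''.+1 => 'X * chebyshev n' - chebyshev n'' end
  end.

Lemma chebyshevSS n : chebyshev n.+2 = 'X * chebyshev n.+1 - chebyshev n. Proof. by []. Qed.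

Lemma size_chebyshev n : (size (chebyshev n) <= n.+1)%N.
Proof.
suff [] : (size (chebyshev n) <= n.+1)%N /\ (size (chebyshev n.+1) <= n.+2)%N by [].
elim: n => [|n [h1 h2]]; first by rewrite size_poly1 size_polyX.
split=> //; rewrite chebyshevSS (leq_trans (size_polyD _ _)) // geq_max size_polyN.
rewrite (leq_trans h1) ?andbT; last by rewrite ltnW.
by rewrite (leq_trans (size_polyMleq _ _)) // size_polyX.
Qed.

Lemma horner_chebyshev n (z : K) : z != 0 ->
  z ^+ n.+1 - z ^- n.+1 = (z - z^-1) * (chebyshev n).[z + z^-1].
Proof.
move=> z0; suff [] : z ^+ n.+1 - z ^- n.+1 = (z - z^-1) * (chebyshev n).[z + z^-1]
   /\ z ^+ n.+2 - z ^- n.+2 = (z - z^-1) * (chebyshev n.+1).[z + z^-1] by [].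
elim: n => [|n [h1 h2]].
  by rewrite /chebyshev hornerC hornerX mulr1 expr1 expr2; split=> //; field; rewrite z0.
split=> //; rewrite chebyshevSS hornerD hornerN hornerM hornerX mulrBr mulrCA -h1 -h2 !exprS.
by have zn : z ^+ n != 0 by [rewrite expf_neq0]; field; rewrite zn z0.
Qed.

(** The entries are values at the points q^l_j + q^-l_j of polynomials of degree less
than N, up to a factor per column; so the determinant is a multiple of a Vandermonde
determinant, by a factor independent of l. *)
Lemma sp_det_Vandermonde N : exists C : K, forall q (l : 'I_N -> nat), q != 0 ->
  sp_det (fun i => q ^+ i) l
  = C * \prod_(i < N) ((q ^+ l i - q ^- l i) * \prod_(j < N | (i < j)%N)
      ((q ^+ l j + q ^- l j) - (q ^+ l i + q ^- l i))).
Proof.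
pose L : 'M[K]_N := \matrix_(i, j) (chebyshev (N - i).-1)`_j.
exists (\det L) => q l q0.
pose y : 'rV[K]_N := \row_s (q ^+ l s + q ^- l s).
rewrite big_split /=.
have -> : \prod_(i < N) \prod_(j < N | (i < j)%N)
      ((q ^+ l j + q ^- l j) - (q ^+ l i + q ^- l i)) = \det (Vandermonde N y).
  rewrite det_Vandermonde; apply: eq_bigr => i _; apply: eq_bigr => j _.
  by rewrite !mxE.
rewrite mulrCA -det_mulmx -det_scale_cols /sp_det.
congr (\det _); apply/matrixP => i s; rewrite !mxE.
have hi : (0 < N - i)%N by rewrite subn_gt0.
rewrite exprAC -(prednK hi).
rewrite horner_chebyshev ?expf_neq0 // mulrC; congr (_ * _).
rewrite (horner_coef_wide _ (n := N)); last first.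
  by rewrite (leq_trans (size_chebyshev _)) // prednK // leq_subr.
by apply: eq_bigr => j _; rewrite !mxE.
Qed.

(** For l_j = m + j + 1 each factor of the Vandermonde product splits as a difference
that contributes q^m and a sum that contributes a factor of the product formula. *)
Lemma sp_det_shift N m (q : K) : q != 0 ->
  sp_det (fun i => q ^+ i) (fun s : 'I_N => m + s + 1)%N
    * \prod_(i < N) \prod_(j < N | (i <= j)%N) (q ^+ m * (1 - q ^+ (i + j + 2)%N))
  = sp_det (fun i => q ^+ i) (fun s : 'I_N => 0 + s + 1)%N
    * \prod_(i < N) \prod_(j < N | (i <= j)%N) (1 - q ^+ (2 * m + i + j + 2)%N).
Proof.
move=> q0; have [C hC] := sp_det_Vandermonde N; rewrite !hC // -!mulrA; congr (_ * _).
rewrite -!big_split /=; apply: eq_bigr => i _.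
have sp (F : 'I_N -> K) : \prod_(j < N | (i <= j)%N) F j = F i * \prod_(j < N | (i < j)%N) F j.
  rewrite (bigD1 i) //=; congr (_ * _); apply: eq_bigl => j.
  by rewrite ltn_neqAle eq_sym andbC.
have qn k : q ^+ k != 0 by rewrite expf_neq0.
rewrite (sp (fun j => q ^+ m * (1 - q ^+ (i + j + 2)%N))).
rewrite (sp (fun j => 1 - q ^+ (2 * m + i + j + 2)%N)).
rewrite mulrACA [RHS]mulrACA -!big_split /=; congr (_ * _).
  rewrite mul2n -addnn !exprD ?expr0 ?mul1r; field.
  rewrite ?qn ?q0 //.
apply: eq_bigr => j ij.
have -> : nat_of_ord j = (i + (j - i))%N by rewrite subnKC // ltnW.
move: (j - i)%N => d.
rewrite mul2n -addnn !exprD ?expr0 ?mul1r; field.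
by rewrite ?qn ?q0 //.
Qed.
End SymplecticVandermonde.

(** * Symplectic patterns and staircase plane partitions *)

Section PatternType.
Local Open Scope ring_scope.
Variables (K : fieldType) (L : nat) (x : nat -> K).
Local Notation M := L.+1.

(** The rows below the top row of a pattern with 2k rows. *)
Fixpoint pattern k : finType :=
  match k with
  | 0 => unit : finType
  | k'.+1 => ({ffun 'I_k'.+1 -> 'I_M} * {ffun 'I_k' -> 'I_M} * pattern k')%type : finType
  end.

Fixpoint valid_pattern k : {ffun 'I_k -> 'I_M} -> pattern k -> bool :=
  match k with
  | 0 => fun _ _ => true
  | k'.+1 => fun l p => (odd_interlaced l p.1.1 && even_interlaced p.1.1 p.1.2) && valid_pattern p.1.2 p.2
  end.

Fixpoint pattern_weight k : {ffun 'I_k -> 'I_M} -> pattern k -> K :=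
  match k with
  | 0 => fun _ _ => 1
  | k'.+1 => fun l p =>
       (x k'.+1 ^+ k'.+1 * (\prod_s x k'.+1 ^- l s) * (\prod_s x k'.+1 ^+ (2 * p.1.1 s))
         * (\prod_s x k'.+1 ^- p.1.2 s)) * pattern_weight p.1.2 p.2
  end.

Lemma pattern_sumE k (l : {ffun 'I_k -> 'I_M}) :
  pattern_sum x l = \sum_(p : pattern k | valid_pattern l p) pattern_weight l p.
Proof.
elim: k l => [|k IH] l /=; first by rewrite (big_pred1 tt) //; case.
rewrite pair_big_dep /=.
under eq_bigr => p _ do rewrite IH mulr_sumr.
by rewrite pair_big_dep.
Qed.

(** The pattern with prescribed entries: [FO j] is row 2j - 1 and [FI j] is row 2j,
shifted. *)
Fixpoint encode k (FO FI : nat -> nat -> nat) : pattern k :=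
  match k with
  | 0 => tt
  | k'.+1 => ([ffun s : 'I_k'.+1 => inord (FO k'.+1 s)], [ffun s : 'I_k' => inord (FI k' s)],
              encode k' FO FI)
  end.

Fixpoint pat_odd k : pattern k -> nat -> nat -> nat :=
  match k with
  | 0 => fun _ _ _ => 0%N
  | k'.+1 => fun p j s => if j == k'.+1 then p.1.1 (inord s) : nat else pat_odd p.2 j s
  end.

Fixpoint pat_even k : {ffun 'I_k -> 'I_M} -> pattern k -> nat -> nat -> nat :=
  match k with
  | 0 => fun _ _ _ _ => 0%N
  | k'.+1 => fun l p j s => if j == k'.+1 then l (inord s) : nat else pat_even p.1.2 p.2 j s
  end.

Lemma pat_even_top k (l : {ffun 'I_k -> 'I_M}) p (s : 'I_k) : pat_even l p k s = l s.
Proof. by case: k l p s => [|k] l p s; [case: s | rewrite /= eqxx inord_val]. Qed.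

Lemma eq_encode k FO FI FO' FI' :
  (forall j s, (s < j <= k)%N -> FO j s = FO' j s) ->
  (forall j s, (s < j < k)%N -> FI j s = FI' j s) -> encode k FO FI = encode k FO' FI'.
Proof.
elim: k => [//|k IH] hO hI /=; congr (_, _, _).
- by apply/ffunP => s; rewrite !ffunE hO // ltn_ord leqnn.
- by apply/ffunP => s; rewrite !ffunE hI // ltn_ord ltnS leqnn.
apply: IH => j s h; [apply: hO | apply: hI]; lia.
Qed.

Lemma encode_pat k (l : {ffun 'I_k -> 'I_M}) (p : pattern k) : encode k (pat_odd p) (pat_even l p) = p.
Proof.
elim: k l p => [|k IH] l; first by case.
case=> [[o l'] p] /=; congr (_, _, _).
- by apply/ffunP => s; rewrite ffunE eqxx !inord_val.
- apply/ffunP => s; rewrite ffunE ltn_eqF ?ltnS //.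
  by rewrite pat_even_top inord_val.
rewrite -[RHS](IH l'); apply: eq_encode => j s h.
  by rewrite ltn_eqF // ltnS; case/andP: h.
by rewrite ltn_eqF // ltnS ltnW //; case/andP: h.
Qed.

Lemma encode_inj k FO FI FO' FI' :
  (forall j s, (s < j <= k)%N -> (FO j s < M)%N && (FO' j s < M)%N) ->
  (forall j s, (s < j < k)%N -> (FI j s < M)%N && (FI' j s < M)%N) ->
  encode k FO FI = encode k FO' FI' ->
  (forall j s, (s < j <= k)%N -> FO j s = FO' j s) /\
  (forall j s, (s < j < k)%N -> FI j s = FI' j s).
Proof.
elim: k => [|k IH] hO hI /=; first by move=> _; split=> j s; lia.
case=> eO eI /IH[||h1 h2].
- by move=> j s h; apply: hO; lia.
- by move=> j s h; apply: hI; lia.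
split=> j s h.
  have [e|ne] := eqVneq j k.+1; last by apply: h1; lia.
  rewrite e in h *; have hs : (s < k.+1)%N by lia.
  have /andP[b1 b2] := hO _ _ h.
  have /ffunP/(_ (Ordinal hs)) := eO; rewrite !ffunE /= => /(congr1 val).
  by rewrite /= !inordK.
have [e|ne] := eqVneq j k; last by apply: h2; lia.
rewrite e in h *; have hs : (s < k)%N by lia.
have /andP[b1 b2] := hI _ _ h.
have /ffunP/(_ (Ordinal hs)) := eI; rewrite !ffunE /= => /(congr1 val).
by rewrite /= !inordK.
Qed.

Definition interlacing k (FO FI : nat -> nat -> nat) :=
  forall j s, (s < j <= k)%N ->
    [/\ FO j s < FI j s, (0 < s)%N -> FI j s.-1 <= FO j s
      & (s.+1 < j)%N -> FO j s < FI j.-1 s <= FO j s.+1]%N.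

(** The recursive description of patterns in terms of all entries at once. *)
Lemma valid_interlacing k (l : {ffun 'I_k -> 'I_M}) (p : pattern k) :
  valid_pattern l p -> interlacing k (pat_odd p) (pat_even l p).
Proof.
elim: k l p => [|k IH] l; first by move=> ? ? j s; lia.
case=> [[o l'] p] /= /andP[/andP[/forallP h1 /forallP h2] /IH h3] j s hj.
have [e|ne] := eqVneq j k.+1; last first.
  have [|a b c] := h3 j s; first by lia.
  split=> // h; rewrite (_ : (j.-1 == k.+1) = false); first by apply: c.
  by apply/negP => /eqP; lia.
rewrite e in hj *; rewrite /= ?eqxx; have hs : (s < k.+1)%N by lia.
have /andP[a b] := h1 (inord s).
split=> // [s0|sk].
  move: a; rewrite /prev_part inordK // (negPf (lt0n_neq0 s0)) => a.
  apply: leq_trans a; rewrite leq_eqVlt; apply/orP; left; apply/eqP.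
  by congr (nat_of_ord (l _)); apply: ord_inj; rewrite ord_predE ?inordK //; lia.
rewrite (ltn_eqF (ltnSn k)).
have sk' : (s < k)%N by lia.
have /= := pat_even_top l' p (Ordinal sk'); move=> ->.
have := h2 (Ordinal sk').
rewrite (_ : widen_ord _ _ = inord s); last by apply/val_inj; rewrite /= inordK.
by rewrite (_ : lift _ _ = inord s.+1) //; apply/val_inj; rewrite /= inordK.
Qed.

Lemma encode_valid k FO FI : interlacing k FO FI ->
  (forall j s, (s < j <= k)%N -> (FI j s < M)%N) ->
  valid_pattern [ffun s : 'I_k => inord (FI k s)] (encode k FO FI).
Proof.
elim: k => [//|k IH] h b /=; rewrite IH; last first.
- by move=> j s hs; apply: b; lia.
- by move=> j s hs; apply: h; lia.
have bO j s : (s < j <= k.+1)%N -> (FO j s < M)%N.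
  by move=> hs; have [h1 _ _] := h _ _ hs; apply: ltn_trans h1 (b _ _ hs).
have bI' (s : 'I_k.+1) : (FI k.+1 s < M)%N by apply: b; rewrite ltn_ord leqnn.
have bO' (s : 'I_k.+1) : (FO k.+1 s < M)%N by apply: bO; rewrite ltn_ord leqnn.
rewrite andbT; apply/andP; split; apply/forallP => s.
  have hs : (s < k.+1 <= k.+1)%N by rewrite ltn_ord leqnn.
  have [h1 h2 _] := h _ _ hs.
  rewrite /prev_part !ffunE !inordK ?bI' ?bO' // h1 andbT.
  by case: eqP => // /eqP; rewrite -lt0n => s0; rewrite ord_predE // h2.
have hs : (s < k.+1 <= k.+1)%N by have := ltn_ord s; lia.
have hs' : (s.+1 < k.+1 <= k.+1)%N by have := ltn_ord s; lia.
have [_ _] := h _ _ hs; rewrite !ltnS ltn_ord => /(_ isT) /=.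
rewrite !ffunE !inordK ?bO //; apply: b.
by have := ltn_ord s; lia.
Qed.

Lemma pattern_weight_encode k FO FI :
  (forall j s, (s < j <= k)%N -> (FO j s < M)%N && (FI j s < M)%N) ->
  pattern_weight [ffun s : 'I_k => inord (FI k s)] (encode k FO FI)
  = \prod_(1 <= j < k.+1) (x j ^+ j * (\prod_(s < j) x j ^- FI j s)
       * (\prod_(s < j) x j ^+ (2 * FO j s)) * (\prod_(s < j.-1) x j ^- FI j.-1 s)).
Proof.
elim: k => [|k IH] b /=; first by rewrite big_nil.
rewrite big_nat_recr //= IH; last by move=> j s h; apply: b; lia.
rewrite mulrC; congr (_ * _); congr (_ * _ * _ * _); apply: eq_bigr => s _; rewrite !ffunE inordK //.
- by apply: (andP (b k.+1 s _)).2; rewrite ltn_ord leqnn.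
- by apply: (andP (b k.+1 s _)).1; rewrite ltn_ord leqnn.
by apply: (andP (b k s _)).2; have := ltn_ord s; lia.
Qed.
End PatternType.

Section PPPatterns.
Local Open Scope ring_scope.
Variables (N m : nat).
Local Notation PPt := (PP N m).
Local Notation L := (m + N)%N.

(** Row 2j - 1 consists of the entries on the diagonal through the outer cell (j, N + 1
- j), row 2j of those on the diagonal through (j, N - j), read towards the corner. Parts
in column 0 or beyond are equal to m by the convention for [entry]; they are the parts
that the rectangular top row forces to be m. *)
Definition odd_part (f : filling N m) j s := (entry f (j - s) (N.+1 - j - s) + s)%N.
Definition even_part (f : filling N m) j s := (entry f (j - s) (N - j - s) + s.+1)%N.

Lemma odd_part_lt f j s : (s < j <= N)%N -> (odd_part f j s < L.+1)%N.
Proof. by rewrite /odd_part => h; have := entry_le f (j - s) (N.+1 - j - s); lia. Qed.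

Lemma even_part_lt f j s : (s < j <= N)%N -> (even_part f j s < L.+1)%N.
Proof. by rewrite /even_part => h; have := entry_le f (j - s) (N - j - s); lia. Qed.

Lemma even_part_top f s : even_part f N s = (m + s.+1)%N.
Proof. by rewrite /even_part subnn sub0n entry0r. Qed.

Lemma pp_interlacing f : is_pp f -> interlacing N (odd_part f) (even_part f).
Proof.
move=> hf j s hs; have P := is_ppP hf; rewrite /odd_part /even_part; split=> [|s0|sj].
- have [h|h] := posnP (N.+1 - j - s)%N.
    by rewrite h (_ : (N - j - s)%N = 0%N) ?addnS //; lia.
  have -> : (N.+1 - j - s = (N - j - s).+1)%N by lia.
  rewrite addnS ltnS leq_add2r P //; lia.
- have -> : (j - s.-1 = (j - s).+1)%N by lia.
  have -> : (N - j - s.-1 = N.+1 - j - s)%N by lia.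
  by rewrite prednK // leq_add2r P //; lia.
have -> : (N - j.-1 = N.+1 - j)%N by lia.
have -> : (j.-1 - s = j - s.+1)%N by lia.
have e : (j - s = (j - s.+1).+1)%N by lia.
apply/andP; split.
  by rewrite [in X in (X <= _)%N]e addnS ltnS leq_add2r P //; lia.
rewrite leq_add2r; have [h|h] := posnP (N.+1 - j - s)%N.
  by rewrite h (_ : (N.+1 - j - s.+1)%N = 0%N) //; lia.
have -> : (N.+1 - j - s = (N.+1 - j - s.+1).+1)%N by lia.
by rewrite P //; lia.
Qed.

Definition encode_pp (p : PPt) : pattern L N := encode L N (odd_part (val p)) (even_part (val p)).

Definition top_row : {ffun 'I_N -> 'I_L.+1} := [ffun s : 'I_N => inord (m + s.+1)].

Lemma top_rowE f : top_row = [ffun s : 'I_N => inord (even_part f N s)].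
Proof. by apply/ffunP => s; rewrite !ffunE even_part_top. Qed.

Lemma encode_pp_valid p : valid_pattern top_row (encode_pp p).
Proof.
rewrite (top_rowE (val p)); apply: encode_valid; first exact: pp_interlacing (valP p).
by move=> j s; apply: even_part_lt.
Qed.

Lemma cell_leN (c : cell N) : (crow c + ccol c <= N.+1)%N.
Proof. by case: c => -[a b] /= h; case/and3P: (h). Qed.

Lemma encode_pp_inj : injective encode_pp.
Proof.
move=> p p' /encode_inj[j s h|j s h|hO hI].
- by rewrite !odd_part_lt.
- by rewrite !even_part_lt //; lia.
apply/val_inj/ffunP => c; apply/val_inj.
have c1 := crow_gt0 c; have c2 := ccol_gt0 c; have c3 := cell_leN c.
rewrite /= -!entry_cell; set d := (N.+1 - crow c - ccol c)%N.
have [od|ed] := boolP (odd d).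
  have := hI (crow c + d./2)%N d./2; rewrite /even_part addnK.
  have -> : (N - (crow c + d./2) - d./2 = ccol c)%N by lia.
  by move=> h; apply/eqP; rewrite -(eqn_add2r d./2.+1) h //; lia.
have := hO (crow c + d./2)%N d./2; rewrite /odd_part addnK.
have -> : (N.+1 - (crow c + d./2) - d./2 = ccol c)%N by lia.
by move=> h; apply/eqP; rewrite -(eqn_add2r d./2) h //; lia.
Qed.

Lemma entry_out (f : filling N m) a b : (0 < a)%N -> (0 < b)%N -> (N.+1 < a + b)%N -> entry f a b = 0%N.
Proof.
move=> a0 b0 ab; have [[c [e1 e2] _]|[_ //]] := entryP f a0 b0.
by have := cell_leN c; lia.
Qed.

Lemma cell_exists a b : (0 < a)%N -> (0 < b)%N -> (a + b <= N.+1)%N ->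
  exists c : cell N, crow c = a /\ ccol c = b.
Proof.
move=> a0 b0 ab.
have ha : (a < N.+1)%N by lia.
have hb : (b < N.+1)%N by lia.
have hc : [&& 0 < (Ordinal ha, Ordinal hb).1, 0 < (Ordinal ha, Ordinal hb).2
     & (Ordinal ha, Ordinal hb).1 + (Ordinal ha, Ordinal hb).2 <= N.+1]%N.
  by rewrite /= a0 b0.
by exists (Sub (Ordinal ha, Ordinal hb) hc).
Qed.

(** The parts of a valid pattern in column 0 or beyond are squeezed between m and m, by
downward induction from the top row; all others are read off as entries of a plane
partition. *)
Lemma encode_pp_surj (p : pattern L N) : valid_pattern top_row p -> exists q, encode_pp q = p.
Proof.
move=> vp; have V := valid_interlacing vp.
set GO := pat_odd p in V; set GI := pat_even top_row p in V.
have top s : (s < N)%N -> GI N s = (m + s.+1)%N.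
  move=> hs; have /= := pat_even_top top_row p (Ordinal hs); rewrite -/GI => ->.
  by rewrite ffunE inordK //=; lia.
have low j s : (s < j <= N)%N -> (s <= GO j s < GI j s)%N.
  elim: s => [|s IH] h; first by have [->] := V _ _ h.
  have [-> /(_ isT) h2 _] := V _ _ h.
  by have /andP[h3 h4] := IH ltac:(lia); rewrite andbT (leq_trans _ h2) // (leq_ltn_trans h3).
have up i : forall j s, (N - j = i)%N -> (s < j <= N)%N -> (GI j s <= m + s.+1)%N.
  elim: i => [|i IH] j s ji h.
    by have -> : j = N; [lia | rewrite top //; lia].
  have hs : (s < j.+1 <= N)%N by lia.
  have [_ _ /(_ ltac:(lia)) /andP[_ h1]] := V _ _ hs.
  have hs' : (s.+1 < j.+1 <= N)%N by lia.
  have [h2 _ _] := V _ _ hs'.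
  by have := IH j.+1 s.+1 ltac:(lia) hs'; rewrite /= in h1; lia.
(* part s of row 2j is in column 0 or beyond if N <= j + s, of row 2j - 1 if N < j + s *)
have frozen i : forall j s, (N - j = i)%N -> (s < j <= N)%N -> (N <= j + s)%N -> (m + s.+1 <= GI j s)%N.
  elim: i => [|i IH] j s ji h hN.
    by have -> : j = N; [lia | rewrite top //; lia].
  have hs : (s < j.+1 <= N)%N by lia.
  have [_ /(_ ltac:(lia)) h1 /(_ ltac:(lia)) /andP[h2 _]] := V _ _ hs.
  rewrite /= in h2.
  by have := IH j.+1 s.-1 ltac:(lia) ltac:(lia) ltac:(lia); lia.
have frozenO j s : (s < j <= N)%N -> (N < j + s)%N -> GO j s = (m + s)%N.
  move=> h hN; have [h1 /(_ ltac:(lia)) h2 _] := V _ _ h.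
  have := up _ j s erefl h; have := frozen _ j s.-1 erefl ltac:(lia) ltac:(lia); lia.
(* (a, b) is part d / 2 of an odd row if d is even, of an even row if d is odd *)
pose val_at a b := let d := (N.+1 - a - b)%N in
  (if odd d then GI (a + d./2) d./2 - d./2.+1 else GO (a + d./2) d./2 - d./2)%N.
have val_le a b : (0 < a)%N -> (0 < b)%N -> (a + b <= N.+1)%N -> (val_at a b <= m)%N.
  move=> a0 b0 ab; rewrite /val_at; set d := (N.+1 - a - b)%N.
  have hs : (d./2 < a + d./2 <= N)%N by lia.
  have := up _ _ _ erefl hs; have := low _ _ hs; case: (odd d); lia.
pose f : filling N m := [ffun c => inord (val_at (crow c) (ccol c))].
have fE a b : (0 < a)%N -> (0 < b)%N -> (a + b <= N.+1)%N -> entry f a b = val_at a b.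
  move=> a0 b0 ab; have [c [<- <-]] := cell_exists a0 b0 ab.
  rewrite entry_cell ffunE inordK // ltnS val_le ?crow_gt0 ?ccol_gt0 //.
  exact: cell_leN.
have fpp : is_pp f.
  apply/forallP => c; rewrite -entry_cell.
  have a0 := crow_gt0 c; have b0 := ccol_gt0 c; have ab := cell_leN c.
  move: (crow c) (ccol c) a0 b0 ab => a b a0 b0 ab.
  have [e|ne] := eqVneq (a + b)%N N.+1.
    by rewrite (@entry_out f a.+1 b) ?(@entry_out f a b.+1) //; lia.
  rewrite !fE //; try lia.
  rewrite /val_at; set d := (N.+1 - a - b)%N.
  have -> : (N.+1 - a.+1 - b = d.-1)%N by lia.
  have -> : (N.+1 - a - b.+1 = d.-1)%N by lia.
  have d0 : (0 < d)%N by lia.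
  have [od|ed] := boolP (odd d).
    have -> : odd d.-1 = false by lia.
    have -> : (d.-1)./2 = d./2 by lia.
    have hs : (d./2 < a + d./2 <= N)%N by lia.
    have hs' : (d./2 < a.+1 + d./2 <= N)%N by lia.
    have [h1 _ _] := V _ _ hs; have [_ _ h2] := V _ _ hs'.
    have := h2 ltac:(lia); rewrite addSn /=; have := low _ _ hs; have := low _ _ hs'; lia.
  have -> : odd d.-1 by lia.
  have -> : (d.-1)./2 = d./2.-1 by lia.
  have -> : (a.+1 + d./2.-1 = a + d./2)%N by lia.
  have hs : (d./2 < a + d./2 <= N)%N by lia.
  have hs' : (d./2.-1 < a + d./2 <= N)%N by lia.
  have [_ /(_ ltac:(lia)) h1 _] := V _ _ hs; have [_ _ h2] := V _ _ hs'.
  have := h2 ltac:(lia); rewrite prednK; last by lia.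
  have -> : ((a + d./2).-1 = a + d./2.-1)%N by lia.
  have := low _ _ hs; have := low _ _ hs'; lia.
exists (Sub f fpp); rewrite /encode_pp /= -[RHS](encode_pat top_row) -/GO -/GI.
apply: eq_encode => j s h.
  rewrite /odd_part; have [h0|h0] := posnP (N.+1 - j - s)%N.
    by rewrite h0 entry0r frozenO //; lia.
  rewrite fE; try lia.
  rewrite /val_at (_ : (N.+1 - (j - s) - (N.+1 - j - s) = s.*2)%N); last by lia.
  rewrite odd_double doubleK (_ : (j - s + s = j)%N); last by lia.
  by have := low j s h; lia.
have hs : (s < j <= N)%N by lia.
rewrite /even_part; have [h0|h0] := posnP (N - j - s)%N.
  rewrite h0 entry0r; have := up _ _ _ erefl hs; have := frozen _ _ _ erefl hs; lia.
rewrite fE; try lia.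
rewrite /val_at (_ : (N.+1 - (j - s) - (N - j - s) = s.*2.+1)%N); last by lia.
rewrite /= odd_double /= uphalf_double (_ : (j - s + s = j)%N); last by lia.
have [h1 _ _] := V _ _ hs; have := low j s hs; lia.
Qed.

End PPPatterns.

Section LinearWeight.
Local Open Scope ring_scope.
Variables (N m : nat).

(** The complement m - f, which increases away from the corner and vanishes on the
boundary. *)
Definition coentry (f : filling N m) a b : int := m%:Z - (entry f a b)%:Z.

Definition diag_sum (g : nat -> nat -> int) a b : int := \sum_(s < a) g (a - s)%N (b - s)%N.

(** The exponent of q in the weight of the pattern of f at x_i = q^-i, normalised to be
0 when f is constant equal to m. *)
Definition king_weight (f : filling N m) : int :=
  let D := diag_sum (coentry f) in
  \sum_(1 <= j < N.+1) j%:Z * (D j (N.+1 - j)%N *+ 2 - D j (N - j)%N - D j.-1 (N.+1 - j)%N).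

Variable K : fieldType.

Lemma prod_exprz (u : K) I (r : seq I) (P : pred I) (F : I -> int) : u != 0 ->
  \prod_(i <- r | P i) u ^ F i = u ^ (\sum_(i <- r | P i) F i).
Proof.
move=> u0; elim/big_rec2: _ => [|i z y _ ->]; first by rewrite expr0z.
by rewrite expfzDr.
Qed.

Lemma sum_succ n : \sum_(s < n) (s.+1)%:Z = \sum_(s < n) s%:Z + n%:Z.
Proof.
elim: n => [|n IH]; first by rewrite !big_ord0.
rewrite !big_ord_recr /= IH; ring.
Qed.

Lemma sum_even_part (f : filling N m) j : \sum_(s < j) (even_part f j s)%:Z
  = (m * j)%N%:Z - diag_sum (coentry f) j (N - j)%N + \sum_(s < j) s%:Z + j%:Z.
Proof.
rewrite /diag_sum -addrA -sum_succ PoszM.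
have -> : m%:Z * j%:Z = \sum_(s < j) m%:Z by rewrite sumr_const card_ord -mulr_natr natz.
rewrite -sumrB -big_split /=; apply: eq_bigr => s _.
by rewrite /even_part /coentry PoszD opprB addrCA subrr addr0.
Qed.

Lemma sum_odd_part (f : filling N m) j : \sum_(s < j) (odd_part f j s)%:Z
  = (m * j)%N%:Z - diag_sum (coentry f) j (N.+1 - j)%N + \sum_(s < j) s%:Z.
Proof.
rewrite /diag_sum PoszM.
have -> : m%:Z * j%:Z = \sum_(s < j) m%:Z by rewrite sumr_const card_ord -mulr_natr natz.
rewrite -sumrB -big_split /=; apply: eq_bigr => s _.
by rewrite /odd_part /coentry PoszD opprB addrCA subrr addr0.
Qed.

Lemma pattern_weight_king (q : K) (p : PP N m) : q != 0 ->
  q ^ king_weight (val p)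
  = q ^+ (\sum_(1 <= j < N.+1) m * j) * pattern_weight (fun j => q^-1 ^+ j) (top_row N m) (encode_pp p).
Proof.
move=> q0; rewrite (top_rowE (val p)) pattern_weight_encode; last first.
  by move=> j s h; rewrite odd_part_lt ?even_part_lt.
rewrite [q ^+ _]exprnP -natz natr_sum -[in RHS]prod_exprz // -big_split /= /king_weight -prod_exprz //.
apply: eq_big_nat => j /andP[j0 jN].
set u := q^-1 ^+ j; have u0 : u != 0 by rewrite expf_neq0 ?invr_eq0.
set D := diag_sum _.
have uE (z : int) : u ^ z = q ^ (- (j%:Z * z)).
  by rewrite /u exprnP exprz_inv exprz_exp mulNr.
transitivity (q ^ (m * j)%N%:R * u ^ (j%:Z - \sum_(s < j) (even_part (val p) j s)%:Z
   + 2 * (\sum_(s < j) (odd_part (val p) j s)%:Z) - \sum_(s < j.-1) (even_part (val p) j.-1 s)%:Z)); last first.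
  congr (_ * _); rewrite !expfzDr //; congr (_ * _ * _ * _).
  - by rewrite -sumrN -prod_exprz //; apply: eq_bigr => s _; rewrite -exprnN.
  - by rewrite mulr_sumr -prod_exprz //; apply: eq_bigr => s _; rewrite exprnP PoszM.
  - by rewrite -sumrN -prod_exprz //; apply: eq_bigr => s _; rewrite -exprnN.
rewrite uE -expfzDr //; congr (q ^ _).
rewrite !sum_even_part !sum_odd_part -/D.
have -> : (N - j.-1 = N.+1 - j)%N by lia.
case: j j0 jN @u u0 uE => // j _ _ _ _ _ /=.
rewrite [\sum_(s < j.+1) s%:Z]big_ord_recr /= !PoszM; set S := \sum_(s < j) _.
rewrite natz PoszM !(intS j); move: (D _ _) (D _ _) (D _ _) S => a b c S; ring.
Qed.

Lemma sum_king_weight (q : K) : q != 0 ->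
  \sum_(p : PP N m) q ^ king_weight (val p)
  = q ^+ (\sum_(1 <= j < N.+1) m * j) * pattern_sum (fun j => q^-1 ^+ j) (top_row N m).
Proof.
move=> q0; rewrite (eq_bigr _ (fun p _ => pattern_weight_king p q0)).
rewrite -mulr_sumr pattern_sumE; congr (_ * _).
rewrite -(big_imset (fun p => pattern_weight (fun j => q^-1 ^+ j) (top_row N m) p) (h := @encode_pp N m)) /=; last first.
  by move=> ? ? _ _; apply: encode_pp_inj.
apply: eq_bigl => p; apply/imsetP/idP => [[p' _ ->]|/encode_pp_surj[p' <-]].
  exact: encode_pp_valid.
by exists p'.
Qed.
End LinearWeight.

Section ProductFormula.
Local Open Scope ring_scope.
Variable K : fieldType.

Lemma sum_king_weight0 N (q : K) : \sum_(p : PP N 0) q ^ king_weight (val p) = 1.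
Proof.
have e0 (f : filling N 0) a b : entry f a b = 0%N by have := entry_le f a b; case: entry.
have pp0 : is_pp ([ffun=> ord0] : filling N 0) by apply/forallP => c; rewrite !e0.
rewrite (big_pred1 (Sub [ffun=> ord0] pp0)) => [|p].
  rewrite /king_weight big1 ?expr0z // => j _.
  have D0 a b : diag_sum (coentry (val (Sub [ffun=> ord0] pp0 : PP N 0))) a b = 0.
    by rewrite /diag_sum big1 // => s _; rewrite /coentry e0.
  by rewrite !D0 !subr0 mulr0.
by apply/esym/eqP/val_inj/ffunP => c; apply/val_inj; rewrite [RHS]/= ffunE; case: (val p c) => -[].
Qed.

(** The unknown factor between the sum and the determinant is the same for all m, and
for m = 0 the sum is 1. *)
Lemma king_product N m (q : K) : q != 0 -> (forall i, (0 < i <= N.*2)%N -> q ^+ i != 1) ->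
  (\sum_(p : PP N m) q ^ king_weight (val p))
     * (\prod_(i < N) \prod_(j < N | (i <= j)%N) (1 - q ^+ (i + j + 2)))
  = \prod_(i < N) \prod_(j < N | (i <= j)%N) (1 - q ^+ (2 * m + i + j + 2)%N).
Proof.
move=> q0 hq; set r := q^-1.
have r0 : r != 0 by rewrite invr_eq0.
have hr i : (0 < i <= N.*2)%N -> r ^+ i != 1 by move=> h; rewrite exprVn invr_eq1 hq.
have [C hC] : exists C : K, forall M (l : {ffun 'I_N -> 'I_M}),
    (forall s, prev_part l s <= l s)%N -> pattern_sum (fun j => r ^+ j) l = C * sp_det (fun j => r ^+ j) (fun s => l s).
  apply: (pattern_sum_sp_det (N := N)) => //.
  - by move=> i _; rewrite expf_neq0.
  - by move=> i h; rewrite -exprM hr //; lia.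
  - move=> i j h1 h2; rewrite -(subnKC (_ : i <= j)%N); last by lia.
    rewrite exprD -[X in X != _]mulr1 (inj_eq (mulfI _)) ?expf_neq0 // eq_sym hr //; lia.
  by move=> i j h1 h2; rewrite -exprD hr //; lia.
have top m' : pattern_sum (fun j => r ^+ j) (top_row N m') = C * sp_det (fun j => r ^+ j) (fun s : 'I_N => m' + s + 1)%N.
  rewrite hC; last first.
    move=> s; rewrite /prev_part /top_row; case: N s {hq hr hC} => [[]//|n] s.
    case: eqP => // /eqP s0; rewrite !ffunE !inordK ?ord_predE ?lt0n //; have := ltn_ord s; lia.
  congr (_ * \det _); apply/matrixP => i s; rewrite !mxE /top_row ffunE inordK; last by have := ltn_ord s; lia.
  by have -> : (m' + s + 1 = m' + s.+1)%N by lia.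
(* for m = 0 the product of C and the determinant is 1 *)
have := sum_king_weight0 N q; rewrite !sum_king_weight // !top.
rewrite [X in q ^+ X]big1 ?expr0 ?mul1r // => e1.
have := sp_det_shift N m r0; rewrite -/r.
move=> /(congr1 (fun y => C * y)); rewrite [in RHS]mulrA e1 mul1r mulrA.
set S := C * sp_det _ _ => e2.
have fac a : 1 - r ^+ a = - r ^+ a * (1 - q ^+ a).
  by rewrite mulNr mulrBr mulr1 -exprMn mulVf // expr1n opprB.
pose P (F : nat -> nat -> K) := \prod_(i < N) \prod_(j < N | (i <= j)%N) F i j.
have PM F G : P (fun i j => F i j * G i j) = P F * P G.
  by rewrite /P -big_split; apply: eq_bigr => i _; rewrite big_split.
have Peq F G : (forall i j, F i j = G i j) -> P F = P G.
  by move=> FG; apply: eq_bigr => i _; apply: eq_bigr => j _; apply: FG.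
have e3 : q ^+ (\sum_(1 <= j < N.+1) m * j) = P (fun i j => q ^+ m).
  rewrite /P (exchange_big_dep predT) //= expr_sum big_add1 big_mkord /=.
  apply: eq_bigr => j _; rewrite prodr_const exprM; congr (_ ^+ _).
  rewrite -[LHS](card_ord j.+1) -(card_image (f := widen_ord (ltn_ord j))); last by move=> x y /(congr1 val) /= /val_inj.
  apply: eq_card => i; apply/imageP/idP => [[k _ ->]|ij]; first exact: (ltn_ord k).
  by exists (Ordinal (ij : (i < j.+1)%N)) => //; apply/val_inj.
have Pn0 F : (forall i j, F i j != 0) -> P F != 0.
  by move=> h; apply/prodf_neq0 => i _; apply/prodf_neq0 => j _.
apply: (mulfI (Pn0 (fun i j => - r ^+ (2 * m + i + j + 2)%N) _)).
  by move=> i j; rewrite oppr_eq0 expf_neq0.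
rewrite -/(P (fun i j => 1 - q ^+ (i + j + 2)%N)) -/(P (fun i j => 1 - q ^+ (2 * m + i + j + 2)%N)).
rewrite -[RHS]PM.
transitivity (P (fun i j => 1 - r ^+ (2 * m + i + j + 2)%N)); last first.
  by apply: Peq => i j; rewrite fac.
transitivity (S * P (fun i j => r ^+ m * (1 - r ^+ (i + j + 2)%N))); last exact: e2.
rewrite e3 -/r [P (fun i j => q ^+ m) * _]mulrC -mulrA mulrCA; congr (_ * _).
rewrite -!PM; apply: Peq => i j.
rewrite fac !mulrA; congr (_ * _).
rewrite (_ : (2 * m + i + j + 2 = m + (m + (i + j + 2)))%N); last by lia.
have h : r ^+ m * q ^+ m = 1 by rewrite -exprMn mulVf ?expr1n.
by rewrite !(exprD r m) -[in RHS](mulr1 (r ^+ m)) -h; ring.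
Qed.
End ProductFormula.

(** * Toggles, and the conjugacy of rowmotion and promotion *)

Section Toggles.
Variables (N m : nat).
Local Notation PPt := (PP N m).

(** Neither equal nor adjacent, so that the toggles at the two cells do not see each
other. *)
Definition far_cells (c d : cell N) : bool :=
  (1 < (crow c - crow d) + (crow d - crow c) + ((ccol c - ccol d) + (ccol d - ccol c)))%N.

Lemma eq_entry (f f' : filling N m) i j :
  (forall c, crow c = i -> ccol c = j -> f c = f' c) -> entry f i j = entry f' i j.
Proof.
move=> h; rewrite /entry; case: ifP => // _.
by case: pickP => // c /andP[/eqP e1 /eqP e2]; rewrite (h c).
Qed.

Lemma toggle_filling_local (f f' : filling N m) d :
  (forall c, ~~ far_cells c d -> f c = f' c) -> toggle_filling d f d = toggle_filling d f' d.
Proof.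
move=> h; rewrite !ffunE eqxx /toggle_value; congr inord.
have e i j : (crow d - i + (i - crow d) + ((ccol d - j) + (j - ccol d)) <= 1)%N ->
    entry f i j = entry f' i j.
  by move=> le; apply: eq_entry => c e1 e2; apply: h; rewrite /far_cells e1 e2 -leqNgt; lia.
have d1 := crow_gt0 d; have d2 := ccol_gt0 d.
by rewrite /upper /lower -!entry_cell !e //; lia.
Qed.

(** A product of toggles at pairwise far cells acts on all these cells simultaneously;
this description no longer depends on the order of the factors. *)
Definition toggles_on (g : {perm PPt}) (A : pred (cell N)) :=
  forall (p : PPt) d, val (g p) d = if A d then toggle_filling d (val p) d else val p d.

Lemma toggles_on_ext g h A B : toggles_on g A -> toggles_on h B -> A =1 B -> g = h.
Proof.
move=> gA hB AB; apply/permP => p; apply/val_inj/ffunP => d.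
by rewrite [LHS]gA [RHS]hB AB.
Qed.

Lemma toggles_on1 : toggles_on 1 pred0.
Proof. by move=> p d; rewrite perm1. Qed.

Lemma toggles_on_toggle c : toggles_on (toggle_perm m c) (pred1 c).
Proof.
move=> p d; rewrite permE /toggle /= !ffunE eqxx.
by case: eqP => // ->.
Qed.

Lemma toggles_on_mul g h A B : toggles_on g A -> toggles_on h B ->
  (forall c d, A c -> B d -> far_cells c d) -> toggles_on (g * h) (predU A B).
Proof.
move=> gA hB AB p d; rewrite permM hB /=.
have [Bd|nBd] := boolP (B d); last by rewrite orbF gA.
rewrite orbT; apply: toggle_filling_local => c nf.
by rewrite gA ifN //; apply: contra nf => Ac; apply: AB.
Qed.

Lemma toggles_on_prod (I : eqType) (r : seq I) (P : pred I) (G : I -> {perm PPt})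
    (A : I -> pred (cell N)) :
  uniq r -> (forall i, toggles_on (G i) (A i)) ->
  (forall i j c d, i != j -> P i -> P j -> A i c -> A j d -> far_cells c d) ->
  toggles_on (\prod_(i <- r | P i) G i) (fun c => has (fun i => P i && A i c) r).
Proof.
move=> ur GA far_A; elim: r ur => [_|i r IH /= /andP[ir ur]].
  by rewrite big_nil; apply: toggles_on1.
rewrite big_cons; case: ifP => Pi /=; last exact: IH.
apply: toggles_on_mul => //; first exact: IH.
move=> c d Ac /hasP[j jr /andP[Pj Ad]]; apply: (far_A i j) => //.
by apply: contraNneq ir => ->.
Qed.

Lemma parity_far (c d : cell N) : c != d -> odd (crow c + ccol c) = odd (crow d + ccol d) -> far_cells c d.
Proof.
move=> cd odd_cd; rewrite /far_cells ltnNge; apply: contra cd => h.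
by apply/eqP; apply: cell_inj; lia.
Qed.

Lemma toggles_on_class (A : pred (cell N)) :
  (forall c d, c != d -> A c -> A d -> far_cells c d) ->
  toggles_on (\prod_(c | A c) toggle_perm m c) A.
Proof.
move=> h p d; rewrite (toggles_on_prod (A := fun c => pred1 c)) ?index_enum_uniq //.
- congr (if _ then _ else _).
  apply/hasP/idP => [[c _ /andP[Ac /eqP->]] //|Ad].
  by exists d; rewrite ?mem_index_enum //= Ad eqxx.
- by move=> c; apply: toggles_on_toggle.
by move=> c d' c' d'' ne Ac Ad /eqP-> /eqP->; apply: h.
Qed.
End Toggles.

Section OddEven.
Local Open Scope group_scope.
Variables (gT : finGroupType) (g : nat -> gT).
Hypothesis comm_g : forall i j, (i.+1 < j)%N -> commute (g i) (g j).

Lemma commute_prod (x : gT) (r : seq nat) (P : pred nat) :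
  (forall i, i \in r -> P i -> commute x (g i)) -> commute x (\prod_(i <- r | P i) g i).
Proof.
move=> h; rewrite big_seq_cond; elim/big_rec: _ => [|i y /andP[ir Pi] xy].
  exact: commute1.
by apply: commuteM => //; apply: h.
Qed.

(** Induction on r: the last factor joins the parity class it belongs to after the other
class has been moved around it by conjugation. The conjugating element involves only
factors that commute with all later ones. *)
Lemma prod_conj_parity r : exists h, (forall j, (r <= j)%N -> commute h (g j)) /\
  \prod_(0 <= i < r) g i
  = ((\prod_(0 <= i < r | odd i == odd r) g i) * (\prod_(0 <= i < r | odd i != odd r) g i)) ^ h.
Proof.
elim: r => [|r [h [hg IH]]].
  by exists 1; split=> [j _|]; [apply/commute_sym/commute1 | rewrite !big_nil mulg1 conjg1].
set A := \prod_(0 <= i < r | odd i == odd r) g i in IH.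
set B := \prod_(0 <= i < r | odd i != odd r) g i in IH.
have cA j : (r <= j)%N -> commute A (g j).
  move=> rj; apply/commute_sym/commute_prod => i; rewrite mem_index_iota => /andP[_ ir] /eqP oi.
  by apply/commute_sym/comm_g; apply: leq_trans rj; rewrite ltn_neqAle ir andbT; apply: contra_eq_neq oi => <-; rewrite /=; case: odd.
exists (A^-1 * h); split.
  move=> j rj; apply/commute_sym/commuteM; apply/commute_sym; last by apply: hg; apply: ltnW.
  by apply/commute_sym/commuteV/commute_sym/cA/ltnW.
have recr (P : pred nat) : \prod_(0 <= i < r.+1 | P i) g i
    = \prod_(0 <= i < r | P i) g i * (if P r then g r else 1).
  by rewrite big_mkcond big_nat_recr //= -big_mkcond.
have eA : \prod_(0 <= i < r.+1 | odd i == odd r.+1) g i = B.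
  rewrite recr /= (_ : (odd r == ~~ odd r) = false) ?mulg1; last by case: odd.
  by apply: eq_bigl => i; case: (odd i); case: (odd r).
have eB : \prod_(0 <= i < r.+1 | odd i != odd r.+1) g i = A * g r.
  rewrite recr /= (_ : (odd r != ~~ odd r) = true); last by case: odd.
  by congr (_ * _); apply: eq_bigl => i; case: (odd i); case: (odd r).
have e0 : \prod_(0 <= i < r.+1) g i = \prod_(0 <= i < r) g i * g r by rewrite big_nat_recr.
have e1 : g r = (g r) ^ h by rewrite conjgE -hg // mulKg.
rewrite eA eB e0 IH {1}e1 -conjMg conjgM; congr (_ ^ h).
by rewrite conjgE invgK cA // !mulgA mulgK.
Qed.
End OddEven.

Section Conjugacy.
Local Open Scope group_scope.
Variables (N m : nat).
Local Notation PPt := (PP N m).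

Lemma toggles_on_Rk k : toggles_on (Rk N m k) (fun c => crow c + ccol c - 1 == k)%N.
Proof.
apply: toggles_on_class => c d cd /eqP h1 /eqP h2; apply: parity_far => //.
have := crow_gt0 c; have := crow_gt0 d; lia.
Qed.

Lemma toggles_on_Fk k : toggles_on (Fk N m k) (fun c => (ccol c)%:Z - (crow c)%:Z == k)%R.
Proof.
by apply: toggles_on_class => c d cd /eqP h1 /eqP h2; apply: parity_far => //; lia.
Qed.

Lemma toggles_on_commute (g h : {perm PPt}) A B : toggles_on g A -> toggles_on h B ->
  (forall c d, A c -> B d -> far_cells c d) -> commute g h.
Proof.
move=> gA hB AB; rewrite /commute.
apply: (toggles_on_ext (toggles_on_mul gA hB AB) (toggles_on_mul hB gA _)) => [c d Bc Ad|c].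
  by have := AB _ _ Ad Bc; rewrite /far_cells; lia.
by rewrite /= orbC.
Qed.

Definition half_sweep (b : bool) : {perm PPt} :=
  \prod_(c | odd (crow c + ccol c) == b) toggle_perm m c.

Lemma toggles_on_half_sweep b : toggles_on (half_sweep b) (fun c => odd (crow c + ccol c) == b).
Proof.
by apply: toggles_on_class => c d cd /eqP h1 /eqP h2; apply: parity_far; rewrite ?h1 ?h2.
Qed.

(** Both for ranks i + j - 1 and for files j - i the classes of one parity together
contain the cells with i + j of one parity. This is what links rowmotion and
promotion. *)
Lemma Rk_half (b : bool) : \prod_(0 <= i < N | odd i == b) Rk N m i.+1 = half_sweep b.
Proof.
apply: (toggles_on_ext (toggles_on_prod (P := fun i => odd i == b) (iota_uniq _ _) (fun i => toggles_on_Rk i.+1) _) (toggles_on_half_sweep b)).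
  move=> i j c d ij /eqP oi /eqP oj /eqP ei /eqP ej; apply: parity_far; last by lia.
  by apply: contra ij => /eqP cd; rewrite -eqSS -ei -ej cd.
move=> c; have c1 := crow_gt0 c; have c2 := ccol_gt0 c; have c3 := cell_leN c.
apply/hasP/idP => [[i _ /andP[/eqP oi /eqP ei]]|/eqP o]; first by apply/eqP; lia.
exists (crow c + ccol c - 2)%N; first by rewrite mem_iota; lia.
by apply/andP; split; apply/eqP; lia.
Qed.

Lemma Fk_half (b : bool) :
  \prod_(0 <= t < N.*2.-1 | odd t == b) Fk N m (t%:Z - N%:Z + 1)%R = half_sweep (odd N (+) ~~ b).
Proof.
apply: (toggles_on_ext (toggles_on_prod (P := fun i => odd i == b) (iota_uniq _ _) (fun t => toggles_on_Fk (t%:Z - N%:Z + 1)%R) _)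
  (toggles_on_half_sweep _)).
  move=> i j c d ij /eqP oi /eqP oj /eqP ei /eqP ej; apply: parity_far; last by lia.
  by apply: contraNneq ij => cd; apply/eqP; rewrite cd in ei; lia.
move=> c; have c1 := crow_gt0 c; have c2 := ccol_gt0 c; have c3 := cell_leN c.
apply/hasP/idP => [[i _ /andP[/eqP oi /eqP ei]]|/eqP o]; first by apply/eqP; lia.
exists (ccol c + N - crow c - 1)%N; first by rewrite mem_iota; lia.
by apply/andP; split; apply/eqP; lia.
Qed.

Lemma Row_conj_Pr : exists h, Row N m = (Pr N m) ^ h.
Proof.
have commR i j : (i.+1 < j)%N -> commute (Rk N m i.+1) (Rk N m j.+1).
  move=> ij; apply: (toggles_on_commute (toggles_on_Rk _) (toggles_on_Rk _)) => c d /eqP ei /eqP ej.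
  rewrite /far_cells; lia.
have commF i j : (i.+1 < j)%N ->
    commute (Fk N m (i%:Z - N%:Z + 1)%R) (Fk N m (j%:Z - N%:Z + 1)%R).
  move=> ij; apply: (toggles_on_commute (toggles_on_Fk _) (toggles_on_Fk _)) => c d /eqP ei /eqP ej.
  rewrite /far_cells; lia.
have swap b : exists h, half_sweep b * half_sweep (~~ b) = (half_sweep true * half_sweep false) ^ h.
  case: b; first by exists 1; rewrite conjg1.
  by exists (half_sweep true); rewrite conjgE -mulgA mulKg.
have [h1 [_ e1]] := prod_conj_parity commR N.
have [h2 [_ e2]] := prod_conj_parity commF N.*2.-1.
have neqb (x y : bool) : (x != y) = (x == ~~ y) by case: x; case: y.
rewrite Rk_half (eq_bigl _ _ (fun i => neqb (odd i) (odd N))) Rk_half in e1.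
rewrite Fk_half (eq_bigl _ _ (fun i => neqb (odd i) (odd N.*2.-1))) Fk_half in e2.
have [h3 e3] := swap (odd N).
have [h4 e4] := swap (odd N (+) ~~ odd N.*2.-1).
exists (h2^-1 * h4^-1 * h3 * h1).
rewrite [odd N (+) ~~ ~~ _]addbN in e2.
rewrite /Row big_add1 e1 e3 /Pr e2 e4 -!conjgM !mulgA.
by rewrite mulgK mulgV mul1g.
Qed.

Lemma card_fixed_Row_Pr k :
  #|[set p : PPt | (Row N m ^+ k) p == p]| = #|[set p : PPt | (Pr N m ^+ k) p == p]|.
Proof.
have [h ->] := Row_conj_Pr; rewrite -conjXg.
rewrite -[RHS](card_imset _ (@perm_inj _ h)); apply: eq_card => p.
apply/idP/imsetP => [|[x]].
  rewrite inE => /eqP e; exists (h^-1 p); last by rewrite permKV.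
  by rewrite inE -{2}e conjgE !permM permK.
rewrite !inE => /eqP e ->; by rewrite conjgE !permM permK e.
Qed.
End Conjugacy.

(** * The Robinson-Schensted-Knuth correspondence by toggles *)

Section DiagonalSums.
Local Open Scope ring_scope.
Variable g : nat -> nat -> int.
Hypothesis g0l : forall b, g 0%N b = 0.
Hypothesis g0r : forall a, g a 0%N = 0.
Hypothesis g_ge0 : forall a b, 0 <= g a b.

Lemma diag_sum0 h b : diag_sum h 0 b = 0. Proof. by rewrite /diag_sum big_ord0. Qed.

Lemma diag_sumS h a b : diag_sum h a.+1 b = h a.+1 b + diag_sum h a b.-1.
Proof.
rewrite /diag_sum big_ord_recl !subn0; congr (_ + _); apply: eq_bigr => s _.
by rewrite /= /bump /= add1n subSS -subn1 -subnDA add1n.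
Qed.

Lemma diag_sum_r0 h a : (forall x, h x 0%N = 0) -> diag_sum h a 0 = 0.
Proof. by move=> h0; rewrite /diag_sum big1 // => s _; rewrite sub0n h0. Qed.

Lemma diag_sumE a b : diag_sum g a b = g a b + diag_sum g a.-1 b.-1.
Proof. by case: a => [|a]; rewrite ?diag_sumS // !diag_sum0 g0l addr0. Qed.

(** The maximum of one toggle and the minimum of the next one along the diagonal are
taken over the same two entries, so their sum is the sum of these entries. *)
Lemma diag_sum_toggle (g' : nat -> nat -> int) a b :
  (forall x, g' x 0%N = 0) ->
  (forall s, (s < a)%N -> (s < b)%N -> let x := (a - s)%N in let y := (b - s)%N in
     g' x y = Num.max (g x.-1 y) (g x y.-1) + Num.min (g x.+1 y) (g x y.+1) - g x y) ->
  diag_sum g' a b + diag_sum g a b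
  = Num.min (g a.+1 b) (g a b.+1) + diag_sum g a.-1 b + diag_sum g a b.-1.
Proof.
move=> g'0; elim: a b => [|a IH] [|b] h.
- by rewrite !diag_sum0 !g0l g0r minxx.
- by rewrite !diag_sum0 !g0l min_r // !addr0.
- by rewrite !diag_sum_r0 // g0r min_l // !addr0.
rewrite !diag_sumS /= addrACA IH => [|s sa sb]; last first.
  by have := h s.+1; rewrite !subSS; apply.
have /= -> := h 0%N isT isT; rewrite !subn0 subrK.
rewrite [diag_sum g a b.+1]diag_sumE /=; lia.
Qed.
End DiagonalSums.

Section RSK.
Local Open Scope ring_scope.
Variables (N m : nat).
Local Notation PPt := (PP N m).

(** The weight that a last passage percolation model with passage times m - f has at the
cell (a, b). *)
Definition excess (f : filling N m) a b : int :=
  coentry f a b - Num.max (coentry f a.-1 b) (coentry f a b.-1).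

Definition rect_sum (f : filling N m) a b : int :=
  \sum_(x < a) \sum_(y < b) excess f x.+1 y.+1.

Lemma coentry0l f b : @coentry N m f 0 b = 0. Proof. by rewrite /coentry entry0l subrr. Qed.
Lemma coentry0r f a : @coentry N m f a 0 = 0. Proof. by rewrite /coentry entry0r subrr. Qed.
Lemma coentry_ge0 f a b : 0 <= @coentry N m f a b.
Proof. by rewrite subr_ge0 lez_nat entry_le. Qed.

Lemma rect_sum0l f b : rect_sum f 0 b = 0. Proof. by rewrite /rect_sum big_ord0. Qed.
Lemma rect_sum0r f a : rect_sum f a 0 = 0.
Proof. by rewrite /rect_sum big1 // => x _; rewrite big_ord0. Qed.

Lemma rect_sum_row f a b : rect_sum f a.+1 b = rect_sum f a b + \sum_(y < b) excess f a.+1 y.+1.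
Proof. by rewrite /rect_sum big_ord_recr. Qed.

Lemma rect_sum_col f a b : rect_sum f a b.+1 = rect_sum f a b + \sum_(x < a) excess f x.+1 b.+1.
Proof. by rewrite /rect_sum -big_split; apply: eq_bigr => x _; rewrite big_ord_recr. Qed.

(** The toggles along all diagonals that end at a cell (a, b) with a + b = L + 1, at the
cells strictly before that end. *)
Definition sweep L : {perm PPt} :=
  (\prod_(c | (crow c + ccol c < L)%N && odd (crow c + ccol c + L)) toggle_perm m c)%g.

Lemma toggles_on_sweep L : toggles_on (sweep L) (fun c => (crow c + ccol c < L)%N && odd (crow c + ccol c + L)).
Proof.
apply: toggles_on_class => c d cd /andP[_ h1] /andP[_ h2]; apply: parity_far => //; lia.
Qed.

Lemma coentry_sweep_fix L (p : PPt) a b : (a + b < L)%N && odd (a + b + L) = false ->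
  coentry (val (sweep L p)) a b = coentry (val p) a b.
Proof.
move=> h; congr (_ - Posz _); apply: eq_entry => c e1 e2.
by rewrite toggles_on_sweep e1 e2 h.
Qed.

Lemma coentry_sweep L (p : PPt) a b : (L <= N.+1)%N -> (0 < a)%N -> (0 < b)%N ->
  (a + b < L)%N -> odd (a + b + L) ->
  coentry (val (sweep L p)) a b
  = Num.max (coentry (val p) a.-1 b) (coentry (val p) a b.-1)
    + Num.min (coentry (val p) a.+1 b) (coentry (val p) a b.+1) - coentry (val p) a b.
Proof.
move=> LN a0 b0 abL oL.
have [c [ca cb]] := cell_exists a0 b0 (leq_trans (ltnW abL) LN).
rewrite /coentry -{1}ca -{1}cb entry_cell toggles_on_sweep ca cb abL oL /=.
rewrite toggle_fillingE ?(valP p) // /upper /lower ca cb -entry_cell ca cb.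
have /andP[] := pp_bounds c (valP p); rewrite /upper /lower ca cb -entry_cell ca cb.
set e := entry (val p) a b; set e1 := entry _ a.-1 b; set e2 := entry _ a b.-1.
set e3 := entry _ a.+1 b; set e4 := entry _ a b.+1.
clearbody e e1 e2 e3 e4; clear; lia.
Qed.

Fixpoint rsk L : {perm PPt} := if L is L'.+1 then (rsk L' * sweep L')%g else 1%g.

Lemma rskS L p : rsk L.+1 p = sweep L (rsk L p). Proof. by rewrite /= permM. Qed.

Lemma coentry_rsk_fix L (p : PPt) a b : (L <= (a + b).+1)%N ->
  coentry (val (rsk L p)) a b = coentry (val p) a b.
Proof.
elim: L => [|L IH] h; first by rewrite perm1.
by rewrite rskS coentry_sweep_fix ?IH //; lia.
Qed.

(** After the sweeps up to L, the diagonal sum that ends at (a, b) is the sum of the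
excesses over the rectangle with corner (a, b), whenever a + b is L or L - 1: both
satisfy the same inclusion-exclusion recursion. Cells further out are still untouched,
which makes the excess at (a, b) available. *)
Lemma rsk_diag_sum L (p : PPt) a b : (L <= N.+1)%N ->
  (a + b = L)%N \/ (a + b).+1 = L ->
  diag_sum (coentry (val (rsk L p))) a b = rect_sum (val p) a b.
Proof.
elim: L a b => [|L IH] a b LN.
  case=> // /eqP; rewrite addn_eq0 => /andP[/eqP-> /eqP->].
  by rewrite diag_sum0 rect_sum0l.
move=> h; rewrite rskS; set p' := rsk L p.
have [E|ne] := eqVneq (a + b)%N L.
  rewrite -IH; [|exact: ltnW|by left].
  apply: eq_bigr => s _; have [s0|s0] := posnP (b - s)%N.
    by rewrite s0 !coentry0r.
  by rewrite coentry_sweep_fix //; have := ltn_ord s; lia.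
have {h ne} abL : (a + b = L.+1)%N by lia.
case: a b abL => [|a] [|b] abL.
- by rewrite diag_sum0 rect_sum0l.
- by rewrite diag_sum0 rect_sum0l.
- by rewrite diag_sum_r0 ?rect_sum0r // => x; rewrite coentry0r.
have eL : (a + b).+1 = L by lia.
rewrite diag_sumS [b.+1.-1]/= coentry_sweep_fix; last by lia.
have tel : diag_sum (coentry (val (sweep L p'))) a b + diag_sum (coentry (val p')) a b
    = Num.min (coentry (val p') a.+1 b) (coentry (val p') a b.+1)
      + diag_sum (coentry (val p')) a.-1 b + diag_sum (coentry (val p')) a b.-1.
  apply: diag_sum_toggle => [c|c|c d|c|s sa sb x y].
  - exact: coentry0l.
  - exact: coentry0r.
  - exact: coentry_ge0.
  - exact: coentry0r.
  by rewrite coentry_sweep //; rewrite /x /y; lia.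
have I1 := IH a b.+1 (ltnW LN) ltac:(lia).
have I2 := IH a.+1 b (ltnW LN) ltac:(lia).
have I3 := IH a b (ltnW LN) ltac:(lia).
have e1 : excess (val p) a.+1 b.+1 = coentry (val p') a.+1 b.+1
      - Num.max (coentry (val p') a b.+1) (coentry (val p') a.+1 b).
  by rewrite /excess !coentry_rsk_fix //=; lia.
have e2 : rect_sum (val p) a.+1 b.+1 = excess (val p) a.+1 b.+1
    + rect_sum (val p) a b.+1 + rect_sum (val p) a.+1 b - rect_sum (val p) a b.
  by rewrite !rect_sum_row [rect_sum _ a b.+1]rect_sum_col big_ord_recr /=; ring.
rewrite -/p' in I1 I2 I3; rewrite e2 e1 -I1 -I2 -I3.
have d1 : diag_sum (coentry (val p')) a b.+1 = coentry (val p') a b.+1 + diag_sum (coentry (val p')) a.-1 b.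
  by apply: diag_sumE => c; apply: coentry0l.
rewrite d1 diag_sumS; move: tel.
set A := diag_sum (coentry (val (sweep L p'))) a b; set B := diag_sum (coentry (val p')) a b.
set C := coentry (val p') a.+1 b; set D := coentry (val p') a b.+1.
set E := diag_sum (coentry (val p')) a.-1 b; set F := diag_sum (coentry (val p')) a b.-1.
set G := coentry (val p') a.+1 b.+1.
by clearbody A B C D E F G; clear; lia.
Qed.

(** The excess in the coordinates of a symmetric matrix: the cell in row a and column b
is the entry (a - 1, N - b), on or above the diagonal. *)
Definition excess_tri (f : filling N m) r j : nat :=
  (minn (entry f r.+1 (N - j).-1) (entry f r (N - j)) - entry f r.+1 (N - j))%N.

(** The degree of the product of the x_(r, j)^e_(r, j) when x_(r, j) has degree (r + 1)
+ (j + 1). *)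
Definition pp_weight (f : filling N m) : nat :=
  (\sum_(r < N) \sum_(j < N | (r <= j)%N) (r + j + 2) * excess_tri f r j)%N.

Lemma excess_triE f r j : is_pp f -> (j < N)%N -> (excess_tri f r j)%:Z = excess f r.+1 (N - j)%N.
Proof.
move=> hf jN; have P := is_ppP hf; rewrite /excess_tri /excess /coentry /=.
have h1 : (entry f r.+1 (N - j) <= entry f r (N - j))%N by have [] := P r (N - j)%N; [lia | ].
have h2 : (entry f r.+1 (N - j) <= entry f r.+1 (N - j).-1)%N.
  by have [_] := P r.+1 (N - j).-1 isT; rewrite prednK //; lia.
lia.
Qed.

Lemma pp_weight_rect_sum f : is_pp f ->
  (pp_weight f)%:Z = \sum_(1 <= j < N.+1) j%:Z * (rect_sum f j (N.+1 - j)%N *+ 2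
        - rect_sum f j (N - j)%N - rect_sum f j.-1 (N.+1 - j)%N).
Proof.
move=> hf.
transitivity (\sum_(r < N) \sum_(j < N | (r <= j)%N) (r.+1%:Z * excess f r.+1 (N - j)%N)
   + \sum_(r < N) \sum_(j < N | (r <= j)%N) (j.+1%:Z * excess f r.+1 (N - j)%N)).
  rewrite /pp_weight -big_split -natz natr_sum; apply: eq_bigr => r _.
  rewrite -big_split natr_sum; apply: eq_bigr => j rj.
  rewrite /= -mulrDl natrM !natz excess_triE //; congr (_ * _); lia.
rewrite [X in _ + X](exchange_big_dep predT) //= big_add1 big_mkord -big_split /=.
apply: eq_bigr => r _; rewrite -!mulr_sumr -mulrDr; congr (_ * _).
have rN := ltn_ord r.
rewrite subSS.
have e1 : \sum_(j < N | (r <= j)%N) excess f r.+1 (N - j)%N = \sum_(y < N - r) excess f r.+1 y.+1.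
  rewrite -(big_mkord (fun j => r <= j)%N (fun j => excess f r.+1 (N - j)%N)).
  rewrite big_nat_rev /= add0n -(big_mkord predT (fun y => excess f r.+1 y.+1)) /=.
  rewrite (big_cat_nat (n := (N - r)%N)) //=; last by lia.
  rewrite [X in _ + X]big_nat_cond [X in _ + X]big1 ?addr0; last by move=> j; lia.
  rewrite big_nat_cond [RHS]big_nat_cond; apply: eq_big => [j|j h]; first by lia.
  congr excess; lia.
have e2 : \sum_(i < N | (i <= r)%N) excess f i.+1 (N - r)%N = \sum_(x < r.+1) excess f x.+1 (N - r)%N.
  rewrite -(big_mkord (fun i => i <= r)%N (fun i => excess f i.+1 (N - r)%N)).
  rewrite -(big_mkord predT (fun y => excess f y.+1 (N - r)%N)) /=.
  rewrite (big_cat_nat (n := r.+1)) //=.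
  rewrite [X in _ + X]big_nat_cond [X in _ + X]big1 ?addr0; last by move=> j; lia.
  rewrite big_nat_cond [RHS]big_nat_cond; apply: eq_bigl => j; lia.
have -> : (N - r = (N - r.+1).+1)%N by lia.
have -> : (N - r.+1).+1 = (N - r)%N by lia.
rewrite e1 e2 rect_sum_row.
have := rect_sum_col f r.+1 (N - r.+1); rewrite (_ : (N - r.+1).+1 = (N - r)%N); last by lia.
have := rect_sum_row f r (N - r).
lia.
Qed.

Lemma pp_weight_king_weight (p : PPt) : (pp_weight (val p))%:Z = king_weight (val (rsk N.+1 p)).
Proof.
rewrite pp_weight_rect_sum ?(valP p) // /king_weight; apply: eq_big_nat => j /andP[j0 jN].
by rewrite !rsk_diag_sum //; lia.
Qed.

(** The correspondence is a permutation of the plane partitions that carries one weight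
to the other. *)
Lemma sum_pp_weight (K : fieldType) (q : K) :
  \sum_(p : PPt) q ^+ pp_weight (val p) = \sum_(p : PPt) q ^ king_weight (val p).
Proof.
rewrite [RHS](reindex_inj (@perm_inj _ (rsk N.+1))) /=; apply: eq_bigr => p _.
by rewrite -pp_weight_king_weight.
Qed.
End RSK.

(** * Leading monomials *)

Section Layers.
Variables (N m : nat).

(** The cells at which f first falls to t or below form an antichain. In the coordinates
of a symmetric matrix this is a partial increasing function from rows to columns. *)
Definition layer (f : filling N m) t (r : 'I_N) : option 'I_N :=
  [pick j : 'I_N | (r <= j) &&
     (entry f r.+1 (N - j) <= t < minn (entry f r.+1 (N - j).-1) (entry f r (N - j)))].

Variable f : filling N m.
Hypothesis fpp : is_pp f.

Lemma entry_mono a a' b b' : (0 < a) || (0 < b) -> a <= a' -> b <= b' -> entry f a' b' <= entry f a b.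
Proof.
move=> ab /subnKC <- /subnKC <-; have P := is_ppP fpp.
elim: (a' - a) => [|i IH].
  rewrite addn0; elim: (b' - b) => [|j IH]; first by rewrite addn0.
  by rewrite addnS; have [_] := P a (b + j) ltac:(lia); move=> h; apply: leq_trans h IH.
by rewrite addnS; have [h _] := P (a + i) (b + (b' - b)) ltac:(lia); apply: leq_trans h IH.
Qed.

Lemma layerP t r j : reflect (layer f t r = Some j)
  ((r <= j) && (entry f r.+1 (N - j) <= t < minn (entry f r.+1 (N - j).-1) (entry f r (N - j)))).
Proof.
apply: (iffP idP) => [h|]; last by rewrite /layer; case: pickP => // j' h [<-].
rewrite /layer; case: pickP => [j' h'|/(_ j)]; last by rewrite h.
congr Some; apply/val_inj => /=; have jN := ltn_ord j; have jN' := ltn_ord j'.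
move: h h'; rewrite !leq_min => /and3P[rj h1 /andP[h2 h3]] /and3P[rj' h1' /andP[h2' h3']].
apply/eqP; rewrite eqn_leq; apply/andP; split; rewrite leqNgt; apply/negP => lt.
  have E := @entry_mono r.+1 r.+1 (N - j') (N - j).-1 isT (leqnn _) ltac:(lia).
  by have := leq_trans (leq_trans h2 E) h1'; rewrite ltnn.
have E := @entry_mono r.+1 r.+1 (N - j) (N - j').-1 isT (leqnn _) ltac:(lia).
by have := leq_trans (leq_trans h2' E) h1; rewrite ltnn.
Qed.

Lemma layer_mono t r r' j j' : layer f t r = Some j -> layer f t r' = Some j' ->
  r < r' -> j < j'.
Proof.
move=> /layerP; rewrite leq_min => /and3P[h0 h1 /andP[h2 h3]].
move=> /layerP; rewrite leq_min => /and3P[h0' h1' /andP[h2' h3']] rr.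
have jN := ltn_ord j; have jN' := ltn_ord j'.
rewrite ltnNge; apply/negP => lt.
have E := @entry_mono r.+1 r' (N - j) (N - j') isT rr ltac:(lia).
by have := leq_trans (leq_trans h3' E) h1; rewrite ltnn.
Qed.

Lemma card_interval a b : b <= m -> \sum_(t < m | a <= t < b) 1 = b - a.
Proof.
move=> bm; rewrite -(big_mkord (fun t => a <= t < b) (fun=> 1)).
have [ab|ba] := leqP a b; last first.
  rewrite big_nat_cond big1; [lia | move=> t; lia].
rewrite (big_cat_nat (n := b)) //= [X in _ + X]big_nat_cond [X in _ + X]big1 ?addn0; last by move=> t; lia.
rewrite (big_cat_nat (n := a)) //= [X in X + _]big_nat_cond [X in X + _]big1 ?add0n; last by move=> t; lia.
rewrite big_nat_cond (eq_bigl (fun i => (a <= i < b) && true)) -?big_nat_cond.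
  by rewrite sum_nat_const_nat muln1.
by move=> t /=; lia.
Qed.

(** The cell (r, j) belongs to the layers t with f <= t < (smaller neighbour towards the
corner), as many as the excess there. *)
Lemma sum_layers (F : nat -> nat -> nat) :
  \sum_(t < m) \sum_(r < N) (if layer f t r is Some j then F r j else 0)
  = \sum_(r < N) \sum_(j < N | r <= j) F r j * excess_tri f r j.
Proof.
rewrite exchange_big /=; apply: eq_bigr => r _.
transitivity (\sum_(t < m) \sum_(j < N | (r <= j) &&
    (entry f r.+1 (N - j) <= t < minn (entry f r.+1 (N - j).-1) (entry f r (N - j)))) F r j).
  apply: eq_bigr => t _; case E: (layer f t r) => [j|].
    by rewrite (big_pred1 j) // => j'; apply/layerP/eqP => [|->//]; rewrite E => -[].
  by rewrite big1 // => j /layerP; rewrite E.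
rewrite (exchange_big_dep (fun j : 'I_N => r <= j)) /= => [|t j _ /andP[]//].
apply: eq_bigr => j rj; rewrite (eq_bigr (fun=> F r j * 1)); last by move=> *; rewrite muln1.
rewrite -big_distrr /=; congr (_ * _); rewrite /excess_tri -[RHS]card_interval; last by rewrite geq_min entry_le.
by apply: eq_bigl => t; rewrite rj.
Qed.

End Layers.

Section Digits.

Lemma digits_inj B K (d d' : nat -> nat) : (forall k, d k < B) -> (forall k, d' k < B) ->
  \sum_(k < K) d k * B ^ k = \sum_(k < K) d' k * B ^ k -> forall k, k < K -> d k = d' k.
Proof.
elim: K d d' => [//|K IH] d d' hd hd'; rewrite !big_ord_recl !expn0 !muln1.
have e (c : nat -> nat) : \sum_(i < K) c (lift ord0 i) * B ^ lift ord0 i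
    = (\sum_(i < K) c i.+1 * B ^ i) * B.
  by rewrite big_distrl /=; apply: eq_bigr => i _; rewrite /bump /= add1n expnSr mulnA.
rewrite !e => E; have B0 : 0 < B by apply: leq_ltn_trans (hd 0).
have e0 : d 0 = d' 0.
  have := congr1 (fun x => x %% B) E; rewrite /= ![d _ + _]addnC ![d' _ + _]addnC !modnMDl.
  by rewrite !modn_small.
move: E; rewrite e0 => /eqP; rewrite eqn_add2l eqn_pmul2r // => /eqP E.
case=> [//|k] /= kK; apply: (IH (fun k => d k.+1) (fun k => d' k.+1)) => //.
Qed.

(** The entries are recovered from the corner outwards. *)
Lemma excess_tri_inj N m (f f' : filling N m) :
  is_pp f -> is_pp f' -> (forall r j, r <= j < N -> excess_tri f r j = excess_tri f' r j) -> f = f'.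
Proof.
move=> hf hf' h.
have E s : forall a b, a + b <= s -> 0 < a -> 0 < b -> a + b <= N.+1 -> entry f a b = entry f' a b.
  elim: s => [|s IH] a b ab a0 b0 abN; first by lia.
  have IH' x y : x + y <= s -> x + y <= N.+1 -> entry f x y = entry f' x y.
    case: x y => [|x] [|y] h1 h2; rewrite ?entry0l ?entry0r //; exact: IH.
  have := h a.-1 (N - b) ltac:(lia); rewrite /excess_tri prednK //.
  have -> : N - (N - b) = b by lia.
  have M1 := entry_mono hf (a := a) (a' := a) (b := b.-1) (b' := b) ltac:(lia) (leqnn _) (leq_pred _).
  have M2 := entry_mono hf (a := a.-1) (a' := a) (b := b) (b' := b) ltac:(lia) (leq_pred _) (leqnn _).
  have M3 := entry_mono hf' (a := a) (a' := a) (b := b.-1) (b' := b) ltac:(lia) (leqnn _) (leq_pred _).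
  have M4 := entry_mono hf' (a := a.-1) (a' := a) (b := b) (b' := b) ltac:(lia) (leq_pred _) (leqnn _).
  have e1 := IH' a b.-1 ltac:(lia) ltac:(lia).
  have e2 := IH' a.-1 b ltac:(lia) ltac:(lia).
  rewrite e1 e2 => E; rewrite e1 in M1; rewrite e2 in M2.
  have L1 : entry f a b <= minn (entry f' a b.-1) (entry f' a.-1 b) by rewrite leq_min M1.
  have L2 : entry f' a b <= minn (entry f' a b.-1) (entry f' a.-1 b) by rewrite leq_min M3.
  by rewrite -(subKn L1) E subKn.
apply/ffunP => c; apply/val_inj; rewrite /= -!entry_cell.
by apply: (E _ _ _ (leqnn _)); rewrite ?crow_gt0 ?ccol_gt0 ?cell_leN.
Qed.

End Digits.

Section LeadingTerm.
Variables (N m : nat).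

Definition weight_base := (N + m).+2.
(** A linear order on the entries: by i + j first. The second term separates entries
with the same i + j. *)
Definition weight_index i j := (i + j) * N.+1 + minn i j.
(** The exponents of a one-variable substitution that separates monomials as a term
order would: powers of a base exceeding both the exponents that occur and the number of
factors of a minor. *)
Definition entry_weight i j := weight_base ^ weight_index i j.

Lemma entry_weightC i j : entry_weight i j = entry_weight j i.
Proof. by rewrite /entry_weight /weight_index [i + j]addnC minnC. Qed.

Lemma weight_index_lt i j i' j' : i < N -> j < N -> i' < N -> j' < N -> i + j < i' + j' -> weight_index i j < weight_index i' j'.
Proof.
move=> iN jN iN' jN' h; rewrite /weight_index.
have h1 : (i + j).+1 * N.+1 <= (i' + j') * N.+1 by rewrite leq_mul2r h orbT.
by rewrite mulSn in h1; have := geq_minl i j; lia.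
Qed.

Lemma weight_index_inj i j i' j' : i <= j < N -> i' <= j' < N -> weight_index i j = weight_index i' j' -> i = i' /\ j = j'.
Proof.
move=> h h' e; have [s|s|s] := ltngtP (i + j) (i' + j').
- by have := weight_index_lt _ _ _ _ s; rewrite e; lia.
- by have := weight_index_lt _ _ _ _ s; rewrite e; lia.
by move: e; rewrite /weight_index s; lia.
Qed.

Definition total_weight (f : filling N m) := \sum_(r < N) \sum_(j < N | r <= j) entry_weight r j * excess_tri f r j.

Lemma total_weight_inj (f f' : filling N m) : is_pp f -> is_pp f' ->
  total_weight f = total_weight f' -> f = f'.
Proof.
move=> hf hf'.
(* the digits of the total weight to the base weight_base *)
pose dig (f : filling N m) k := \sum_(r < N) \sum_(j < N | (r <= j) && (weight_index r j == k)) excess_tri f r j.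
pose K := weight_index N N.
have eeB (g : filling N m) r j : excess_tri g r j < weight_base.
  by rewrite /excess_tri /weight_base; have := entry_le g r.+1 (N - j).-1; lia.
have one (g : filling N m) (r j : 'I_N) : r <= j -> dig g (weight_index r j) = excess_tri g r j.
  move=> rj; rewrite /dig (bigD1 r) //= [X in _ + X]big1 => [|r' nr]; last first.
    apply: big1 => j' /andP[rj' /eqP e]; case/eqP: nr; apply/val_inj => /=.
    by case: (weight_index_inj _ _ e) => //; rewrite ?rj ?rj' ltn_ord.
  rewrite addn0 (big_pred1 j) // => j'; apply/andP/eqP => [[rj' /eqP e]|->]; last by rewrite rj eqxx.
  by apply/val_inj; case: (weight_index_inj _ _ e) => //; rewrite ?rj ?rj' ltn_ord.
have digB (g : filling N m) k : dig g k < weight_base.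
  have [/existsP[r /existsP[j /andP[rj /eqP <-]]]|no] :=
    boolP [exists r : 'I_N, exists j : 'I_N, (r <= j) && (weight_index r j == k)]; first by rewrite one.
  rewrite /dig big1 // => r _; apply: big1 => j rj.
  by case/negP: no; apply/existsP; exists r; apply/existsP; exists j.
have tot (g : filling N m) : total_weight g = \sum_(k < K) dig g k * weight_base ^ k.
  rewrite /dig; under [RHS]eq_bigr => k _ do rewrite big_distrl /=.
  rewrite exchange_big /=; apply: eq_bigr => r _.
  under [RHS]eq_bigr => k _ do rewrite big_distrl /=.
  rewrite (exchange_big_dep (fun j : 'I_N => r <= j)) /= => [|k j _ /andP[]//].
  apply: eq_bigr => j rj.
  have kK : weight_index r j < K.
    rewrite /K /weight_index; have := ltn_ord r; have := ltn_ord j => h1 h2.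
    have : (r + j) * N.+1 <= (N + N) * N.+1 by rewrite leq_mul2r; lia.
    by rewrite minnn; lia.
  rewrite (big_pred1 (Ordinal kK)) => [|k].
    by rewrite /entry_weight mulnC.
  by rewrite rj /= eq_sym -val_eqE.
rewrite !tot => /(digits_inj (digB f) (digB f')) h.
apply: excess_tri_inj => // r j /andP[rj jN]; have rN : r < N by lia.
have := h (weight_index r j); rewrite (one f (Ordinal rN) (Ordinal jN)) // (one f' (Ordinal rN) (Ordinal jN)) //.
apply; rewrite /K /weight_index.
have : (r + j) * N.+1 <= (N + N) * N.+1 by rewrite leq_mul2r; lia.
by rewrite minnn; lia.
Qed.

(** Consider the largest row i moved by u. The entry at (i, g i) is larger in the linear
order than all entries that u uses up to row i, and its weight exceeds the sum of
theirs. *)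
Lemma entry_weight_perm (g : 'I_N -> option 'I_N) (u : {perm 'I_N}) :
  (forall r r' j j', g r = Some j -> g r' = Some j' -> r < r' -> j < j') ->
  (forall s, g s = None -> u s = s) -> u != 1%g ->
  \sum_s (if g s is Some j then entry_weight (u s) j else 0)
  < \sum_s (if g s is Some j then entry_weight s j else 0).
Proof.
move=> gmono ufix u1.
have [i0 hi0] : exists i, u i != i.
  apply/existsP; apply: contraNT u1; rewrite negb_exists => /forallP h.
  by apply/eqP/permP => i; rewrite perm1; have := h i; rewrite negbK => /eqP.
have [i ui imax] : exists2 i, u i != i & forall s, u s != s -> s <= i.
  by case: (arg_maxnP (P := fun i => u i != i) (fun i : 'I_N => i : nat) hi0) => i h1 h2; exists i.
have fixup (s : 'I_N) : i < s -> u s = s.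
  by move=> lt; apply/eqP; apply: contraTT lt => /imax; rewrite -leqNgt.
have ule (s : 'I_N) : s <= i -> u s <= i.
  move=> si; rewrite leqNgt; apply/negP => lt; have := fixup _ lt => /perm_inj e.
  by move: lt; rewrite e; lia.
have [j gi] : exists j, g i = Some j.
  by case E: (g i) => [j|]; [exists j | case/eqP: ui; apply: ufix].
rewrite (bigID (fun s : 'I_N => s <= i)) [X in _ < X](bigID (fun s : 'I_N => s <= i)) /=.
have -> : \sum_(s : 'I_N | ~~ (s <= i)) (if g s is Some j then entry_weight (u s) j else 0)
    = \sum_(s : 'I_N | ~~ (s <= i)) (if g s is Some j then entry_weight s j else 0).
  by apply: eq_bigr => s; rewrite -ltnNge => /fixup->.
rewrite ltn_add2r [X in _ < X](bigD1 i) //= gi.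
apply: leq_trans (leq_addr _ _).
have ii : u i < i by have := ule i (leqnn _); rewrite leq_eqVlt => /orP[/eqP e|//]; case/eqP: ui; apply/val_inj.
have M0 : 0 < weight_index i j by apply: leq_ltn_trans (leq0n _) (weight_index_lt (i := u i) (j := j) _ _ _ _ _); rewrite ?ltn_add2r.
apply: (@leq_ltn_trans (\sum_(s : 'I_N | s <= i) weight_base ^ (weight_index i j).-1)).
  apply: leq_sum => s si; case gs: (g s) => [j'|//].
  rewrite /entry_weight leq_exp2l // -ltnS prednK //; apply: weight_index_lt; rewrite ?ltn_ord //.
  move: si; rewrite leq_eqVlt => /orP[/eqP/val_inj e|lt].
    by move: gs; rewrite e gi => -[<-]; rewrite ltn_add2r.
  by have := gmono _ _ _ _ gs gi lt; have := ule _ (ltnW lt); lia.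
rewrite sum_nat_const /entry_weight -[X in _ < _ ^ X](prednK M0) expnS ltn_mul2r expn_gt0 /=.
by rewrite /weight_base; apply: leq_ltn_trans (max_card _) _; rewrite card_ord; lia.
Qed.

Local Open Scope ring_scope.
Variable C : fieldType.
Variable d : 'I_N -> C.
Hypothesis d0 : forall j, d j != 0.

(** The columns of the identity matrix, except that the columns in the domain of g are
replaced by columns of a symmetric matrix of powers of the variable (up to scalars). Its
determinant is a minor of that symmetric matrix, with positive sign. *)
Definition layer_mx (g : 'I_N -> option 'I_N) : 'M[{poly C}]_N :=
  \matrix_(i, s) (if g s is Some j then (d j)^-1 *: 'X^(entry_weight i j) else (i == s)%:R).

(** The identity permutation contributes the leading term. *)
Lemma size_det_layer_mx (g : 'I_N -> option 'I_N) :
  (forall r r' j j', g r = Some j -> g r' = Some j' -> r < r' -> j < j')%N ->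
  size (\det (layer_mx g)) = (\sum_s (if g s is Some j then entry_weight s j else 0)).+1.
Proof.
move=> gmono.
pose cst (i s : 'I_N) : C := if g s is Some j then (d j)^-1 else (i == s)%:R.
pose ex (i s : 'I_N) : nat := if g s is Some j then entry_weight i j else 0%N.
have mxE' i s : layer_mx g i s = cst i s *: 'X^(ex i s).
  by rewrite mxE /cst /ex; case: (g s) => // ; rewrite expr0 alg_polyC; case: eqP.
have prodE (u : {perm 'I_N}) :
    \prod_s (layer_mx g)^T s (u s) = (\prod_s cst (u s) s) *: 'X^(\sum_s ex (u s) s).
  rewrite expr_sum -scaler_prod; apply: eq_bigr => s _; by rewrite mxE mxE'.
rewrite -det_tr /determinant (bigD1 1%g) //= odd_perm1 expr0 mul1r prodE.
have c0 : \prod_s cst ((1%g : {perm 'I_N}) s) s != 0.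
  apply/prodf_neq0 => s _; rewrite perm1 /cst; case: (g s) => [j|]; first by rewrite invr_eq0.
  by rewrite eqxx oner_eq0.
have e1 : (\sum_s ex ((1%g : {perm 'I_N}) s) s = \sum_s (if g s is Some j then entry_weight s j else 0))%N.
  by apply: eq_bigr => s _; rewrite perm1.
rewrite e1 size_polyDl size_scale ?size_polyXn //.
rewrite ltnS (leq_trans (size_sum _ _ _)) //; apply/bigmax_leqP => u u1.
rewrite -signr_odd mulr_sign.
suff h : (size (\prod_s (layer_mx g)^T s (u s))%R <= \sum_s (if g s is Some j then entry_weight s j else 0))%N.
  by case: ifP; rewrite ?size_polyN.
rewrite prodE.
(* a permutation moving a column of the identity contributes 0 *)
have [/forallP ufix|/forallPn[s]] := boolP [forall s, (g s == None) ==> (u s == s)].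
  apply: (leq_trans (size_scale_leq _ _)); rewrite size_polyXn.
  apply: entry_weight_perm => // s gs; apply/eqP; have := ufix s; rewrite gs eqxx /=. by [].
rewrite negb_imply => /andP[/eqP gs us].
by rewrite (bigD1 s) //= /cst gs (negPf us) mul0r scale0r size_poly0.
Qed.
End LeadingTerm.

(** * Eigenvectors of the cyclic action in the grove algebra *)

Section Eigenbasis.
Local Open Scope ring_scope.
Variables (R : realType) (n : nat).
Local Notation C := R[i].
Local Notation N := n.-1.
Hypothesis n_gt0 : (0 < n)%N.
Variable xi : C.
Hypothesis xi_prim : n.*2.-primitive_root xi.

Lemma xi_neq0 : xi != 0.
Proof.
apply/eqP => e; have := prim_expr_order xi_prim.
by rewrite e expr0n eqn0Ngt (prim_order_gt0 xi_prim) => /eqP; rewrite eq_sym oner_eq0.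
Qed.

Lemma xi_n : xi ^+ n = -1.
Proof.
have : (xi ^+ n) ^+ 2 == 1 by rewrite -exprM muln2 prim_expr_order.
rewrite sqrf_eq1 => /orP[|/eqP//].
by rewrite -(prim_order_dvd xi_prim) gtnNdvd //; lia.
Qed.

(** The sign of the square root of -1 is chosen so that the product of the eigenvalues u
xi^-j over 1 <= j <= N is 1. *)
Lemma exists_imaginary : exists iu : C, iu ^+ 2 = -1 /\
  iu ^+ N = xi ^+ (\sum_(r < N) r.+1).
Proof.
have S2 k : (\sum_(r < k) r.+1 = 'C(k.+1, 2))%N.
  by rewrite -bin2_sum big_mkord big_ord_recl add0n; apply: eq_bigr.
rewrite S2 prednK //; have [on|en] := boolP (odd n).
  have -> : 'C(n, 2) = (n * n./2)%N by rewrite bin2; lia.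
  exists 'i; rewrite sqrCi; split=> //.
  have -> : N = (2 * n./2)%N by lia.
  by rewrite !exprM sqrCi xi_n.
exists (xi ^+ n./2); split; first by rewrite -exprM (_ : (n./2 * 2 = n)%N) ?xi_n //; lia.
rewrite -exprM; congr (_ ^+ _); rewrite bin2.
have e : n = (n./2).*2 by lia.
have -> : (n * N = (n./2 * N).*2)%N by rewrite doubleMl -e.
by rewrite doubleK.
Qed.

Variable iu : C.
Hypothesis iu2 : iu ^+ 2 = -1.
Hypothesis iuN : iu ^+ N = xi ^+ (\sum_(r < N) r.+1).

Lemma iu_neq0 : iu != 0.
Proof. by apply/eqP => e; move/eqP: iu2; rewrite e expr0n /= eq_sym oppr_eq0 oner_eq0. Qed.

Lemma col_lo_subproof (r : 'I_N) : (r < N.*2)%N. Proof. by have := ltn_ord r; lia. Qed.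
Lemma col_hi_subproof (r : 'I_N) : (N + r < N.*2)%N. Proof. by have := ltn_ord r; lia. Qed.
(** Eigenvectors of c are numbered so that [col_lo r] and [col_hi r] are the ones paired
by the form. *)
Definition col_lo r := Ordinal (col_lo_subproof r).
Definition col_hi r := Ordinal (col_hi_subproof r).

Lemma sum_lo_hi (F : 'I_(N.*2) -> C) : \sum_p F p = \sum_r (F (col_lo r) + F (col_hi r)).
Proof.
rewrite big_split /= (reindex (cast_ord (addnn N))) /=; last first.
  by exists (cast_ord (esym (addnn N))) => x _; rewrite ?cast_ordK ?cast_ordKV.
rewrite big_split_ord /=; congr (_ + _); apply: eq_bigr => r _; congr F; exact/val_inj.
Qed.

(** The exponents are n + 1, ..., 2n - 1 and 1, ..., n - 1. The missing exponents 0 and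
n belong to the eigenvalues u and -u of c on the ambient space, whose squares are -1;
they are killed by the passage to V. *)
Definition eig_exp (p : 'I_(N.*2)) : nat := if (p < N)%N then (n.*2 - p.+1)%N else (p.+1 - N)%N.
Definition eig p : C := iu * xi ^+ eig_exp p.

Lemma eig_lo r : eig (col_lo r) = iu * xi ^- r.+1.
Proof.
rewrite /eig /eig_exp /= ltn_ord; congr (_ * _).
apply: (mulIf (expf_neq0 r.+1 xi_neq0)); rewrite -exprD subnK ?mulVf ?expf_neq0 ?xi_neq0 //.
  exact: prim_expr_order.
by have := ltn_ord r; lia.
Qed.

Lemma eig_hi r : eig (col_hi r) = iu * xi ^+ r.+1.
Proof. by rewrite /eig /eig_exp /= ltnNge leq_addr /= -addnS addKn. Qed.

Lemma eig_neq0 p : eig p != 0.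
Proof. by rewrite mulf_neq0 ?iu_neq0 ?expf_neq0 ?xi_neq0. Qed.

Lemma eig_exp_lt p : (0 < eig_exp p < n.*2)%N && (eig_exp p != n).
Proof. by rewrite /eig_exp; have := ltn_ord p; case: ifP; lia. Qed.

Lemma eig_mul p p' : eig p * eig p' = - xi ^+ (eig_exp p + eig_exp p').
Proof. by rewrite /eig mulrACA -expr2 iu2 mulN1r exprD. Qed.

Lemma eig_inj : injective eig.
Proof.
move=> p p' /(mulfI iu_neq0) /eqP; rewrite (eq_prim_root_expr xi_prim).
have := eig_exp_lt p; have := eig_exp_lt p' => h' h.
rewrite !modn_small; try lia.
move=> /eqP e; apply/val_inj => /=; move: e; rewrite /eig_exp.
by have := ltn_ord p; have := ltn_ord p'; case: ifP; case: ifP; lia.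
Qed.

Lemma eig_sqr p : 1 + eig p ^- 2 != 0.
Proof.
apply/eqP => /(congr1 (fun y => y * eig p ^+ 2)).
rewrite mul0r mulrDl mul1r mulVf ?expf_neq0 ?eig_neq0 // expr2 eig_mul => /eqP.
rewrite addrC subr_eq0 eq_sym -(prim_order_dvd xi_prim) addnn -!muln2 dvdn_pmul2r //.
have /andP[h1 h2] := eig_exp_lt p; move=> /dvdnP[k e].
case: k e => [|[|k]] e; lia.
Qed.

Lemma eig_partner p p' : eig p * eig p' = -1 ->
  (forall r, p = col_lo r -> p' = col_hi r) /\ (forall r, p = col_hi r -> p' = col_lo r).
Proof.
move=> e; have inj q : eig q * eig p = -1 -> p' = q.
  by move=> e'; apply/eig_inj/(mulfI (eig_neq0 p)); rewrite e mulrC.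
have n0 r : xi ^+ r.+1 != 0 by rewrite expf_neq0 ?xi_neq0.
split=> r pr; apply: inj; rewrite pr eig_lo eig_hi mulrACA -expr2 iu2.
  by rewrite mulfV ?mulr1.
by rewrite mulVf ?mulr1.
Qed.

(** The columns are eigenvectors of c acting on column vectors. *)
Definition eigvec_mx : 'M[C]_(n.*2, N.*2) := \matrix_(i, p) eig p ^- i.
Definition eigval_mx : 'M[C]_(N.*2) := diag_mx (\row_p eig p).

Lemma eig_order p : eig p ^+ n.*2 = (-1) ^+ n.
Proof.
rewrite /eig exprMn -exprM mulnC exprM (prim_expr_order xi_prim) expr1n mulr1.
by rewrite -muln2 mulnC exprM iu2.
Qed.

Lemma cmx_eigvec_mx : cmx R n *m eigvec_mx = eigvec_mx *m eigval_mx.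
Proof.
apply/matrixP => i p; rewrite mul_mx_diag !mxE.
have i2 := ltn_ord i.
have [i0|i0] := posnP i.
  have h : (n.*2.-1 < n.*2)%N by lia.
  rewrite (bigD1 (Ordinal h)) //= big1 ?addr0 => [|j nj]; rewrite !mxE i0 /=.
    rewrite prednK ?eqxx /=; last by lia.
    rewrite expr0 invr1 mul1r -(eig_order p) -{1}(prednK (ltn_trans _ h : 0 < n.*2)%N); last by lia.
    by rewrite exprS mulfK ?expf_neq0 ?eig_neq0.
  rewrite (_ : (j.+1 == n.*2) = false) ?mul0r //.
  by apply: contraNF nj => /eqP e; apply/eqP/val_inj => /=; rewrite -[LHS]/(j.+1.-1) e.
have h : (i.-1 < n.*2)%N by lia.
rewrite (bigD1 (Ordinal h)) //= big1 ?addr0 => [|j nj]; rewrite !mxE /=.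
  by rewrite prednK // eqxx mul1r -{2}(prednK i0) exprSr invfM mulfVK ?eig_neq0.
rewrite (_ : (i == j.+1 :> nat) = false); last first.
  by apply: contraNF nj => /eqP e; apply/eqP/val_inj; rewrite /= e.
by rewrite eqn0Ngt i0 /= mul0r.
Qed.

Definition basis_mx : 'M[C]_(N.*2) := wmx R n *m eigvec_mx.

(** Restricted to V the eigenvectors form a Vandermonde matrix, up to a factor 1 + x^-2
for the eigenvalue x. *)
Lemma basis_mxE i p : basis_mx i p = eig p ^- i * (1 + eig p ^- 2).
Proof.
have i2 := ltn_ord i; have e2 : (i.+2 < n.*2)%N by lia.
have e0 : (i < n.*2)%N by lia.
rewrite mxE (bigD1 (Ordinal e0)) //= (bigD1 (Ordinal e2)) /=; last by apply/eqP => /(congr1 val) /=; lia.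
rewrite big1 ?addr0 => [|j /andP[j1 j2]]; rewrite !mxE /= ?eqxx ?orbT ?mul1r.
  by rewrite mulrDr mulr1 -invfM -exprD addn2.
rewrite (_ : (j == i :> nat) = false); last by apply: contraNF j1 => /eqP e; apply/eqP/val_inj.
rewrite (_ : (j == i.+2 :> nat) = false) ?mul0r //; by apply: contraNF j2 => /eqP e; apply/eqP/val_inj.
Qed.

Lemma basis_mx_unit : basis_mx \in unitmx.
Proof.
have -> : basis_mx = Vandermonde N.*2 (\row_p (eig p)^-1) *m diag_mx (\row_p (1 + eig p ^- 2)).
  by apply/matrixP => i p; rewrite mul_mx_diag basis_mxE !mxE exprVn.
rewrite unitmx_mul !unitmxE det_diag det_Vandermonde !unitfE; apply/andP; split.
  apply/prodf_neq0 => p _; apply/prodf_neq0 => p' pp; rewrite !mxE subr_eq0.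
  by rewrite (inj_eq invr_inj) (inj_eq eig_inj) -val_eqE /= gtn_eqF.
by apply/prodf_neq0 => p _; rewrite mxE eig_sqr.
Qed.

Lemma cVmx_basis_mx : cVmx R n *m basis_mx = basis_mx *m eigval_mx.
Proof. by rewrite /basis_mx mulmxA -wmx_cmx -!mulmxA cmx_eigvec_mx. Qed.

Lemma conj_form k (V A L D : 'M[C]_k) : V *m A = D *m V -> A^T *m V^T = V^T *m D ->
  D *m (V *m L *m V^T) *m D = V *m (A *m L *m A^T) *m V^T.
Proof. by move=> e1 e2; rewrite !mulmxA e1 -[RHS]mulmxA e2 !mulmxA. Qed.

Definition form_mx : 'M[C]_(N.*2) := invmx basis_mx *m Lambda R n *m (invmx basis_mx)^T.

(** c multiplies the form by -1, so two eigenvectors are orthogonal unless the product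
of their eigenvalues is -1. *)
Lemma form_mx_eig p p' : form_mx p p' * (eig p * eig p' + 1) = 0.
Proof.
have QV : basis_mx *m invmx basis_mx = 1%:M by rewrite mulmxV ?basis_mx_unit.
have VQ : invmx basis_mx *m basis_mx = 1%:M by rewrite mulVmx ?basis_mx_unit.
have DT : eigval_mx^T = eigval_mx by rewrite tr_diag_mx.
have e1 : invmx basis_mx *m cVmx R n = eigval_mx *m invmx basis_mx.
  by rewrite -[LHS]mulmx1 -QV mulmxA -[invmx basis_mx *m _ *m basis_mx]mulmxA cVmx_basis_mx mulmxA VQ mul1mx.
have e2 : (cVmx R n)^T *m (invmx basis_mx)^T = (invmx basis_mx)^T *m eigval_mx.
  by rewrite -trmx_mul e1 trmx_mul DT.
have : eigval_mx *m form_mx *m eigval_mx = - form_mx.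
  rewrite (conj_form _ e1 e2).
  by rewrite cVmx_Lambda mulmxN mulNmx.
move/matrixP/(_ p p'); rewrite mul_mx_diag mul_diag_mx !mxE => e.
by rewrite mulrDr mulr1 -[X in _ + X]opprK -e; ring.
Qed.

(** The equations for the kernel link coordinates two apart; the odd ones vanish from
the left end, the even ones from the right end. *)
Lemma Lambda_unit : Lambda R n \in unitmx.
Proof.
rewrite -row_free_unit -kermx_eq0; apply/rowV0P => v /sub_kermxP vL.
(* v extended by 0 to the right, where the equation of the last column refers to it *)
pose v' k : C := if insub k is Some k' then v 0 (k' : 'I_(N.*2)) else 0.
have v'E (k : 'I_(N.*2)) : v' k = v 0 k by rewrite /v' valK.
have v'0 k : (N.*2 <= k)%N -> v' k = 0 by move=> h; rewrite /v' insubN // -leqNgt.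
have col l : (l < N.*2)%N -> (if l is l'.+1 then v' l' else 0) = (if l is _.+1 then -1 else 1) * v' l.+1.
  move=> lN; have := congr1 (fun M : 'rV_(N.*2) => M 0 (Ordinal lN)) vL; rewrite [RHS]mxE mxE.
  have E (k : 'I_(N.*2)) : v 0 k * Lambda R n k (Ordinal lN)
      = (k.+1 == l)%:R * (v' k * (-1) ^+ k) - (k == l.+1 :> nat)%:R * (v' k * (-1) ^+ l).
    rewrite mxE v'E /= eq_sym; case: eqP => [e|_].
      by rewrite (_ : (k == l.+1 :> nat) = false) ?mul0r ?subr0 ?mul1r //; apply/eqP; lia.
    by rewrite mul0r sub0r; case: eqP => _; rewrite ?mul1r ?mulrN // !mul0r mulr0 oppr0.
  rewrite (eq_bigr _ (fun k _ => E k)) sumrB.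
  have -> : \sum_(k < N.*2) (k == l.+1 :> nat)%:R * (v' k * (-1) ^+ l) = v' l.+1 * (-1) ^+ l.
    have [h|h] := ltnP l.+1 N.*2.
      rewrite (bigD1 (Ordinal h)) //= eqxx mul1r big1 ?addr0 // => k nk.
      by rewrite (_ : (k == l.+1 :> nat) = false) ?mul0r //; apply: contraNF nk => /eqP e; apply/eqP/val_inj.
    rewrite v'0 // mul0r big1 // => k _.
    by rewrite (_ : (k == l.+1 :> nat) = false) ?mul0r //; apply/eqP; have := ltn_ord k; lia.
  case: l lN {E} => [|l] lN.
    by rewrite big1 ?sub0r ?expr0 ?mulr1 ?mul1r => [/eqP|k _]; rewrite ?oppr_eq0 ?mul0r // => /eqP->.
  rewrite (bigD1 (Ordinal (ltnW lN))) //= eqxx mul1r big1 ?addr0 => [|k nk]; last first.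
    by rewrite eqSS (_ : (k == l :> nat) = false) ?mul0r //; apply: contraNF nk => /eqP e; apply/eqP/val_inj.
  rewrite exprS mulN1r mulrN opprK -mulrDl => /eqP; rewrite mulf_eq0 signr_eq0 orbF addr_eq0 => /eqP->.
  by rewrite mulN1r.
have odd0 i : v' i.*2.+1 = 0.
  elim: i => [|i IH].
    have [h|h] := posnP N.*2; first by rewrite v'0 // h.
    by have := col 0%N h; rewrite mul1r.
  have [h|h] := ltnP i.+1.*2 N.*2; last by rewrite v'0 //; lia.
  by have := col i.+1.*2 h; rewrite doubleS IH mulN1r => /esym/eqP; rewrite oppr_eq0 => /eqP.
have even0 i : v' (N.*2 - i.*2)%N = 0.
  elim: i => [|i IH]; first by rewrite subn0 v'0.
  have [h|h] := ltnP i.+1.*2 N.*2.+1; last first.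
    by have -> : (N.*2 - i.+1.*2 = N.*2 - i.*2)%N by lia.
  have := col (N.*2 - i.+1.*2).+1%N ltac:(lia).
  by rewrite (_ : (N.*2 - i.+1.*2).+2 = N.*2 - i.*2)%N ?IH ?mulr0 //; lia.
apply/rowP => k; rewrite [RHS]mxE -v'E; have kN := ltn_ord k.
have [ok|ek] := boolP (odd k).
  by have := odd0 k./2; rewrite (_ : (k./2.*2.+1 = k)%N) //; lia.
by have := even0 (N - k./2)%N; rewrite (_ : (N.*2 - (N - k./2).*2 = k)%N) //; lia.
Qed.

Lemma form_mx_unit : form_mx \in unitmx.
Proof. by rewrite !unitmx_mul Lambda_unit unitmx_tr unitmx_inv basis_mx_unit. Qed.

Lemma form_mx_lo r p : p != col_hi r -> form_mx (col_lo r) p = 0.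
Proof.
move=> ne; have /eqP := form_mx_eig (col_lo r) p; rewrite mulf_eq0 addr_eq0 => /orP[/eqP//|/eqP e].
by have [/(_ r erefl) e' _] := eig_partner e; rewrite e' eqxx in ne.
Qed.

Lemma form_mx_hi r p : p != col_lo r -> form_mx (col_hi r) p = 0.
Proof.
move=> ne; have /eqP := form_mx_eig (col_hi r) p; rewrite mulf_eq0 addr_eq0 => /orP[/eqP//|/eqP e].
by have [_ /(_ r erefl) e'] := eig_partner e; rewrite e' eqxx in ne.
Qed.

Lemma form_mx_anti p p' : form_mx p' p = - form_mx p p'.
Proof.
have LT : (Lambda R n)^T = - Lambda R n.
  by apply/matrixP => i j; rewrite !mxE; apply: lamC.
have : form_mx^T = - form_mx by rewrite /form_mx !trmx_mul trmxK LT mulNmx mulmxN mulmxA.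
by move/matrixP/(_ p p'); rewrite !mxE.
Qed.

Definition form_coef r := form_mx (col_lo r) (col_hi r).

Lemma form_coef_neq0 r : form_coef r != 0.
Proof.
apply/eqP => j0.
have r0 : row (col_lo r) form_mx = 0.
  apply/rowP => p; rewrite [LHS]mxE [RHS]mxE; have [->//|] := eqVneq p (col_hi r).
  exact: form_mx_lo.
have := congr1 (fun M => M *m invmx form_mx) r0; rewrite -row_mul mulmxV ?form_mx_unit // mul0mx.
by move/rowP/(_ (col_lo r)); rewrite !mxE eqxx => /eqP; rewrite oner_eq0.
Qed.

(** The subspace spanned by the rows, in eigencoordinates, is the graph of S after
rescaling by the coefficients of the form. *)
Definition graph_mx (S : 'M[C]_N) : 'M[C]_(N, N.*2) :=
  \matrix_(r, p) (if (p < N)%N then (p == r :> nat)%:R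
    else \sum_j (p == col_hi j)%:R * (S r j / form_coef j)).

Lemma graph_lo (S : 'M[C]_N) r s : graph_mx S r (col_lo s) = (s == r)%:R.
Proof. by rewrite mxE /= ltn_ord. Qed.

Lemma graph_hi (S : 'M[C]_N) r s : graph_mx S r (col_hi s) = S r s / form_coef s.
Proof.
rewrite mxE /= ltnNge leq_addr /= (bigD1 s) //= eqxx mul1r big1 ?addr0 // => j nj.
by rewrite -val_eqE /= eqn_add2l val_eqE eq_sym (negPf nj) mul0r.
Qed.

Lemma graph_lagrangian (S : 'M[C]_N) : (forall i j, S i j = S j i) ->
  lagrangian (graph_mx S *m invmx basis_mx).
Proof.
move=> Ssym; apply/andP; split.
  rewrite /row_free mxrankMfree; last by rewrite row_free_unit unitmx_inv basis_mx_unit.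
  rewrite -/(row_free _) -kermx_eq0; apply/rowV0P => v /sub_kermxP vL.
  apply/rowP => r; have := congr1 (fun M : 'rV_(N.*2) => M 0 (col_lo r)) vL; rewrite !mxE.
  rewrite (bigD1 r) //= big1 ?addr0 => [|s ns]; rewrite graph_lo ?eqxx ?mulr1 //.
  by rewrite eq_sym (negPf ns) mulr0.
have -> : graph_mx S *m invmx basis_mx *m Lambda R n *m (graph_mx S *m invmx basis_mx)^T
   = graph_mx S *m form_mx *m (graph_mx S)^T by rewrite trmx_mul /form_mx !mulmxA.
apply/eqP; apply/matrixP => a b; rewrite [RHS]mxE mxE sum_lo_hi.
have JR r : (graph_mx S *m form_mx) a (col_hi r) = (r == a)%:R * form_coef r.
  rewrite mxE (bigD1 (col_lo r)) //= graph_lo big1 ?addr0 // => p np.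
  by rewrite form_mx_anti form_mx_hi // oppr0 mulr0.
have JL r : (graph_mx S *m form_mx) a (col_lo r) = - S a r.
  rewrite mxE (bigD1 (col_hi r)) //= graph_hi big1 ?addr0 => [|p np].
    by rewrite form_mx_anti mulrN divfK ?form_coef_neq0.
  by rewrite form_mx_anti form_mx_lo // oppr0 mulr0.
rewrite (eq_bigr (fun r => - (S a r * (r == b)%:R) + (r == a)%:R * S b r)); last first.
  move=> r _; rewrite JR JL ![(graph_mx S)^T _ _]mxE graph_lo graph_hi mulNr; congr (_ + _).
  by rewrite -mulrA [form_coef r * _]mulrC divfK ?form_coef_neq0.
rewrite big_split sumrN /= (bigD1 b) //= eqxx mulr1 big1 ?addr0; last by move=> r /negPf->; rewrite mulr0.
rewrite (bigD1 a) //= eqxx mul1r big1 ?addr0; last by move=> r /negPf->; rewrite mul0r.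
by rewrite Ssym addNr.
Qed.

Lemma graph_eigvec_mx (S : 'M[C]_N) : graph_mx S *m invmx basis_mx *m wmx R n *m eigvec_mx = graph_mx S.
Proof. by rewrite -!mulmxA -/basis_mx mulVmx ?basis_mx_unit // mulmx1. Qed.

Local Notation ppoly := {mpoly C[#|{: pindex n}|]}.

(** Columns listed out of order or with repetition give a Plucker coordinate up to sign,
or 0. *)
Lemma exists_minor_poly (g : 'I_N -> 'I_(n.*2)) : exists p : ppoly, p \is 1.-homog /\
  forall t (M : 'M[C]_(N, n.*2)), peval t M p = t * \det (colsub g M).
Proof.
have [/injectiveP ginj|/injectivePn[i1 [i2 ne e]]] := boolP (injectiveb g); last first.
  exists 0; split=> [|t M]; first exact: dhomog0.
  rewrite /peval meval0 -det_tr (determinant_alternate ne) ?mulr0 // => j.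
  by rewrite !mxE e.
have cI : #|[set g k | k : 'I_N]| == n.-1 by rewrite card_imset // card_ord.
pose I : pindex n := exist (fun J : {set 'I_n.*2} => #|J| == n.-1) _ cI.
have surj k : exists k', pcol I k' == g k.
  have gk : g k \in val I by apply: imset_f.
  exists (cast_ord (eqP (valP I)) (enum_rank_in gk (g k))).
  by rewrite /pcol cast_ordK enum_rankK_in.
pose s k := xchoose (surj k).
have sE k : pcol I (s k) = g k by apply/eqP/(xchooseP (surj k)).
have sinj : injective s by move=> k k' /(congr1 (pcol I)); rewrite !sE => /ginj.
exists ((-1) ^+ perm sinj *: Delta R I); split=> [|t M].
  by apply: dhomogZ; rewrite /Delta dhomogX; apply/eqP; apply: mdeg1.
rewrite /peval mevalZ mevalXU enum_rankK /plucker mulrCA; congr (_ * _).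
have -> : colsub g M = col_perm (perm sinj) (colsub (pcol I) M).
  by apply/matrixP => i k; rewrite !mxE permE sE.
by rewrite col_permE det_mulmx det_perm odd_permV mulrC.
Qed.

(** Expand the determinant by multilinearity in the columns of M Y, as in the
Cauchy-Binet formula. *)
Lemma exists_det_poly (Y : 'M[C]_(n.*2, N)) : exists p : ppoly, p \is 1.-homog /\
  forall t (M : 'M[C]_(N, n.*2)), peval t M p = t * \det (M *m Y).
Proof.
have /choice[P hP] : forall f : {ffun 'I_N -> 'I_(n.*2)}, exists p : ppoly, p \is 1.-homog /\
    forall t (M : 'M[C]_(N, n.*2)), peval t M p = t * \det (colsub f M).
  by move=> f; apply: exists_minor_poly.
exists (\sum_(f : {ffun 'I_N -> 'I_(n.*2)}) (\prod_s Y (f s) s) *: P f); split=> [|t M].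
  by apply: rpred_sum => f _; apply: dhomogZ; case: (hP f).
rewrite /peval raddf_sum /=.
transitivity (\sum_(f : {ffun 'I_N -> 'I_(n.*2)} | [forall s : 'I_N, true])
    t * \det (\matrix_(i, s) (M i (f s) * Y (f s) s))).
  apply: eq_big => [f|f _]; first by apply/esym/forallP.
  rewrite mevalZ; have [_ e] := hP f; have := e t M; rewrite /peval => ->.
  rewrite mulrCA -det_scale_cols; congr (_ * \det _).
  by apply/matrixP => i s; rewrite !mxE.
rewrite -mulr_sumr (sum_det_columns (fun _ _ => true) (fun i s x => M i x * Y x s)).
by congr (_ * \det _); apply/matrixP => i s; rewrite !mxE.
Qed.

Variable m : nat.

Definition layer_col (f : filling N m) t (r : 'I_N) : 'I_(N.*2) :=
  if layer f t r is Some j then col_hi j else col_lo r.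

Lemma exists_layer_poly (f : filling N m) : exists p : ppoly, p \is m.-homog /\
  forall t (M : 'M[C]_(N, n.*2)),
    peval t M p = \prod_(i < m) (t * \det (colsub (layer_col f i) (M *m eigvec_mx))).
Proof.
have /choice[P hP] : forall i : nat, exists p : ppoly, p \is 1.-homog /\
    forall t (M : 'M[C]_(N, n.*2)), peval t M p = t * \det (colsub (layer_col f i) (M *m eigvec_mx)).
  move=> i; have [p [hp e]] := exists_det_poly (colsub (layer_col f i) eigvec_mx).
  by exists p; split=> // t M; rewrite e mulmx_colsub.
exists (\prod_(i < m) P i); split=> [|t M].
  elim: (m) => [|k IH]; first by rewrite big_ord0; apply: dhomog1.
  by rewrite big_ord_recr /= -addn1; apply: dhomogM => //; case: (hP k).
rewrite /peval rmorph_prod /=; apply: eq_bigr => i _.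
by have [_ /(_ t M)] := hP i.
Qed.

(** Replacing the column paired below with row s by the one paired above with row j
multiplies the eigenvalue by xi^((s+1)+(j+1)); the eigenvalue without any replacement is
1. *)
Lemma prod_layer_eig (f : filling N m) : is_pp f ->
  \prod_(i < m) \prod_s eig (layer_col f i s) = xi ^+ pp_weight f.
Proof.
move=> hf.
have h i s : eig (layer_col f i s) = (iu * xi ^- s.+1)
    * xi ^+ (if layer f i s is Some j then (s + j + 2)%N else 0%N).
  rewrite /layer_col; case: layer => [j|]; rewrite ?eig_hi ?eig_lo ?expr0 ?mulr1 // -mulrA; congr (_ * _).
  rewrite (_ : (s + j + 2 = s.+1 + j.+1)%N); last by lia.
  by rewrite exprD mulKf // expf_neq0 ?xi_neq0.
have c1 : \prod_(s < N) (iu * xi ^- s.+1) = 1.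
  rewrite big_split /= prodr_const card_ord iuN expr_sum -big_split /= big1 // => s _.
  by rewrite mulfV // expf_neq0 ?xi_neq0.
have -> : pp_weight f = _ := esym (sum_layers hf (fun r j => (r + j + 2)%N)).
rewrite expr_sum; apply: eq_bigr => i _.
rewrite expr_sum; under eq_bigr => s _ do rewrite h.
by rewrite big_split /= c1 mul1r.
Qed.

Lemma det_layer_graph (f : filling N m) t (T : C) :
  \det (colsub (layer_col f t) (graph_mx (\matrix_(i, j) T ^+ entry_weight N m i j)))
  = (\det (layer_mx m form_coef (layer f t))).[T].
Proof.
rewrite -horner_evalE -det_map_mx; congr (\det _); apply/matrixP => i s.
rewrite mxE /layer_col [RHS]mxE [layer_mx _ _ _ _ _]mxE /=.
case: layer => [j|]; first by rewrite graph_hi mxE horner_evalE hornerZ hornerXn mulrC.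
by rewrite graph_lo horner_evalE eq_sym; case: eqP; rewrite ?hornerC ?horner0.
Qed.

Lemma poly_eq0_eval (p : {poly C}) : (forall T, p.[T] = 0) -> p = 0.
Proof.
move=> h; apply: (roots_geq_poly_eq0 (rs := [seq i%:R | i <- iota 0 (size p)])).
- by apply/allP => x _; apply/eqP/h.
- by rewrite map_inj_uniq ?iota_uniq // => x y /eqP; rewrite eqr_nat => /eqP.
by rewrite size_map size_iota.
Qed.

Lemma distinct_sizes_free (T : finType) (p : T -> {poly C}) (a : T -> C) :
  (forall x, (0 < size (p x))%N) -> injective (size \o p) ->
  \sum_x a x *: p x = 0 -> forall x, a x = 0.
Proof.
move=> p0 pinj sum0 x0; apply/eqP; apply: contraT => ax0.
(* among the terms with nonzero coefficient, the one of largest degree cannot cancel *)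
case: (arg_maxnP (P := fun x => a x != 0) (fun x => size (p x)) ax0) => x ax xmax.
have : (\sum_x a x *: p x)`_(size (p x)).-1 = 0 by rewrite sum0 coef0.
rewrite coef_sum (bigD1 x) //= big1 ?addr0 => [|y yx].
  rewrite coefZ => /eqP; rewrite mulf_eq0 (negPf ax) /= -/(lead_coef _) lead_coef_eq0.
  by rewrite -size_poly_eq0 eqn0Ngt p0.
rewrite coefZ; have [->|ay] := eqVneq (a y) 0; first by rewrite mul0r.
rewrite nth_default ?mulr0 // -ltnS prednK //.
rewrite ltn_neqAle (xmax y ay : (_ <= _)%N) andbT.
by apply: contra yx => /eqP/pinj ->.
Qed.

Lemma size_prod_layers (f : filling N m) : is_pp f ->
  size (\prod_(i < m) \det (layer_mx m form_coef (layer f i))) = (total_weight f).+1.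
Proof.
move=> hf.
have S i : size (\det (layer_mx m form_coef (layer f i)))
    = (\sum_s (if layer f i s is Some j then entry_weight N m s j else 0)).+1%N.
  by apply: size_det_layer_mx => [j|]; [exact: form_coef_neq0 | move=> r r' j j'; apply: layer_mono].
rewrite size_prod => [|i _]; last by rewrite -size_poly_eq0 S.
under eq_bigr => i _ do rewrite S -addn1.
by rewrite big_split /= sum1_card -addSn addnK (sum_layers hf (entry_weight N m)).
Qed.

(** The products of minors attached to plane partitions. Linear independence is tested
on graphs of symmetric matrices, where the products have pairwise different degrees. *)
Lemma exists_eigenbasis : exists h : PP N m -> grove R n,
  [/\ forall p, in_grove_deg m (h p),
      forall p, cyc (h p) = xi ^+ pp_weight (val p) *: h p
    & forall a : PP N m -> C, \sum_p a p *: h p = 0 -> forall p, a p = 0].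
Proof.
have /choice[H hH] : forall p : PP N m, exists q : ppoly, q \is m.-homog /\
  forall t (M : 'M[C]_(N, n.*2)),
    peval t M q = \prod_(i < m) (t * \det (colsub (layer_col (val p) i) (M *m eigvec_mx))).
  by move=> p; apply: exists_layer_poly.
exists (fun p => grove_pi (H p)); split=> [p|p|a].
- by exists (H p) => //; case: (hH p).
- have -> : xi ^+ pp_weight (val p) *: grove_pi (H p) = grove_pi ((xi ^+ pp_weight (val p))%:MP * H p).
    by rewrite rmorphM.
  rewrite cyc_pi; apply/grove_piP; apply/asboolP => t A t0 lA.
  have [_ e] := hH p.
  rewrite /peval mevalB mevalM mevalC -!/(peval _ _ _) peval_cyc !e.
  apply/eqP; rewrite subr_eq0 -(prod_layer_eig (valP p)) -big_split /=; apply/eqP.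
  apply: eq_bigr => i _; rewrite mulrCA; congr (_ * _).
  rewrite -det_scale_cols; congr (\det _).
  rewrite -[A *m _ *m _ *m _]mulmxA cmx_eigvec_mx mulmxA; apply/matrixP => r s.
  by rewrite mxE mul_mx_diag [RHS]mxE [LHS]mxE [in RHS]mxE !mxE.
move=> sum0.
have I0 : \sum_p a p *: H p \in grove_ideal (n := n) (R := R).
  rewrite -[X in X \in _]subr0; apply/grove_piP.
  rewrite rmorph0 raddf_sum -[RHS]sum0; apply: eq_bigr => p _.
  transitivity (grove_pi ((a p)%:MP * H p)); first by rewrite mul_mpolyC.
  by rewrite rmorphM.
apply: (distinct_sizes_free (p := fun p : PP N m => \prod_(i < m) \det (layer_mx m form_coef (layer (val p) i)))).
- by move=> p; rewrite size_prod_layers ?(valP p).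
- move=> p p' /=; rewrite !size_prod_layers ?(valP p) ?(valP p') // => -[e].
  by apply/val_inj/(total_weight_inj (valP p) (valP p') e).
apply: poly_eq0_eval => T.
pose S : 'M[C]_N := \matrix_(i, j) T ^+ entry_weight N m i j.
have Ssym i j : S i j = S j i by rewrite !mxE entry_weightC.
have /asboolP := I0 => /(_ 1 (graph_mx S *m invmx basis_mx) (oner_neq0 _) (graph_lagrangian Ssym)).
rewrite /peval raddf_sum /= => E; rewrite -[RHS]E horner_sum; apply: eq_bigr => p _.
rewrite hornerZ mevalZ; congr (_ * _).
have [_ e] := hH p; rewrite -/(peval _ _ _) e graph_eigvec_mx horner_prod.
by apply: eq_bigr => i _; rewrite mul1r det_layer_graph.
Qed.

End Eigenbasis.

(** * The trace of the cyclic action *)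

Section Trace.
Local Open Scope ring_scope.
Variables (R : realType) (n m : nat).
Local Notation C := R[i].
Local Notation T := (PP n.-1 m).
Hypothesis n_gt0 : (0 < n)%N.
Variable b : T -> grove R n.
Hypothesis b_basis : is_basis_of_deg m b.
Hypothesis b_cyc : forall p, cyc (b p) = b (Pr n.-1 m p).
Variable xi : C.
Hypothesis xi_prim : n.*2.-primitive_root xi.

Lemma cyc_sum (I : finType) (a : I -> C) (x : I -> grove R n) :
  cyc (\sum_i a i *: x i) = \sum_i a i *: cyc (x i).
Proof.
have E (c : C) (y : grove R n) : c *: y = grove_pi (c%:MP) * y by [].
have xE i : x i = grove_pi (repr (x i)) by rewrite /grove_pi reprK.
transitivity (cyc (grove_pi (\sum_i (a i)%:MP * repr (x i)))).
  congr cyc; rewrite rmorph_sum; apply: eq_bigr => i _.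
  by rewrite E {1}xE rmorphM.
rewrite cyc_pi.
transitivity (grove_pi (\sum_i (a i)%:MP * cyc_poly (repr (x i)))).
  congr grove_pi; rewrite /cyc_poly rmorph_sum; apply: eq_bigr => i _ /=.
  by rewrite rmorphM /= comp_mpolyC.
rewrite rmorph_sum; apply: eq_bigr => i _ /=.
by rewrite E rmorphM /=; congr (_ * _); rewrite [in RHS]xE cyc_pi.
Qed.

(** The eigenvectors expanded in the given basis: applying c to the expansion permutes
the coefficients by promotion. *)
Lemma promotion_eigenbasis : exists B : T -> T -> C,
  [/\ forall a : T -> C, (forall q, \sum_p a p * B p q = 0) -> forall p, a p = 0
    & forall p q k, B p (((Pr n.-1 m)^-1 ^+ k)%g q) = xi ^+ (k * pp_weight (val p)) * B p q].
Proof.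
have [bdeg bfree bspan] := b_basis.
have [iu [iu2 iuN]] := exists_imaginary n_gt0 xi_prim.
have [h [hdeg hcyc hfree]] := exists_eigenbasis n_gt0 xi_prim iu2 iuN m.
have /choice[B hB] : forall p, exists a : T -> C, h p = \sum_q a q *: b q.
  by move=> p; apply/bspan/hdeg.
have step p q : B p ((Pr n.-1 m)^-1%g q) = xi ^+ pp_weight (val p) * B p q.
  apply/eqP; rewrite -subr_eq0; apply/eqP; move: q; apply: bfree.
  have := hcyc p; rewrite hB cyc_sum scaler_sumr.
  rewrite (reindex_inj (@perm_inj _ (Pr n.-1 m)^-1%g)) /= => e.
  under eq_bigr => q _ do rewrite scalerBl -scalerA.
  rewrite sumrB -e; apply/eqP; rewrite subr_eq0; apply/eqP; apply: eq_bigr => q _.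
  by rewrite b_cyc permKV.
exists B; split=> [a ha|p q k].
  apply: hfree; under eq_bigr => p _ do rewrite hB scaler_sumr.
  rewrite exchange_big big1 // => q _ /=.
  under eq_bigr => p _ do rewrite scalerA.
  by rewrite -scaler_suml ha scale0r.
elim: k q => [|k IH] q; first by rewrite expg0 perm1 mul0n expr0 mul1r.
by rewrite expgS permM IH step mulrA -exprD mulSnr.
Qed.

(** The matrix B of coefficients is square with independent rows, hence invertible, and
conjugates the permutation matrix of Pr^-k to a diagonal matrix. Comparing traces gives
the formula. *)
Lemma card_fixed_Pr k :
  #|[set p : T | (Pr n.-1 m ^+ k)%g p == p]|%:R = \sum_(p : T) xi ^+ (k * pp_weight (val p)).
Proof.
have [B [Bfree Bstep]] := promotion_eigenbasis.
pose M : 'M[C]_#|{: T}| := \matrix_(i, j) B (enum_val i) (enum_val j).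
pose P : 'M[C]_#|{: T}| := \matrix_(i, j) (enum_val i == ((Pr n.-1 m)^-1 ^+ k)%g (enum_val j))%:R.
pose d : 'rV[C]_#|{: T}| := \row_i xi ^+ (k * pp_weight (val (enum_val i : T))).
have sum_enum (F : T -> C) : \sum_(i < #|{: T}|) F (enum_val i) = \sum_p F p.
  by rewrite -(big_enum_val F); apply: eq_bigl.
have Munit : M \in unitmx.
  rewrite -row_free_unit -kermx_eq0; apply/rowV0P => v /sub_kermxP vM.
  apply/rowP => i; rewrite [RHS]mxE -(enum_valK i).
  apply: (Bfree (fun p => v 0 (enum_rank p))) => q.
  have := congr1 (fun A : 'rV_#|{: T}| => A 0 (enum_rank q)) vM; rewrite [RHS]mxE mxE => e.
  rewrite -[RHS]e -[LHS](sum_enum (fun p => v 0 (enum_rank p) * B p q)).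
  by apply: eq_bigr => j _; rewrite mxE enum_valK enum_rankK.
have MP : M *m P = diag_mx d *m M.
  apply/matrixP => i j; rewrite mul_diag_mx !mxE -Bstep.
  pose q := ((Pr n.-1 m)^-1 ^+ k)%g (enum_val j); rewrite -/q.
  rewrite (bigD1 (enum_rank q)) //= !mxE enum_rankK eqxx mulr1 big1 ?addr0 // => l nl.
  by rewrite !mxE (_ : (enum_val l == q) = false) ?mulr0 //; apply: contraNF nl => /eqP <-; rewrite enum_valK.
have trP : \tr P = \sum_(p : T) xi ^+ (k * pp_weight (val p)).
  have -> : P = invmx M *m (diag_mx d *m M) by rewrite -MP mulKmx.
  rewrite mxtrace_mulC -mulmxA mulmxV // mulmx1 mxtrace_diag.
  by rewrite -[RHS](sum_enum (fun p => xi ^+ (k * pp_weight (val p)))); apply: eq_bigr => i _; rewrite mxE.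
rewrite -trP -sum1_card natr_sum /mxtrace big_mkcond /=.
rewrite -[LHS](sum_enum (fun p => if p \in [set p : T | (Pr n.-1 m ^+ k)%g p == p] then 1%N%:R else 0 : C)) /=.
apply: eq_bigr => i _; rewrite !mxE inE.
have -> : (enum_val i == ((Pr n.-1 m)^-1 ^+ k)%g (enum_val i)) = ((Pr n.-1 m ^+ k)%g (enum_val i) == enum_val i).
  by rewrite expVgn; apply/eqP/eqP => e; [rewrite [in LHS]e permKV | rewrite -[in RHS]e permK].
by case: ifP.
Qed.

(** If Pr^k = 1 then c^k fixes every eigenvector, as each has a nonzero coefficient in
the basis. *)
Lemma promotion_trivial k : (Pr n.-1 m ^+ k = 1)%g -> forall p : T, xi ^+ (k * pp_weight (val p)) = 1.
Proof.
move=> Pk p; have [B [Bfree Bstep]] := promotion_eigenbasis.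
have [/existsP[q Bpq]|no] := boolP [exists q, B p q != 0].
  apply: (mulIf Bpq); rewrite -Bstep expVgn Pk invg1 perm1 mul1r //.
have H q : \sum_p' (p' == p)%:R * B p' q = 0.
  rewrite (bigD1 p) //= eqxx mul1r big1 ?addr0 => [|p' /negPf->]; last by rewrite mul0r.
  by apply/eqP; move: no; rewrite negb_exists => /forallP/(_ q); rewrite negbK.
by have /eqP := Bfree _ H p; rewrite eqxx oner_eq0.
Qed.
End Trace.

(** * Roots of unity, weights and the theorem *)

Local Open Scope ring_scope.

Section Zeta.
Variable R : realType.
Local Notation C := R[i].

Definition cis (t : R) : C := (trigo.cos t +i* trigo.sin t)%C.

Lemma cisD s t : cis (s + t) = cis s * cis t.
Proof.
rewrite /cis trigo.cosD trigo.sinD; apply/eqP; rewrite eq_complex /=.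
by rewrite eqxx /= addrC [X in _ + X]mulrC [X in X + _]mulrC [X in _ == X]addrC; apply/eqP; ring.
Qed.

Lemma cisX t k : cis t ^+ k = cis (k%:R * t).
Proof.
elim: k => [|k IH]; first by rewrite mul0r /cis trigo.cos0 trigo.sin0.
by rewrite exprS IH -cisD -[k.+1]add1n natrD mulrDl mul1r.
Qed.

(** cos t = 1 forces sin(t / 2) = 0. *)
Lemma cis_neq1 t : 0 < t < 2 * trigo.pi -> cis t != 1.
Proof.
case/andP=> t0 t2; apply/negP; rewrite eq_complex /= => /andP[/eqP c1 _].
have h : 0 < trigo.sin (t / 2).
  by apply: trigo.sin_gt0_pi; rewrite divr_gt0 //= ltr_pdivrMr // mulrC.
have := trigo.cosD (t / 2) (t / 2); rewrite -splitr c1.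
have := trigo.cos2Dsin2 (t / 2); rewrite !expr2 => e1 e2.
have : trigo.sin (t / 2) * trigo.sin (t / 2) = 0 by lra.
by move/eqP; rewrite mulf_eq0 orbb gt_eqF.
Qed.

Lemma cis_prim k : (0 < k)%N -> k.-primitive_root (cis (2 * trigo.pi / k%:R)).
Proof.
move=> k0; have k0' : 0 < k%:R :> R by rewrite ltr0n.
rewrite /primitive_root_of_unity k0; apply/forallP => i; apply/eqP.
rewrite unity_rootE cisX; have [e|ne] := eqVneq i.+1 k.
  have kn : k%:R != 0 :> R by rewrite gt_eqF.
  have -> : i.+1%:R * (2 * trigo.pi / k%:R) = trigo.pi *+ 2 :> R by rewrite e; field.
  rewrite /cis trigo.cos2pi trigo.sin2pi.
  by rewrite eqxx.
apply/negbTE/cis_neq1; apply/andP; split.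
  by rewrite mulr_gt0 ?ltr0n // divr_gt0 // mulr_gt0 ?trigo.pi_gt0.
rewrite mulrCA gtr_pMr; last by rewrite mulr_gt0 ?trigo.pi_gt0.
by rewrite ltr_pdivrMr // mul1r ltr_nat ltn_neqAle ne ltn_ord.
Qed.
End Zeta.

Section SmallWeights.
Variables (N m s : nat).
Hypothesis m_gt0 : (0 < m)%N.
Hypothesis sN : (s < N)%N.

(** Plane partitions whose only cell with nonzero excess is (1, N - s). *)
Definition step_filling : filling N m := [ffun c => inord (m - (N - s <= ccol c)%N)].

Lemma step_entry a b : (0 < a)%N -> (a + b <= N.+1)%N ->
  entry step_filling a b = (m - (N - s <= b)%N)%N.
Proof.
move=> a0 ab; have [->|b0] := posnP b.
  rewrite entry0r (_ : (N - s <= 0)%N = false) ?subn0 //; lia.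
have [c [<- <-]] := cell_exists a0 b0 ab.
by rewrite entry_cell ffunE inordK // ltnS leq_subr.
Qed.

Lemma step_pp : is_pp step_filling.
Proof.
apply/forallP => c; have c1 := crow_gt0 c; have c2 := ccol_gt0 c; have c3 := cell_leN c.
rewrite -entry_cell; have [e|ne] := eqVneq (crow c + ccol c)%N N.+1.
  by rewrite (@entry_out _ _ _ (crow c).+1) ?(@entry_out _ _ _ (crow c) (ccol c).+1) //; lia.
rewrite !step_entry ?leqnn /=; try lia.
Qed.

Lemma pp_weight_step : pp_weight step_filling = (s + 2)%N.
Proof.
have N0 : (0 < N)%N by lia.
have eeE' (r j : 'I_N) : (r <= j)%N ->
   excess_tri step_filling r j = ((r == Ordinal N0) && (j == Ordinal sN))%N :> nat.
  move=> rj; have jN := ltn_ord j; rewrite /excess_tri -!val_eqE /=.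
  rewrite (@step_entry r.+1 (N - j)) ?(@step_entry r.+1 (N - j).-1); try lia.
  case: (posnP r) => [r0|r0]; last by rewrite step_entry; lia.
  by rewrite r0 entry0l; lia.
rewrite /pp_weight (bigD1 (Ordinal N0)) //= [X in (_ + X)%N]big1 ?addn0 => [|r nr]; last first.
  by rewrite big1 // => j rj; rewrite eeE' // (negPf nr) muln0.
rewrite (bigD1 (Ordinal sN)) //= big1 ?addn0 => [|j nj]; last first.
  by rewrite (eeE' (Ordinal N0)) // (negPf nj) andbF muln0.
by rewrite (eeE' (Ordinal N0) (Ordinal sN)) // !eqxx muln1.
Qed.
End SmallWeights.

Lemma exists_pp_weight N m s : (0 < m)%N -> (s < N)%N -> exists p : PP N m, pp_weight (val p) = (s + 2)%N.
Proof. by move=> m0 sN; exists (Sub _ (step_pp m0 sN)); apply: pp_weight_step. Qed.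

Lemma tofrac_inj_int (p q : {poly int}) : tofrac p = tofrac q -> p = q.
Proof. by move/eqP; rewrite tofrac_eq => /eqP. Qed.

Lemma pp_weight_product N m :
  (\sum_(p : PP N m) 'X^(pp_weight (val p)))
    * (\prod_(i < N) \prod_(j < N | (i <= j)%N) (1 - 'X^(i + j + 2)))
  = \prod_(i < N) \prod_(j < N | (i <= j)%N) (1 - 'X^(2 * m + i + j + 2)%N) :> {poly int}.
Proof.
apply: tofrac_inj_int.
have q0 : tofrac 'X != 0 :> {fraction {poly int}} by rewrite tofrac_eq0 polyX_eq0.
have q1 i : (0 < i <= N.*2)%N -> tofrac 'X ^+ i != 1 :> {fraction {poly int}}.
  move=> h; rewrite -rmorphXn -(rmorph1 (@tofrac _)) tofrac_eq.
  apply/eqP => /(congr1 (fun p : {poly int} => size p)); rewrite size_polyXn size_poly1; lia.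
have := king_product m q0 q1; rewrite -sum_pp_weight => E.
rewrite rmorphM rmorph_sum !rmorph_prod.
transitivity ((\sum_(p : PP N m) tofrac 'X ^+ pp_weight (val p))
   * \prod_(i < N) \prod_(j < N | (i <= j)%N) (1 - tofrac 'X ^+ (i + j + 2)) : {fraction {poly int}}).
  congr (_ * _); first by apply: eq_bigr => p _; rewrite rmorphXn.
  apply: eq_bigr => i _; rewrite rmorph_prod; apply: eq_bigr => j _.
  by rewrite rmorphB rmorph1 rmorphXn.
rewrite E; apply: eq_bigr => i _; rewrite rmorph_prod; apply: eq_bigr => j _.
by rewrite rmorphB rmorph1 rmorphXn.
Qed.

(** The quotient 2 / kappa n, by which all weights are divisible. *)
Definition cokappa n : nat := if (3 <= n)%N then 1 else 2.

Lemma kappa_half n x : (kappa n * x)./2 = (x %/ cokappa n)%N.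
Proof. by rewrite /kappa /cokappa; case: ifP => _; lia. Qed.

Lemma cokappa_dvd n i j : (i < n.-1)%N -> (j < n.-1)%N -> (cokappa n %| i + j + 2)%N.
Proof. by rewrite /cokappa; case: ifP => h hi hj; rewrite ?dvd1n //; have [-> ->] : i = 0%N /\ j = 0%N by lia. Qed.

Lemma cokappa_pp_weight n m (f : filling n.-1 m) : (cokappa n %| pp_weight f)%N.
Proof.
apply: dvdn_sum => i _; apply: dvdn_sum => j _; apply: dvdn_mulr.
exact: cokappa_dvd.
Qed.

Definition sieving_poly n m : {poly int} := \sum_(p : PP n.-1 m) 'X^(pp_weight (val p) %/ cokappa n).

(** For kappa = 1 the substitution of X^2 for X reduces the identity to the one with
undivided exponents. *)
Lemma sieving_poly_product n m :
  sieving_poly n m * (\prod_(i < n.-1) \prod_(j < n.-1 | (i <= j)%N) (1 - 'X^((i + j + 2) %/ cokappa n)))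
  = \prod_(i < n.-1) \prod_(j < n.-1 | (i <= j)%N) (1 - 'X^((2 * m + i + j + 2) %/ cokappa n)).
Proof.
have e0 : (0 < cokappa n)%N by rewrite /cokappa; case: ifP.
have compX k : (cokappa n %| k)%N -> 'X^(k %/ cokappa n) \Po 'X^(cokappa n) = 'X^k :> {poly int}.
  by move=> h; rewrite rmorphXn /= comp_polyX -exprM mulnC divnK.
have comp1 k : (cokappa n %| k)%N ->
    (1 - 'X^(k %/ cokappa n)) \Po 'X^(cokappa n) = 1 - 'X^k :> {poly int}.
  by move=> h; rewrite comp_polyB compX // comp_polyC.
apply/eqP; rewrite -subr_eq0 -(@comp_poly_eq0 _ _ 'X^(cokappa n)) ?size_polyXn ?ltnS //.
rewrite comp_polyB comp_polyM subr_eq0; apply/eqP.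
have := pp_weight_product n.-1 m; rewrite /sieving_poly !rmorph_prod rmorph_sum /=.
set A := \sum_p _; set A' := \sum_p _; have -> : A' = A.
  by apply: eq_bigr => p _; rewrite compX // cokappa_pp_weight.
move=> E; transitivity (A * \prod_(i < n.-1) \prod_(j < n.-1 | (i <= j)%N) (1 - 'X^(i + j + 2))).
  congr (_ * _); apply: eq_bigr => i _; rewrite rmorph_prod; apply: eq_bigr => j _ /=.
  by rewrite comp1 // cokappa_dvd.
rewrite E; apply: eq_bigr => i _; rewrite rmorph_prod; apply: eq_bigr => j _ /=.
rewrite comp1 // (_ : 2 * m + i + j + 2 = 2 * m + (i + j + 2))%N; last by lia.
have := cokappa_dvd (ltn_ord i) (ltn_ord j).
rewrite /cokappa; case: ifP => _; rewrite ?dvd1n // => h; rewrite dvdn_addl //.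
exact: dvdn_mulr.
Qed.

Lemma Omega_sieving_poly n m : Omega n m = tofrac (sieving_poly n m).
Proof.
have nz (d : nat) : (0 < d)%N -> tofrac (1 - 'X^d : {poly int}) != 0.
  move=> d0; rewrite tofrac_eq0 subr_eq0 eq_sym; apply/eqP.
  by move/(congr1 (fun p : {poly int} => size p)); rewrite size_polyXn size_poly1; lia.
have reindex2 (F : nat -> nat -> {fraction {poly int}}) :
    \prod_(1 <= i < n) \prod_(i <= j < n) F i j
    = \prod_(i < n.-1) \prod_(j < n.-1 | (i <= j)%N) F i.+1 j.+1.
  rewrite big_add1 big_mkord; apply: eq_bigr => i _.
  by rewrite big_add1 big_geq_mkord.
rewrite /Omega reindex2.
under eq_bigr => i _ do rewrite prodf_div.
rewrite prodf_div.
set D := (X in _ / X); have D0 : D != 0.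
  apply/prodf_neq0 => i _; apply/prodf_neq0 => j _; apply: nz; rewrite kappa_half.
  by rewrite /cokappa; case: ifP; lia.
apply: (mulIf D0); rewrite divfK //.
have := congr1 (@tofrac _) (sieving_poly_product n m); rewrite rmorphM !rmorph_prod /= => E.
transitivity (\prod_(i < n.-1) tofrac (\prod_(j < n.-1 | (i <= j)%N)
    (1 - 'X^((2 * m + i + j + 2) %/ cokappa n)) : {poly int})).
  apply: eq_bigr => i _; rewrite rmorph_prod; apply: eq_bigr => j _.
  by rewrite kappa_half (_ : 2 * m + i.+1 + j.+1 = 2 * m + i + j + 2)%N //; lia.
rewrite -E; congr (_ * _); apply: eq_bigr => i _; rewrite rmorph_prod; apply: eq_bigr => j _.
by rewrite kappa_half (_ : i.+1 + j.+1 = i + j + 2)%N //; lia.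
Qed.

Theorem lemma4p4 (R : realType) (n m : nat) (n_gt0 : (0 < n)%N) (m_gt0 : (0 < m)%N)
    (b : PP n.-1 m -> grove R n)
    (b_basis : is_basis_of_deg m b)
    (b_cyc : forall p : PP n.-1 m, cyc (b p) = b (Pr n.-1 m p)) :
  (exists P : {poly int},
    [/\ Omega n m = tofrac P,
        forall i : nat, 0 <= P`_i
      & forall k : nat,
          #|[set p : PP n.-1 m | (Row n.-1 m ^+ k)%g p == p]|%:R
          = (map_poly intr P).[zeta R n ^+ k]])
  /\ <[Row n.-1 m]>%g \isog Zp (kappa n * n).
Proof.
pose xi : R[i] := cis (2 * trigo.pi / n.*2%:R).
have n2 : (0 < n.*2)%N by rewrite double_gt0.
have xi_prim : n.*2.-primitive_root xi := cis_prim R n2.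
have zetaE : zeta R n = xi ^+ cokappa n.
  rewrite cisX -[LHS]/(cis (2 * trigo.pi / (kappa n * n)%:R)); congr cis.
  have n0 : n%:R != 0 :> R by rewrite pnatr_eq0 -lt0n.
  rewrite /kappa /cokappa -mul2n !natrM; case: ifP => _; field; rewrite ?n0 //.
have fixed k : #|[set p : PP n.-1 m | (Row n.-1 m ^+ k)%g p == p]|%:R
     = \sum_(p : PP n.-1 m) xi ^+ (k * pp_weight (val p)).
  by rewrite card_fixed_Row_Pr; apply: card_fixed_Pr n_gt0 b b_basis b_cyc xi xi_prim k.
split.
  exists (sieving_poly n m); split=> [|i|k]; first exact: Omega_sieving_poly.
    by rewrite coef_sum; apply: sumr_ge0 => p _; rewrite coefXn.
  rewrite fixed rmorph_sum horner_sum; apply: eq_bigr => p _.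
  rewrite rmorphXn /= map_polyX hornerXn zetaE -!exprM; congr (_ ^+ _).
  by rewrite -mulnA mulnCA [(cokappa n * _)%N]mulnC divnK ?cokappa_pp_weight.
have Row_order k : (Row n.-1 m ^+ k == 1)%g = (kappa n * n %| k)%N.
  have xi1 w : (xi ^+ (k * w) == 1) = (n.*2 %| k * w)%N by rewrite (prim_order_dvd xi_prim).
  apply/eqP/idP => [Rk|kn].
    have Pk : (Pr n.-1 m ^+ k = 1)%g.
      have [h e] := Row_conj_Pr n.-1 m; move: Rk; rewrite e -conjXg => /eqP.
      by rewrite conjg_eq1 => /eqP.
    have P1 := promotion_trivial n_gt0 b_basis b_cyc xi_prim Pk.
    have dvd s : (s < n.-1)%N -> (n.*2 %| k * (s + 2))%N.
      by move=> sn; have [p <-] := exists_pp_weight m_gt0 sn; rewrite -xi1 P1.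
    rewrite /kappa; case: ifP => n3.
      (* the difference of the weights 3 and 2 *)
      have d0 := dvd 0%N ltac:(lia); have d1 := dvd 1%N ltac:(lia).
      by have := dvdn_sub d1 d0; rewrite -mulnBr muln1 mul2n.
    rewrite mul1n; case: (ltnP 1 n) => n1; last first.
      by have -> : n = 1%N by lia; rewrite dvd1n.
    by have := dvd 0%N ltac:(lia); rewrite -muln2 dvdn_pmul2r.
  apply/permP => p; rewrite perm1; apply/eqP.
  have : #|[set p : PP n.-1 m | (Row n.-1 m ^+ k)%g p == p]| = #|{: PP n.-1 m}|.
    apply/eqP; rewrite -(eqr_nat R[i]) fixed -sum1_card natr_sum; apply/eqP.
    apply: eq_bigr => p' _; apply/eqP; rewrite xi1.
    rewrite -(divnK (cokappa_pp_weight (val p'))) mulnCA; apply: dvdn_mull.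
    have -> : n.*2 = (kappa n * n * cokappa n)%N by rewrite /kappa /cokappa; case: ifP; lia.
    by rewrite dvdn_pmul2r // /cokappa; case: ifP.
  move=> /eqP; rewrite -cardsT => /eqP e.
  have : [set p : PP n.-1 m | (Row n.-1 m ^+ k)%g p == p] = setT.
    by apply/eqP; rewrite eqEcard subsetT /= e.
  by move/setP/(_ p); rewrite !inE.
have -> : (kappa n * n)%N = #[Row n.-1 m]%g.
  apply/eqP; rewrite eqn_dvd order_dvdn Row_order dvdnn andbT.
  by rewrite -Row_order -order_dvdn.
by rewrite isog_sym Zp_isog.
Qed.
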